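(* Let $b\in C^1[0,\infty)$ be real-valued and satisfy (A1) $b(t)\ge 0$ for all $t\in[0,\infty)$, (A2) $|b(t)|\le C_1\langle t\rangle^{-1}$ and $|b'(t)|\le C_2\langle t\rangle^{-2}$ for all $t\ge 0$, with constants $C_1,C_2$. Assume further that $\limsup_{t\to\infty} t\,b(t)<\tfrac12$ and $\operatorname{Ker}A=\{0\}$. Then to all $u_1\in\mathcal D(\Lambda)$ and $u_2\in H$ there exist corresponding data $(v_1,v_2)=W_+(u_1,u_2)\in E$ such that the solutions $u$ of $u''+2b(t)u'+Au=0$, $u(0)=u_1$, $u'(0)=u_2$, and $v$ of $v''+Av=0$, $v(0)=v_1$, $v'(0)=v_2$, satisfy $$\|\lambda(t)(u(t),u'(t))-(v(t),v'(t))\|_E\to 0\qquad\text{as } t\to\infty,$$ where $\lambda(t)=\exp\left(\int_0^t b(\tau)\,d\tau\right)$.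
   Context: $H$ is a separable Hilbert space with norm $\|\cdot\|$, $A$ is a closed, self-adjoint, non-negative operator in $H$ with domain $\mathcal D(A)$, and $\Lambda=\sqrt A$ with domain $\mathcal D(\Lambda)$. $\langle t\rangle=(1+t^2)^{1/2}$. The abstract energy space $E$ is the closure (completion) of $(\mathcal D(\Lambda)\ominus\operatorname{Ker}\Lambda)\times H$ with respect to the norm $\|(u_1,u_2)\|_E=\|(\Lambda u_1,u_2)\|_{H\times H}$; here $\ominus\operatorname{Ker}\Lambda$ means the part orthogonal to $\operatorname{Ker}\Lambda$. The map $J(u_1,u_2)=(\Lambda u_1,u_2)$ extends to a unitary identification $J:E\to (H\ominus\operatorname{Ker}\Lambda)\times H$. Solutions for data in $E$ are understood in the energy space: $U(t)=J(u(t),u'(t))=(\Lambda u,u')$ is the unique (mild) solution of $$U'(t)=\begin{pmatrix}0&\Lambda\\-\Lambda&-2b(t)\end{pmatrix}U(t),\qquad U(0)=J(u_1,u_2),$$ that is, $U\in C([0,\infty);H\times H)$ with $U(t)=\mathcal E_0(t)U(0)-\int_0^t\mathcal E_0(t-s)\begin{pmatrix}0&0\\0&2b(s)\end{pmatrix}U(s)\,ds$, where $\mathcal E_0(t)$ is the unitary group on $H\times H$ generated by the skew-adjoint operator $\begin{pmatrix}0&\Lambda\\-\Lambda&0\end{pmatrix}$ on $\mathcal D(\Lambda)\times\mathcal D(\Lambda)$. Solutions of the free problem $v''+Av=0$ are defined in the same way with $b\equiv0$. *)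

(* Defs.v *)
From Stdlib Require Import Reals.
From Coquelicot Require Import Coquelicot.

Open Scope R_scope.

(** * Completeness of products *)

Section ProdComplete.

Context {K : AbsRing} (V W : CompleteNormedModule K).

Definition prod_lim (F : ((V * W) -> Prop) -> Prop) : V * W :=
  (lim (filtermap fst F), lim (filtermap snd F)).

Lemma prod_lim_spec (F : ((V * W) -> Prop) -> Prop) :
  ProperFilter F -> cauchy F -> forall eps : posreal, F (ball (prod_lim F) eps).
Proof.
intros PF CF eps.
assert (H1 : filtermap fst F (ball (lim (filtermap fst F)) eps)).
{ apply complete_cauchy.
  - apply filtermap_proper_filter; exact PF.
  - intros e; destruct (CF e) as [p Hp]; exists (fst p).
    unfold filtermap; revert Hp; apply filter_imp; intros q [Hq _]; exact Hq. }
assert (H2 : filtermap snd F (ball (lim (filtermap snd F)) eps)).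
{ apply complete_cauchy.
  - apply filtermap_proper_filter; exact PF.
  - intros e; destruct (CF e) as [p Hp]; exists (snd p).
    unfold filtermap; revert Hp; apply filter_imp; intros q [_ Hq]; exact Hq. }
apply (filter_imp (F := F)
  (fun q => ball (lim (filtermap fst F)) eps (fst q) /\
            ball (lim (filtermap snd F)) eps (snd q))).
- intros q [Hq1 Hq2]; split; assumption.
- apply filter_and; [exact H1 | exact H2].
Qed.

Lemma prod_lim_close (F1 F2 : ((V * W) -> Prop) -> Prop) :
  filter_le F1 F2 -> filter_le F2 F1 -> close (prod_lim F1) (prod_lim F2).
Proof.
intros H1 H2 eps; split.
- refine (close_lim (filtermap fst F1) (filtermap fst F2) _ _ eps);
    intros P; unfold filtermap; [apply H1 | apply H2].
- refine (close_lim (filtermap snd F1) (filtermap snd F2) _ _ eps);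
    intros P; unfold filtermap; [apply H1 | apply H2].
Qed.

Canonical prod_CompleteNormedModule : CompleteNormedModule K :=
  CompleteNormedModule.Pack K (V * W)%type
    (CompleteNormedModule.Class K (V * W)%type
       (NormedModule.class K (prod_NormedModule K V W))
       (CompleteSpace.Mixin _ prod_lim prod_lim_spec prod_lim_close))
    (V * W)%type.

End ProdComplete.

(** * Restriction of scalars from [C] to [R]

    Coquelicot's Riemann integral takes values in real normed modules. *)

Section RestrictScalars.

Variable V : NormedModule C_AbsRing.

Definition rscal (r : R) (x : V) : V := @scal C_AbsRing V (RtoC r) x.

Lemma rscal_assoc (r s : R_AbsRing) (x : V) :
  rscal r (rscal s x) = rscal (mult r s) x.
Proof.
unfold rscal; rewrite (@scal_assoc C_AbsRing V); f_equal.
change (mult r s) with (Rmult r s); rewrite RtoC_mult; reflexivity.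
Qed.

Lemma rscal_one (x : V) : rscal (@one R_AbsRing) x = x.
Proof. exact (@scal_one C_AbsRing V x). Qed.

Lemma rscal_distr_l (r : R_AbsRing) (x y : V) :
  rscal r (plus x y) = plus (rscal r x) (rscal r y).
Proof. exact (@scal_distr_l C_AbsRing V _ x y). Qed.

Lemma rscal_distr_r (r s : R_AbsRing) (x : V) :
  rscal (plus r s) x = plus (rscal r x) (rscal s x).
Proof.
unfold rscal; change (plus r s) with (Rplus r s); rewrite RtoC_plus.
exact (@scal_distr_r C_AbsRing V _ _ x).
Qed.

Definition restrict_ModuleSpace_mixin :
    ModuleSpace.mixin_of R_AbsRing (NormedModule.AbelianGroup C_AbsRing V) :=
  ModuleSpace.Mixin R_AbsRing (NormedModule.AbelianGroup C_AbsRing V)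
    rscal rscal_assoc rscal_one rscal_distr_l rscal_distr_r.

Definition restrict_NormedModuleAux : NormedModuleAux R_AbsRing :=
  NormedModuleAux.Pack R_AbsRing V
    (NormedModuleAux.Class R_AbsRing V
       (ModuleSpace.Class R_AbsRing V
          (AbelianGroup.class (NormedModule.AbelianGroup C_AbsRing V))
          restrict_ModuleSpace_mixin)
       (UniformSpace.class (NormedModule.UniformSpace C_AbsRing V)))
    V.

Lemma norm_rscal (r : R_AbsRing) (x : V) : norm (rscal r x) <= abs r * norm x.
Proof.
unfold rscal; eapply Rle_trans; [exact (@norm_scal C_AbsRing V _ x) |].
apply Req_le; f_equal; exact (Cmod_R r).
Qed.

Definition restrict_NormedModule_mixin :
    NormedModule.mixin_of R_AbsRing restrict_NormedModuleAux :=
  NormedModule.Mixin R_AbsRing restrict_NormedModuleAux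
    (@norm C_AbsRing V) (@norm_factor C_AbsRing V)
    norm_triangle norm_rscal norm_compat1 norm_compat2 norm_eq_zero.

Definition restrict_R : NormedModule R_AbsRing :=
  NormedModule.Pack R_AbsRing V
    (NormedModule.Class R_AbsRing V
       (NormedModuleAux.class R_AbsRing restrict_NormedModuleAux)
       restrict_NormedModule_mixin)
    V.

End RestrictScalars.

Arguments rscal {V} r x.

(** * Complex Hilbert spaces *)

(** The inner product is linear in its first argument. *)
Record CHilbert : Type := {
  hilbert_space :> CompleteNormedModule C_AbsRing;
  inner : hilbert_space -> hilbert_space -> C;
  inner_conj : forall x y, inner y x = Cconj (inner x y);
  inner_plus : forall x y z, inner (plus x y) z = Cplus (inner x z) (inner y z);
  inner_scal : forall (a : C_AbsRing) x y, inner (scal a x) y = Cmult a (inner x y);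
  inner_norm : forall x, inner x x = RtoC (norm x ^ 2)
}.

Arguments inner {c} _ _.

Section HilbertProd.

Variables H1 H2 : CHilbert.

Definition prod_inner (x y : H1 * H2) : C :=
  Cplus (inner (fst x) (fst y)) (inner (snd x) (snd y)).

Lemma prod_inner_conj x y : prod_inner y x = Cconj (prod_inner x y).
Proof.
unfold prod_inner; rewrite (inner_conj _ (fst x)), (inner_conj _ (snd x)).
unfold Cconj, Cplus; simpl; f_equal; ring.
Qed.

Lemma prod_inner_plus x y z :
  prod_inner (plus x y) z = Cplus (prod_inner x z) (prod_inner y z).
Proof.
destruct x as [x1 x2], y as [y1 y2]; unfold prod_inner; simpl.
rewrite !inner_plus; ring.
Qed.

Lemma prod_inner_scal (a : C_AbsRing) x y :
  prod_inner (scal a x) y = Cmult a (prod_inner x y).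
Proof.
destruct x as [x1 x2]; unfold prod_inner; simpl.
rewrite !inner_scal; ring.
Qed.

Lemma prod_inner_norm (x : H1 * H2) : prod_inner x x = RtoC (norm x ^ 2).
Proof.
change (norm x) with (sqrt (norm (fst x) ^ 2 + norm (snd x) ^ 2)).
unfold prod_inner; rewrite !inner_norm, pow2_sqrt, RtoC_plus; [reflexivity |].
apply Rplus_le_le_0_compat; apply pow2_ge_0.
Qed.

Definition prod_CHilbert : CHilbert :=
  {| hilbert_space := prod_CompleteNormedModule H1 H2;
     inner := prod_inner;
     inner_conj := prod_inner_conj;
     inner_plus := prod_inner_plus;
     inner_scal := prod_inner_scal;
     inner_norm := prod_inner_norm |}.

End HilbertProd.

Definition dense {V : NormedModule C_AbsRing} (P : V -> Prop) : Prop :=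
  forall (x : V) (eps : posreal), exists y, P y /\ norm (minus y x) < eps.

Definition separable (V : NormedModule C_AbsRing) : Prop :=
  exists e : nat -> V, dense (fun y => exists n, y = e n).

(** * Unbounded operators *)

(** The values of [op] outside [dom] are irrelevant. *)
Record operator (H : CHilbert) : Type := {
  dom : H -> Prop;
  op :> H -> H;
  dom_zero : dom zero;
  dom_plus : forall x y, dom x -> dom y -> dom (plus x y);
  dom_scal : forall (a : C_AbsRing) x, dom x -> dom (scal a x);
  op_plus : forall x y, dom x -> dom y -> op (plus x y) = plus (op x) (op y);
  op_scal : forall (a : C_AbsRing) x, dom x -> op (scal a x) = scal a (op x)
}.

Arguments dom {H} _ _.
Arguments op {H} _ _.

Definition in_graph {H : CHilbert} (A : operator H) (x y : H) : Prop :=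
  dom A x /\ y = A x.

Definition in_adjoint_graph {H : CHilbert} (A : operator H) (y z : H) : Prop :=
  forall x, dom A x -> inner (A x) y = inner x z.

Definition closed_operator {H : CHilbert} (A : operator H) : Prop :=
  closed (fun p : H * H => in_graph A (fst p) (snd p)).

Definition self_adjoint {H : CHilbert} (A : operator H) : Prop :=
  dense (dom A) /\ forall y z, in_adjoint_graph A y z <-> in_graph A y z.

Definition nonneg_operator {H : CHilbert} (A : operator H) : Prop :=
  forall x, dom A x -> Im (inner (A x) x) = 0 /\ 0 <= Re (inner (A x) x).

Definition in_kernel {H : CHilbert} (A : operator H) (x : H) : Prop :=
  dom A x /\ A x = zero.

(** [L] is the non-negative self-adjoint square root of [A], with
    [D(A) = {x in D(L) | L x in D(L)}]. *)
Definition is_sqrt_operator {H : CHilbert} (A L : operator H) : Prop :=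
  self_adjoint L /\ nonneg_operator L /\
  forall x y, in_graph A x y <-> exists z, in_graph L x z /\ in_graph L z y.

Section WaveOperator.

Variables (H : CHilbert) (L : operator H).

Let HH := prod_CHilbert H H.

Definition wave_dom (U : HH) : Prop := dom L (fst U) /\ dom L (snd U).

Definition wave_fun (U : HH) : HH := (L (snd U), opp (L (fst U))).

Lemma wave_dom_zero : wave_dom zero.
Proof. split; apply dom_zero. Qed.

Lemma wave_dom_plus U V : wave_dom U -> wave_dom V -> wave_dom (plus U V).
Proof. intros [? ?] [? ?]; split; apply dom_plus; assumption. Qed.

Lemma wave_dom_scal (a : C_AbsRing) U : wave_dom U -> wave_dom (scal a U).
Proof. intros [? ?]; split; apply dom_scal; assumption. Qed.

Lemma wave_fun_plus U V : wave_dom U -> wave_dom V ->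
  wave_fun (plus U V) = plus (wave_fun U) (wave_fun V).
Proof.
intros [? ?] [? ?]; unfold wave_fun; simpl.
change (@plus HH U V) with (plus (fst U) (fst V), plus (snd U) (snd V)); simpl.
rewrite !op_plus by assumption.
rewrite (@opp_plus (CompleteNormedModule.AbelianGroup _ H)); reflexivity.
Qed.

Lemma wave_fun_scal (a : C_AbsRing) U : wave_dom U ->
  wave_fun (scal a U) = scal a (wave_fun U).
Proof.
intros [? ?]; unfold wave_fun; simpl.
change (@scal _ HH a U)
  with (@scal C_AbsRing H a (fst U), @scal C_AbsRing H a (snd U)); simpl.
rewrite !op_scal by assumption.
apply injective_projections; [reflexivity | symmetry].
exact (@scal_opp_r C_AbsRing H a (L (fst U))).
Qed.

(** The operator matrix [(0, L; -L, 0)] on [D(L) x D(L)]. *)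
Definition wave_operator : operator HH :=
  {| dom := wave_dom;
     op := wave_fun;
     dom_zero := wave_dom_zero;
     dom_plus := wave_dom_plus;
     dom_scal := wave_dom_scal;
     op_plus := wave_fun_plus;
     op_scal := wave_fun_scal |}.

End WaveOperator.

Arguments wave_operator {H} L.

(** * Unitary groups *)

Definition unitary {H : CHilbert} (T : H -> H) : Prop :=
  (forall x y, T (plus x y) = plus (T x) (T y)) /\
  (forall (a : C_AbsRing) x, T (scal a x) = scal a (T x)) /\
  (forall x y, inner (T x) (T y) = inner x y) /\
  (forall y, exists x, T x = y).

Definition unitary_group {H : CHilbert} (T : R -> H -> H) : Prop :=
  (forall t, unitary (T t)) /\
  (forall x, T 0 x = x) /\
  (forall s t x, T (s + t) x = T s (T t x)) /\
  (forall x t, continuous (fun s => T s x) t).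

Definition generates {H : CHilbert} (B : operator H) (T : R -> H -> H) : Prop :=
  forall x y,
    in_graph B x y <->
    filterlim (fun h : R => rscal (/ h) (minus (T h x) x))
      (locally' 0) (locally y).

(** * The energy space *)

Definition energy_predomain {H : CHilbert} (L : operator H) (U : H * H) : Prop :=
  dom L (fst U) /\ forall k, in_kernel L k -> inner (fst U) k = RtoC 0.

(** The completion of [(D(L) - Ker L) x H] for the energy norm is unique up to
    isometry; [embed] is the canonical map into it (irrelevant outside
    [energy_predomain L]) and [J] the continuous extension of
    [(u1, u2) |-> (L u1, u2)].  The norm of [H * H] is the Hilbert one. *)
Record energy_space {H : CHilbert} (L : operator H) : Type := {
  energy_carrier :> CompleteNormedModule C_AbsRing;
  embed : H * H -> energy_carrier;
  embed_plus : forall U V, energy_predomain L U -> energy_predomain L V ->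
    embed (plus U V) = plus (embed U) (embed V);
  embed_scal : forall (a : C_AbsRing) U, energy_predomain L U ->
    embed (scal a U) = scal a (embed U);
  embed_norm : forall U, energy_predomain L U ->
    norm (embed U) = norm ((L (fst U), snd U) : H * H);
  embed_dense :
    dense (fun e => exists U, energy_predomain L U /\ e = embed U);
  J : energy_carrier -> H * H;
  J_continuous : forall e, continuous J e;
  J_embed : forall U, energy_predomain L U -> J (embed U) = (L (fst U), snd U)
}.

Arguments embed {H L} _ _.
Arguments J {H L} _ _.

(** * Mild solutions *)

(** [T] is the free group [E_0(t)] on [H * H], and [U0] is [U(0)]. *)
Definition mild_solution {H : CHilbert} (T : R -> H * H -> H * H) (b : R -> R)
    (U0 : H * H) (U : R -> H * H) : Prop :=
  (forall t, 0 <= t ->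
     filterlim U (within (Rle 0) (locally t)) (locally (U t))) /\
  U 0 = U0 /\
  forall t, 0 <= t -> exists Y : H * H,
    is_RInt (V := restrict_R (prod_CHilbert H H))
      (fun s => T (t - s) (zero, rscal (2 * b s) (snd (U s)))) 0 t Y /\
    U t = minus (T t U0) Y.

(** [u t] is the pair [(u(t), u'(t))] as an element of the energy space. *)
Definition energy_solution {H : CHilbert} {L : operator H} (E : energy_space L)
    (T : R -> H * H -> H * H) (b : R -> R) (u0 : E) (u : R -> E) : Prop :=
  mild_solution T b (J E u0) (fun t => J E (u t)).

(** * Functions on the half line *)

(** [b] is [C^1] on [[0, oo)] (one-sided at [0]) with derivative [db]. *)
Definition C1_half_line (b db : R -> R) : Prop :=
  forall t, 0 <= t ->
    filterlim (fun s => (b s - b t) / (s - t))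
      (within (Rle 0) (locally' t)) (locally (db t)) /\
    filterlim db (within (Rle 0) (locally t)) (locally (db t)).

Definition bracket (t : R) : R := sqrt (1 + t ^ 2).

Definition limsup_infty (f : R -> R) : Rbar :=
  Rbar_glb (fun M => exists T : R, 0 <= T /\
    M = Lub_Rbar (fun y => exists t, T <= t /\ y = f t)).

(* Main.v *)
Require Import Defs.
From Stdlib Require Import Reals Lra Lia.
From Coquelicot Require Import Coquelicot.
Open Scope R_scope.

(** Let [T] be the free group, [S = diag (1, -1)] and [W = lam T(-t) U]. Since
    [lam' = b lam], the equation becomes [W' = b T(-t) S T(t) W = b S T(2t) W], as
    [S] anticommutes with the generator [B]. The coefficient [b] is not
    integrable, but [T(2t)] oscillates. The claim is that [W] converges; the limit
    is [J] of the data sought, because [J] is isometric and, the kernel of [L]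
    being trivial, surjective ([JE_norm], [JE_surjective]).

    Frequencies are separated by the resolvents [(1 + tau L)^-1], which commute
    with the group and with [S], and so map solutions to solutions. They come
    from the projection theorem ([projection], [shift_surjective]).

    High frequencies ([high_cauchy]). The part [X = (1 - (1 + tau L)^-1) W] is
    [B Y] with [|Y| <= tau |W|], so [b S T(2t) B Y] is [b / 2] times a derivative,
    up to a term of order [b^2]. After an integration by parts the
    integrand is bounded by [(|b'| + b^2) |W|], hence by a multiple of [t^-2] as
    soon as [W] is bounded.

    Low frequencies. As [tau] grows, [(1 + tau L)^-1] tends strongly to zero
    ([res_to_zero]). Applied to a solution it gives the solution with
    [(1 + tau L)^-1] applied to the data, so that [(1 + tau L)^-1 W] is small
    uniformly in time, provided that
      [lam |U(t)| <= K (|u1| + |U(0)|)]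
    for all solutions, with [K] independent of the data ([uniform_bound]). This
    bound also feeds the first step, and it is the heart of the proof.

    The uniform bound. Put [p = lam u'], [y = lam L u], [r = lam u / t],
    [beta = t b], [s = t L], and let a dot be [t d/dt]. Then
      [p. = - beta p - s y],  [y. = beta y + s p],  [r. = p - (1 - beta) r].
    Where [s] is small, [|p|^2 + |r - p|^2] decreases up to terms of relative size
    [s]: this uses [0 <= beta <= 1/2]. Where [s] is large,
    [|p|^2 + |y|^2 + 2 beta <r, p>] is constant up to terms of relative size
    [1/s], by the bound on [b']. So a functional that interpolates between the two
    with powers of [a = (1 + s)^-1] grows at most at the rate [C a (1 - a)], which
    is integrable in [dt/t] uniformly in the frequency. Since that rate is an
    operator, the Gronwall argument is carried out by the weight [(1 + a)^k],
    whose own decay has this rate with a factor proportional to [k]: for large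
    [k] the weighted functional [lyap] decreases ([lyap_der_le]). The derivatives
    are justified by applying [(1 + eps L)^-1] twice, and [eps] is then sent to
    zero. *)

(** * The underlying real Hilbert space *)

(** The operations of a Hilbert space are reachable through several coercion
    paths, which agree only up to conversion. The following constants fix one
    path, so that rewriting never depends on how a term was elaborated. *)
Definition vadd {H : CHilbert} (x y : H) : H := plus x y.
Definition vopp {H : CHilbert} (x : H) : H := opp x.
Definition vsub {H : CHilbert} (x y : H) : H := minus x y.
Definition vzero {H : CHilbert} : H := zero.
Definition vscal {H : CHilbert} (r : R) (x : H) : H := @scal C_AbsRing H (RtoC r) x.
Definition vnorm {H : CHilbert} (x : H) : R := @norm C_AbsRing H x.
Definition rip {H : CHilbert} (x y : H) : R := Re (inner x y).

Notation "x +v y" := (vadd x y) (at level 50, left associativity).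
Notation "x -v y" := (vsub x y) (at level 50, left associativity).
Notation "r *v x" := (vscal r x) (at level 40, left associativity).

Lemma rip_sym {H : CHilbert} (x y : H) : rip x y = rip y x.
Proof. unfold rip; rewrite (inner_conj H x y); reflexivity. Qed.

Lemma rip_add_l {H : CHilbert} (x y z : H) : rip (x +v y) z = rip x z + rip y z.
Proof. unfold rip, vadd; rewrite inner_plus; reflexivity. Qed.

Lemma rip_scal_l {H : CHilbert} (r : R) (x z : H) : rip (r *v x) z = r * rip x z.
Proof.
unfold rip, vscal; rewrite inner_scal; unfold Cmult, RtoC, Re; simpl; ring.
Qed.

Lemma vscal_0 {H : CHilbert} (x : H) : 0 *v x = vzero.
Proof. exact (@scal_zero_l C_AbsRing H x). Qed.

Lemma vscal_m1 {H : CHilbert} (x : H) : (-1) *v x = vopp x.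
Proof.
etransitivity; [| exact (@scal_opp_one C_AbsRing H x)].
unfold vscal; apply (f_equal (fun c => @scal C_AbsRing H c x)).
unfold RtoC, opp, one; simpl; unfold Copp, RtoC; simpl; f_equal; ring.
Qed.

Lemma rip_opp_l {H : CHilbert} (x z : H) : rip (vopp x) z = - rip x z.
Proof. rewrite <- vscal_m1, rip_scal_l; ring. Qed.

Lemma rip_zero_l {H : CHilbert} (z : H) : rip vzero z = 0.
Proof. rewrite <- (vscal_0 vzero), rip_scal_l; ring. Qed.

Lemma rip_sub_l {H : CHilbert} (x y z : H) : rip (x -v y) z = rip x z - rip y z.
Proof.
change (x -v y) with (x +v vopp y); rewrite rip_add_l, rip_opp_l; ring.
Qed.

Lemma rip_add_r {H : CHilbert} (x y z : H) : rip z (x +v y) = rip z x + rip z y.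
Proof. rewrite rip_sym, rip_add_l, (rip_sym x), (rip_sym y); ring. Qed.

Lemma rip_scal_r {H : CHilbert} (r : R) (x z : H) : rip z (r *v x) = r * rip z x.
Proof. rewrite rip_sym, rip_scal_l, (rip_sym x); ring. Qed.

Lemma rip_opp_r {H : CHilbert} (x z : H) : rip z (vopp x) = - rip z x.
Proof. rewrite rip_sym, rip_opp_l, (rip_sym x); ring. Qed.

Lemma rip_zero_r {H : CHilbert} (z : H) : rip z vzero = 0.
Proof. rewrite rip_sym, rip_zero_l; ring. Qed.

Lemma rip_sub_r {H : CHilbert} (x y z : H) : rip z (x -v y) = rip z x - rip z y.
Proof. rewrite rip_sym, rip_sub_l, (rip_sym x), (rip_sym y); ring. Qed.

Lemma rip_norm {H : CHilbert} (x : H) : rip x x = vnorm x ^ 2.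
Proof. unfold rip; rewrite inner_norm; reflexivity. Qed.

Lemma rip_pos {H : CHilbert} (x : H) : 0 <= rip x x.
Proof. rewrite rip_norm; apply pow2_ge_0. Qed.

Ltac rip_simpl :=
  repeat rewrite ?rip_add_l, ?rip_sub_l, ?rip_opp_l, ?rip_scal_l, ?rip_zero_l,
    ?rip_add_r, ?rip_sub_r, ?rip_opp_r, ?rip_scal_r, ?rip_zero_r.

Ltac rip_simpl_in h :=
  repeat rewrite ?rip_add_l, ?rip_sub_l, ?rip_opp_l, ?rip_scal_l, ?rip_zero_l,
    ?rip_add_r, ?rip_sub_r, ?rip_opp_r, ?rip_scal_r, ?rip_zero_r in h.

Lemma norm_0_eq {H : CHilbert} (x : H) : vnorm x = 0 -> x = vzero.
Proof. apply (@norm_eq_zero C_AbsRing H). Qed.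

Lemma rip_0_eq {H : CHilbert} (x : H) : rip x x = 0 -> x = vzero.
Proof.
intros h; apply norm_0_eq; rewrite rip_norm in h.
apply Rsqr_0_uniq; unfold Rsqr; lra.
Qed.

Lemma vsub_0_eq {H : CHilbert} (x y : H) : x -v y = vzero -> x = y.
Proof.
intros h.
assert (e : (x -v y) +v y = x).
{ unfold vadd, vsub, minus; etransitivity;
    [symmetry; apply (@plus_assoc H) |].
  etransitivity; [apply (f_equal (@plus H x)), (@plus_opp_l H) |].
  apply (@plus_zero_r H). }
rewrite <- e, h; apply (@plus_zero_l H).
Qed.

Lemma rip_ext {H : CHilbert} (x y : H) : (forall z, rip x z = rip y z) -> x = y.
Proof.
intros h; apply vsub_0_eq, rip_0_eq; rewrite rip_sub_l, h; ring.
Qed.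

(** Linear identities between vectors are checked against every test vector,
    where they become identities of real numbers. *)
Ltac vec := apply rip_ext; intro; rip_simpl; try ring.

Lemma norm_pos {H : CHilbert} (x : H) : 0 <= vnorm x.
Proof. apply (@norm_ge_0 C_AbsRing H). Qed.

Lemma norm_le_of_sq {H : CHilbert} (x : H) (M : R) :
  0 <= M -> rip x x <= M ^ 2 -> vnorm x <= M.
Proof.
intros hM h; rewrite rip_norm in h.
apply Rsqr_incr_0_var; [unfold Rsqr; lra | exact hM].
Qed.

Lemma norm_sq_le {H : CHilbert} (x : H) (M : R) : vnorm x <= M -> rip x x <= M ^ 2.
Proof.
intros h; rewrite rip_norm; pose proof (norm_pos x); nra.
Qed.

Lemma norm_zero_eq {H : CHilbert} : vnorm (vzero : H) = 0.
Proof. apply (@norm_zero C_AbsRing H). Qed.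

Lemma rip_CS {H : CHilbert} (x y : H) : rip x y <= vnorm x * vnorm y.
Proof.
pose proof (norm_pos x) as hx; pose proof (norm_pos y) as hy.
destruct (Req_dec (vnorm x) 0) as [e | e].
{ rewrite e, (norm_0_eq x e), rip_zero_l; lra. }
destruct (Req_dec (vnorm y) 0) as [e' | e'].
{ rewrite e', (norm_0_eq y e'), rip_zero_r; lra. }
pose proof (rip_pos ((vnorm y *v x) -v (vnorm x *v y))) as h.
rip_simpl_in h; rewrite (rip_sym y x), !rip_norm in h.
assert (0 < vnorm x * vnorm y) by (apply Rmult_lt_0_compat; lra).
apply Rmult_le_reg_l with (vnorm x * vnorm y); [assumption | nra].
Qed.

Lemma norm_opp_eq {H : CHilbert} (x : H) : vnorm (vopp x) = vnorm x.
Proof. apply (@norm_opp C_AbsRing H). Qed.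

Lemma rip_CS_abs {H : CHilbert} (x y : H) : Rabs (rip x y) <= vnorm x * vnorm y.
Proof.
apply Rabs_le; split; [| apply rip_CS].
pose proof (rip_CS (vopp x) y) as h; rewrite rip_opp_l, norm_opp_eq in h; lra.
Qed.

Lemma norm_add_le {H : CHilbert} (x y : H) : vnorm (x +v y) <= vnorm x + vnorm y.
Proof. apply (@norm_triangle C_AbsRing H). Qed.

Lemma norm_sub_le {H : CHilbert} (x y : H) : vnorm (x -v y) <= vnorm x + vnorm y.
Proof.
change (x -v y) with (x +v vopp y).
eapply Rle_trans; [apply norm_add_le | rewrite norm_opp_eq; lra].
Qed.

Lemma norm_sub_sym {H : CHilbert} (x y : H) : vnorm (x -v y) = vnorm (y -v x).
Proof. rewrite <- (norm_opp_eq (x -v y)); f_equal; vec. Qed.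

Lemma norm_sub_trans {H : CHilbert} (x y z : H) :
  vnorm (x -v z) <= vnorm (x -v y) + vnorm (y -v z).
Proof.
replace (x -v z) with ((x -v y) +v (y -v z)) by vec; apply norm_add_le.
Qed.

Lemma norm_scal_eq {H : CHilbert} (r : R) (x : H) : vnorm (r *v x) = Rabs r * vnorm x.
Proof.
apply Rsqr_inj;
  [apply norm_pos | apply Rmult_le_pos; [apply Rabs_pos | apply norm_pos] |].
assert (e := rip_norm (r *v x)); rip_simpl_in e; rewrite rip_norm in e.
rewrite Rsqr_mult, <- Rsqr_abs; unfold Rsqr in *; lra.
Qed.

Lemma norm_le_eps {H : CHilbert} (x : H) :
  (forall eps, 0 < eps -> vnorm x <= eps) -> x = vzero.
Proof.
intros h; apply norm_0_eq; apply Rle_antisym; [| apply norm_pos].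
apply Rnot_lt_le; intros h'; specialize (h (vnorm x / 2)); lra.
Qed.

(** ** Products *)

Lemma prod_rip {H1 H2 : CHilbert} (x y : prod_CHilbert H1 H2) :
  rip x y = rip (fst x) (fst y) + rip (snd x) (snd y).
Proof. reflexivity. Qed.

Lemma prod_norm_sq {H1 H2 : CHilbert} (x : prod_CHilbert H1 H2) :
  vnorm x ^ 2 = vnorm (fst x : H1) ^ 2 + vnorm (snd x : H2) ^ 2.
Proof. rewrite <- !rip_norm; reflexivity. Qed.

Lemma norm_fst_le {H1 H2 : CHilbert} (x : prod_CHilbert H1 H2) :
  vnorm (fst x : H1) <= vnorm x.
Proof.
pose proof (prod_norm_sq x) as h; pose proof (norm_pos x).
apply Rsqr_incr_0_var; [unfold Rsqr; nra | assumption].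
Qed.

Lemma norm_snd_le {H1 H2 : CHilbert} (x : prod_CHilbert H1 H2) :
  vnorm (snd x : H2) <= vnorm x.
Proof.
pose proof (prod_norm_sq x) as h; pose proof (norm_pos x).
apply Rsqr_incr_0_var; [unfold Rsqr; nra | assumption].
Qed.

(** ** Limits *)

Lemma filterlim_vnorm {T : Type} {F : (T -> Prop) -> Prop} {FF : Filter F}
    {H : CHilbert} (f : T -> H) (y : H) :
  filterlim f F (locally y) <->
  forall eps, 0 < eps -> F (fun s => vnorm (f s -v y) < eps).
Proof.
rewrite (filterlim_locally_ball_norm (U := H) f y); split.
- intros h eps he; exact (h (mkposreal eps he)).
- intros h eps; exact (h eps (cond_pos eps)).
Qed.

Lemma norm_cauchy_cv {T : Type} {F : (T -> Prop) -> Prop} {FF : ProperFilter F}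
    {H : CHilbert} (f : T -> H) :
  (forall eps, 0 < eps -> exists P, F P /\
     forall s t, P s -> P t -> vnorm (f s -v f t) < eps) ->
  exists y : H, forall eps, 0 < eps -> F (fun s => vnorm (f s -v y) < eps).
Proof.
intros h; assert (hc : exists y : H, filterlim f F (locally y)).
{ apply (filterlim_locally_cauchy (U := H)); intros eps.
  destruct (h eps (cond_pos eps)) as [P [hP hst]].
  exists P; split; [exact hP |]; intros s t hs ht.
  apply (norm_compat1 (V := H)); apply (hst t s ht hs). }
destruct hc as [y hy]; exists y; apply filterlim_vnorm; exact hy.
Qed.

(** * Orthogonal projection *)

(** Minimising sequences in the form of a filter, so that no sequence has to be
    chosen: a set is large when it contains all points of [M] at which [phi] is
    small enough. *)
Definition near_min {T : Type} (M : T -> Prop) (phi : T -> R) (P : T -> Prop) : Prop :=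
  exists d, 0 < d /\ forall x, M x -> phi x < d -> P x.

Lemma near_min_proper {T : Type} (M : T -> Prop) (phi : T -> R) :
  (forall d, 0 < d -> exists x, M x /\ phi x < d) -> ProperFilter (near_min M phi).
Proof.
intros hin; constructor.
- intros P (d & hd & h); destruct (hin d hd) as (x & hx & hx'); exists x; auto.
- constructor.
  + exists 1; split; [lra | auto].
  + intros P Q (d & hd & h) (d' & hd' & h').
    exists (Rmin d d'); split; [apply Rmin_pos; assumption |].
    intros x hx hlt; pose proof (Rmin_l d d'); pose proof (Rmin_r d d').
    split; [apply h | apply h']; auto; lra.
  + intros P Q hPQ (d & hd & h); exists d; split; auto.
Qed.

Definition real_subspace {H : CHilbert} (M : H -> Prop) : Prop :=
  M vzero /\ (forall x y, M x -> M y -> M (x +v y)) /\ (forall r x, M x -> M (r *v x)).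

Definition vclosed {H : CHilbert} (M : H -> Prop) : Prop :=
  forall y, (forall eps, 0 < eps -> exists m, M m /\ vnorm (m -v y) < eps) -> M y.

Lemma parallelogram {H : CHilbert} (x m n : H) :
  rip (m -v n) (m -v n) + 4 * rip (x -v (/2) *v (m +v n)) (x -v (/2) *v (m +v n))
  = 2 * rip (x -v m) (x -v m) + 2 * rip (x -v n) (x -v n).
Proof. rip_simpl; rewrite (rip_sym n m), (rip_sym m x), (rip_sym n x); field. Qed.

(** The parallelogram identity makes near minimisers of the distance to [x] a
    Cauchy filter; its limit is a minimiser, and moving it along [n] shows that
    the defect is orthogonal to [n]. *)
Lemma projection {H : CHilbert} (M : H -> Prop) (x : H) :
  real_subspace M -> vclosed M ->
  exists m, M m /\ forall n, M n -> rip (x -v m) n = 0.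
Proof.
intros (M0 & Madd & Mscal) Mcl.
destruct (completeness (fun r => exists m, M m /\ r = - vnorm (x -v m))) as [D' [ub lub]].
{ exists 0; intros r (m & _ & ->); pose proof (norm_pos (x -v m)); lra. }
{ exists (- vnorm (x -v vzero)), vzero; auto. }
set (D := - D').
assert (Dle : forall m, M m -> D <= vnorm (x -v m)).
{ intros m hm; unfold D; enough (- vnorm (x -v m) <= D') by lra.
  apply ub; exists m; auto. }
assert (D0 : 0 <= D).
{ unfold D; enough (D' <= 0) by lra; apply lub.
  intros r (m & _ & ->); pose proof (norm_pos (x -v m)); lra. }
assert (Dapp : forall d, 0 < d -> exists m, M m /\ vnorm (x -v m) < D + d).
{ intros d hd; destruct (Classical_Prop.classic
    (exists m, M m /\ vnorm (x -v m) < D + d)) as [h | h]; [exact h | exfalso].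
  enough (D' <= D' - d) by lra; apply lub; intros r (m & hm & ->).
  apply Rnot_lt_le; intros h'; apply h; exists m; split; [exact hm |].
  unfold D; lra. }
set (F := near_min M (fun m => vnorm (x -v m) - D)).
assert (PF : ProperFilter F).
{ apply near_min_proper; intros d hd; destruct (Dapp d hd) as (m & hm & hm').
  exists m; split; [exact hm | lra]. }
destruct (norm_cauchy_cv (F := F) (fun m : H => m)) as [y hy].
{ intros eps heps; set (d := Rmin 1 (eps ^ 2 / (8 * D + 8))).
  assert (hd : 0 < d).
  { apply Rmin_pos; [lra |]; apply Rdiv_lt_0_compat; [apply pow_lt |]; lra. }
  exists (fun m => M m /\ vnorm (x -v m) < D + d); split.
  { exists d; split; [exact hd |]; intros m hm hm'; split; [exact hm | lra]. }
  intros m n [hm hm'] [hn hn'].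
  pose proof (parallelogram x m n) as hp; rewrite !rip_norm in hp.
  assert (hmid : D <= vnorm (x -v (/2) *v (m +v n))) by (apply Dle; auto).
  pose proof (norm_pos (x -v m)); pose proof (norm_pos (x -v n)).
  assert (d1 : d <= 1) by apply Rmin_l.
  assert (d2 : d * (8 * D + 8) <= eps ^ 2).
  { apply Rle_div_r; [lra | apply Rmin_r]. }
  assert (vnorm (m -v n) ^ 2 < eps ^ 2) by nra.
  apply Rsqr_incrst_0; [unfold Rsqr; lra | apply norm_pos | lra]. }
assert (hyM : M y).
{ apply Mcl; intros eps heps; destruct (hy eps heps) as (d & hd & h).
  destruct (Dapp d hd) as (m & hm & hm'); exists m; split; [exact hm |].
  apply h; [exact hm | lra]. }
assert (hyD : vnorm (x -v y) <= D).
{ apply le_epsilon; intros eps heps.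
  destruct (hy (eps / 2)) as (d & hd & h); [lra |].
  destruct (Dapp (Rmin d (eps / 2))) as (m & hm & hm'); [apply Rmin_pos; lra |].
  pose proof (Rmin_l d (eps / 2)); pose proof (Rmin_r d (eps / 2)).
  assert (vnorm (m -v y) < eps / 2) by (apply h; auto; lra).
  pose proof (norm_sub_trans x m y); lra. }
exists y; split; [exact hyM |]; intros n hn.
(* [s] is, up to the summand 1 that allows [n = 0], the optimal step along [n] *)
set (N := rip n n); set (r := rip (x -v y) n); set (s := r / (N + 1)).
assert (N0 : 0 <= N) by apply rip_pos.
assert (h1 : D <= vnorm (x -v (y +v s *v n))) by (apply Dle; auto).
assert (h2 : rip (x -v y) (x -v y)
  <= rip (x -v (y +v s *v n)) (x -v (y +v s *v n))).
{ rewrite !rip_norm; pose proof (norm_pos (x -v y)); nra. }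
assert (h3 : rip (x -v (y +v s *v n)) (x -v (y +v s *v n))
  = rip (x -v y) (x -v y) - 2 * s * r + s ^ 2 * N).
{ unfold r, N; rip_simpl; rewrite (rip_sym n x), (rip_sym n y), (rip_sym y x); ring. }
assert (hs : r = s * (N + 1)) by (unfold s; field; lra).
rewrite h3, hs in h2; rewrite hs; nra.
Qed.

(** * A non-negative self-adjoint operator and its resolvents *)

Definition bounded_by {H G : CHilbert} (M : R) (K : H -> G) : Prop :=
  forall x, vnorm (K x) <= M * vnorm x.

Definition rlinear {H G : CHilbert} (K : H -> G) : Prop :=
  (forall x y, K (x +v y) = K x +v K y) /\ (forall r x, K (r *v x) = r *v K x).

Lemma rlinear_sub {H G : CHilbert} (K : H -> G) (x y : H) :
  rlinear K -> K (x -v y) = K x -v K y.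
Proof.
intros [ha hs]; replace (x -v y) with (x +v (-1) *v y) by vec.
rewrite ha, hs; vec.
Qed.

Section SelfAdjoint.

Context {H : CHilbert} (L : operator H).

Lemma dom_add x y : dom L x -> dom L y -> dom L (x +v y).
Proof. apply dom_plus. Qed.

Lemma dom_vscal r x : dom L x -> dom L (r *v x).
Proof. apply dom_scal. Qed.

Lemma dom_sub x y : dom L x -> dom L y -> dom L (x -v y).
Proof.
intros hx hy; replace (x -v y) with (x +v (-1) *v y) by vec.
auto using dom_add, dom_vscal.
Qed.

Lemma op_add x y : dom L x -> dom L y -> L (x +v y) = L x +v L y.
Proof. apply op_plus. Qed.

Lemma op_vscal r x : dom L x -> L (r *v x) = r *v L x.
Proof. apply op_scal. Qed.

Lemma op_sub x y : dom L x -> dom L y -> L (x -v y) = L x -v L y.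
Proof.
intros hx hy; replace (x -v y) with (x +v (-1) *v y) by vec.
rewrite op_add, op_vscal by auto using dom_vscal; vec.
Qed.

Lemma op_zero : L vzero = vzero.
Proof.
rewrite <- (vscal_0 vzero) at 1; rewrite op_vscal by apply dom_zero; apply vscal_0.
Qed.

Context (Lsa : self_adjoint L).

Lemma sa_symmetric x y : dom L x -> dom L y -> rip (L x) y = rip x (L y).
Proof.
intros hx hy; unfold rip; f_equal.
refine (proj2 (proj2 Lsa y (L y)) (conj hy eq_refl) x hx).
Qed.

(** Testing with [i x] besides [x] recovers the imaginary parts, so the real
    inner product suffices to detect the graph. *)
Lemma sa_graph y z :
  (forall x, dom L x -> rip (L x) y = rip x z) -> in_graph L y z.
Proof.
intros h; apply (proj2 Lsa); intros x hx.
assert (h1 := h x hx); assert (h2 := h _ (dom_scal _ L Ci x hx)).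
rewrite op_scal in h2 by exact hx.
unfold rip in h1, h2; rewrite !inner_scal in h2.
apply injective_projections; [exact h1 |].
unfold Cmult, Ci, Re in h2; simpl in h2; lra.
Qed.

(** An adjoint is closed. *)
Lemma sa_closed y z :
  (forall eps, 0 < eps ->
     exists x, dom L x /\ vnorm (x -v y) < eps /\ vnorm (L x -v z) < eps) ->
  in_graph L y z.
Proof.
intros h; apply sa_graph; intros x hx.
apply cond_eq; intros eps heps.
set (c := vnorm x + vnorm (L x) + 1).
assert (hc : 0 < c).
{ unfold c; pose proof (norm_pos x); pose proof (norm_pos (L x)); lra. }
destruct (h (eps / c)) as (w & hw & h1 & h2).
{ apply Rdiv_lt_0_compat; assumption. }
replace (rip (L x) y - rip x z) with (rip x (L w -v z) - rip (L x) (w -v y)).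
2: { rip_simpl; rewrite (sa_symmetric x w) by assumption; ring. }
pose proof (rip_CS_abs x (L w -v z)); pose proof (rip_CS_abs (L x) (w -v y)).
assert (he : eps = eps / c * c) by (field; lra).
pose proof (Rabs_triang (rip x (L w -v z)) (- rip (L x) (w -v y))) as ht.
rewrite Rabs_Ropp in ht; unfold Rminus in *.
assert (0 < eps / c) by (apply Rdiv_lt_0_compat; assumption).
pose proof (norm_pos x); pose proof (norm_pos (L x)).
assert (vnorm x * vnorm (L w -v z) <= vnorm x * (eps / c))
  by (apply Rmult_le_compat_l; lra).
assert (vnorm (L x) * vnorm (w -v y) <= vnorm (L x) * (eps / c))
  by (apply Rmult_le_compat_l; lra).
unfold c in he at 2; nra.
Qed.

Lemma sa_dense x eps : 0 < eps -> exists y, dom L y /\ vnorm (y -v x) < eps.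
Proof. intros h; exact (proj1 Lsa x (mkposreal eps h)). Qed.

Context (Lpos : nonneg_operator L).

Lemma op_pos x : dom L x -> 0 <= rip (L x) x.
Proof. intros hx; exact (proj2 (Lpos x hx)). Qed.

(** The cross term in the square of [x + t L x] is non-negative. *)
Lemma shift_norm t x : 0 < t -> dom L x ->
  rip x x + t ^ 2 * rip (L x) (L x) <= rip (x +v t *v L x) (x +v t *v L x).
Proof.
intros ht hx; pose proof (op_pos x hx) as h.
rip_simpl; rewrite (rip_sym x (L x)); nra.
Qed.

Lemma shift_norm_le t x : 0 < t -> dom L x ->
  vnorm x <= vnorm (x +v t *v L x) /\ t * vnorm (L x) <= vnorm (x +v t *v L x).
Proof.
intros ht hx; pose proof (shift_norm t x ht hx) as h; rewrite !rip_norm in h.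
pose proof (norm_pos x); pose proof (norm_pos (L x)).
pose proof (norm_pos (x +v t *v L x)).
assert (0 <= t * vnorm (L x)) by (apply Rmult_le_pos; lra).
split; (apply Rsqr_incr_0_var; [unfold Rsqr; nra | assumption]).
Qed.

Lemma shift_sub t x y : dom L x -> dom L y ->
  (x -v y) +v t *v L (x -v y) = (x +v t *v L x) -v (y +v t *v L y).
Proof. intros hx hy; rewrite op_sub by assumption; vec. Qed.

(** By the lower bound, both [x] and [L x] are controlled by [x + t L x], so
    closedness of the graph passes to the range. *)
Lemma shift_closed t : 0 < t ->
  vclosed (fun y => exists x, dom L x /\ y = x +v t *v L x).
Proof.
intros ht y hy.
assert (Fin : forall d, 0 < d -> exists x, dom L x /\ vnorm ((x +v t *v L x) -v y) < d).
{ intros d hd; destruct (hy d hd) as (m & (x & hx & ->) & hm); exists x; auto. }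
set (F := near_min (dom L) (fun x => vnorm ((x +v t *v L x) -v y))).
assert (PF : ProperFilter F) by apply near_min_proper, Fin.
destruct (norm_cauchy_cv (F := F) (fun x : H => x)) as [x hx].
{ intros eps heps.
  exists (fun x => dom L x /\ vnorm ((x +v t *v L x) -v y) < eps / 2); split.
  { exists (eps / 2); split; [lra | auto]. }
  intros m n [hm hm'] [hn hn'].
  pose proof (proj1 (shift_norm_le t (m -v n) ht (dom_sub m n hm hn))) as h.
  rewrite shift_sub in h by assumption.
  pose proof (norm_sub_trans (m +v t *v L m) y (n +v t *v L n)) as h'.
  rewrite (norm_sub_sym y) in h'; lra. }
assert (hg : in_graph L x ((/ t) *v (y -v x))).
{ apply sa_closed; intros eps heps.
  set (e := eps * t / (t + 2)).
  assert (he : 0 < e) by (unfold e; apply Rdiv_lt_0_compat; [nra | lra]).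
  assert (hee : e * (t + 2) = eps * t) by (unfold e; field; lra).
  destruct (hx e he) as (d & hd & h).
  destruct (Fin (Rmin d e)) as (w & hw & hw'); [apply Rmin_pos; assumption |].
  pose proof (Rmin_l d e); pose proof (Rmin_r d e).
  assert (h1 : vnorm (w -v x) < e) by (apply h; auto; lra).
  exists w; split; [exact hw |]; split; [nra |].
  assert (ev : L w -v (/ t) *v (y -v x)
    = (/ t) *v (((w +v t *v L w) -v y) -v (w -v x))) by (vec; field; lra).
  rewrite ev, norm_scal_eq, Rabs_pos_eq by (left; apply Rinv_0_lt_compat; lra).
  pose proof (norm_sub_le ((w +v t *v L w) -v y) (w -v x)).
  apply Rmult_lt_reg_l with t; [lra |].
  rewrite <- Rmult_assoc, Rinv_r, Rmult_1_l by lra; nra. }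
exists x; destruct hg as [hd e]; split; [exact hd |].
rewrite <- e; vec; field; lra.
Qed.

(** A vector orthogonal to the range would be an eigenvector of [L] for the
    eigenvalue [- 1 / t], which non-negativity excludes. *)
Lemma shift_surjective t y : 0 < t -> exists x, dom L x /\ x +v t *v L x = y.
Proof.
intros ht.
destruct (projection (fun y => exists x, dom L x /\ y = x +v t *v L x) y)
  as (m & (x & hx & em) & ho).
- split; [| split].
  + exists vzero; split; [apply dom_zero | rewrite op_zero; vec].
  + intros a b (x & hx & ->) (x' & hx' & ->); exists (x +v x').
    split; [apply dom_add; assumption | rewrite op_add by assumption; vec].
  + intros r a (x & hx & ->); exists (r *v x).
    split; [apply dom_vscal; assumption | rewrite op_vscal by assumption; vec].
- apply shift_closed; exact ht.
- exists x; split; [exact hx |].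
  rewrite <- em; symmetry; apply vsub_0_eq, rip_0_eq.
  destruct (sa_graph (y -v m) ((- / t) *v (y -v m))) as [hd e].
  { intros w hw; assert (h := ho _ (ex_intro _ w (conj hw eq_refl))).
    revert h; generalize (y -v m); intros z h.
    rewrite rip_scal_r, (rip_sym w z), (rip_sym (L w) z).
    rewrite rip_add_r, rip_scal_r in h.
    apply Rmult_eq_reg_l with t; [| lra].
    replace (t * (- / t * rip z w)) with (- rip z w) by (field; lra); lra. }
  pose proof (op_pos _ hd) as h1; rewrite <- e, rip_scal_l in h1.
  pose proof (rip_pos (y -v m)) as h2.
  pose proof (Rinv_0_lt_compat t ht); nra.
Qed.

(** [res t] is [(1 + t L)^-1] when [t] is positive. *)
Definition res (t : R) (x : H) : H :=
  iota (T := H) (fun z => dom L z /\ z +v t *v L z = x).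

Lemma res_unique t x z z' : 0 < t -> dom L z -> dom L z' ->
  z +v t *v L z = x -> z' +v t *v L z' = x -> z = z'.
Proof.
intros ht hz hz' e e'; apply vsub_0_eq, norm_0_eq.
pose proof (proj1 (shift_norm_le t (z -v z') ht (dom_sub _ _ hz hz'))) as h.
rewrite shift_sub, e, e' in h by assumption.
replace (x -v x) with (vzero : H) in h by vec; rewrite norm_zero_eq in h.
pose proof (norm_pos (z -v z')); lra.
Qed.

Lemma res_spec t x : 0 < t -> dom L (res t x) /\ res t x +v t *v L (res t x) = x.
Proof.
intros ht.
refine (iota_correct (V := H)
  (fun z => dom L z /\ z +v t *v L z = x) _).
destruct (shift_surjective t x ht) as (z & hz & e).
exists z; split; [auto |]; intros z' [hz' e'].
eapply res_unique; eassumption.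
Qed.

Lemma res_dom t x : 0 < t -> dom L (res t x).
Proof. intros ht; apply res_spec, ht. Qed.

Lemma res_eq t x z : 0 < t -> dom L z -> z +v t *v L z = x -> res t x = z.
Proof.
intros ht hz e; destruct (res_spec t x ht) as [h1 h2].
eapply res_unique; eassumption.
Qed.

Lemma op_res t x : 0 < t -> t *v L (res t x) = x -v res t x.
Proof.
intros ht; rewrite <- (proj2 (res_spec t x ht)) at 2; vec.
Qed.

Lemma op_res' t x : 0 < t -> L (res t x) = (/ t) *v (x -v res t x).
Proof. intros ht; rewrite <- op_res by exact ht; vec; field; lra. Qed.

Lemma res_op t x : 0 < t -> dom L x -> t *v res t (L x) = x -v res t x.
Proof.
intros ht hx.
assert (e : res t (L x) = L (res t x)).
{ apply res_eq; [exact ht | |].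
  - rewrite op_res' by exact ht; apply dom_vscal, dom_sub; [exact hx | apply res_dom, ht].
  - rewrite op_res' at 2 by exact ht.
    rewrite op_vscal, op_sub; auto using res_dom, dom_sub.
    vec; field; lra. }
rewrite e, op_res; auto.
Qed.

Lemma res_comm_op t x : 0 < t -> dom L x -> res t (L x) = L (res t x).
Proof.
intros ht hx; rewrite op_res' by exact ht; rewrite <- res_op by assumption.
vec; field; lra.
Qed.

Lemma res_linear t : 0 < t -> rlinear (res t).
Proof.
intros ht; split.
- intros x y; apply res_eq; auto using dom_add, res_dom.
  rewrite op_add by (apply res_dom, ht).
  rewrite <- (proj2 (res_spec t x ht)) at 3; rewrite <- (proj2 (res_spec t y ht)) at 3; vec.
- intros r x; apply res_eq; auto using dom_vscal, res_dom.
  rewrite op_vscal by (apply res_dom, ht).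
  rewrite <- (proj2 (res_spec t x ht)) at 3; vec.
Qed.

Lemma res_sub t x y : 0 < t -> res t (x -v y) = res t x -v res t y.
Proof. intros ht; apply rlinear_sub, res_linear, ht. Qed.

Lemma res_norm t x : 0 < t -> vnorm (res t x) <= vnorm x.
Proof.
intros ht; pose proof (proj1 (shift_norm_le t _ ht (res_dom t x ht))) as h.
rewrite (proj2 (res_spec t x ht)) in h; exact h.
Qed.

Lemma res_symmetric t x y : 0 < t -> rip (res t x) y = rip x (res t y).
Proof.
intros ht.
rewrite <- (proj2 (res_spec t y ht)) at 1; rewrite <- (proj2 (res_spec t x ht)) at 2.
rip_simpl; rewrite sa_symmetric by (apply res_dom, ht); ring.
Qed.

Lemma res_pos t x : 0 < t -> rip (res t x) (res t x) <= rip (res t x) x.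
Proof.
intros ht; rewrite <- (proj2 (res_spec t x ht)) at 4.
rip_simpl; pose proof (op_pos _ (res_dom t x ht)) as h.
rewrite (rip_sym (res t x) (L _)); nra.
Qed.

(** The resolvent identity. *)
Lemma res_diff s t x : 0 < s -> 0 < t ->
  res s x -v res t x = ((t - s) / t) *v res s (x -v res t x).
Proof.
intros hs ht; rewrite <- op_res by exact ht.
assert (e : x = res t x +v t *v L (res t x)) by (symmetry; apply res_spec, ht).
destruct (res_linear s hs) as [ha hl].
rewrite e at 1; rewrite ha, !hl.
pose proof (res_op s (res t x) hs (res_dom t x ht)) as h.
apply rip_ext; intros z; assert (hz := f_equal (fun v => rip v z) h); simpl in hz.
rip_simpl; rip_simpl_in hz.
replace (rip (res t x) z) with (rip (res s (res t x)) z + s * rip (res s (L (res t x))) z) by lra.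
field; lra.
Qed.

(** On the domain the error is [t (1 + t L)^-1 L x]; contractions that converge
    on a dense set converge everywhere. *)
Lemma res_to_id x eps : 0 < eps ->
  exists d, 0 < d /\ forall t, 0 < t < d -> vnorm (res t x -v x) < eps.
Proof.
intros he; destruct (sa_dense x (eps / 3)) as (y & hy & hyx); [lra |].
set (c := vnorm (L y) + 1); assert (hc : 0 < c) by (unfold c; pose proof (norm_pos (L y)); lra).
exists (eps / (3 * c)); split; [apply Rdiv_lt_0_compat; lra |]; intros t [ht ht'].
assert (h1 : vnorm (res t y -v y) <= t * c).
{ rewrite norm_sub_sym, <- res_op, norm_scal_eq, Rabs_pos_eq by (assumption || lra).
  apply Rmult_le_compat_l; [lra |]; eapply Rle_trans; [apply res_norm, ht |].
  unfold c; lra. }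
assert (h2 : t * c < eps / 3).
{ apply Rmult_lt_reg_r with (/ c); [apply Rinv_0_lt_compat; lra |].
  replace (t * c * / c) with t by (field; lra).
  replace (eps / 3 * / c) with (eps / (3 * c)) by (field; lra); exact ht'. }
assert (h3 : vnorm (res t (x -v y)) <= vnorm (x -v y)) by apply res_norm, ht.
assert (e : res t x -v x = (res t (x -v y) +v (res t y -v y)) -v (x -v y)).
{ rewrite res_sub by exact ht; vec. }
rewrite e; eapply Rle_lt_trans; [apply norm_sub_le |].
pose proof (norm_add_le (res t (x -v y)) (res t y -v y)).
rewrite norm_sub_sym in hyx; lra.
Qed.

Context (Lker : forall x, dom L x -> L x = vzero -> x = vzero).

(** A vector orthogonal to the range lies in the kernel of the adjoint. *)
Lemma range_dense x eps : 0 < eps -> exists y, dom L y /\ vnorm (L y -v x) < eps.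
Proof.
intros he.
destruct (projection (fun y => forall e, 0 < e -> exists w, dom L w /\ vnorm (L w -v y) < e) x)
  as (m & hm & ho).
- split; [| split].
  + intros e he'; exists vzero; split; [apply dom_zero |].
    rewrite op_zero; replace (vzero -v vzero) with (vzero : H) by vec.
    rewrite norm_zero_eq; exact he'.
  + intros a b ha hb e he'.
    destruct (ha (e / 2)) as (w & hw & h1); [lra |].
    destruct (hb (e / 2)) as (w' & hw' & h2); [lra |].
    exists (w +v w'); split; [apply dom_add; assumption |].
    rewrite op_add by assumption.
    replace ((L w +v L w') -v (a +v b)) with ((L w -v a) +v (L w' -v b)) by vec.
    pose proof (norm_add_le (L w -v a) (L w' -v b)); lra.
  + intros r a ha e he'; pose proof (Rabs_pos r).
    destruct (ha (e / (Rabs r + 1))) as (w & hw & h1); [apply Rdiv_lt_0_compat; lra |].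
    exists (r *v w); split; [apply dom_vscal; assumption |].
    rewrite op_vscal by assumption.
    replace (r *v L w -v r *v a) with (r *v (L w -v a)) by vec.
    rewrite norm_scal_eq.
    assert (e = e / (Rabs r + 1) * (Rabs r + 1)) by (field; lra).
    pose proof (norm_pos (L w -v a)); nra.
- intros y hy e he'; destruct (hy (e / 2)) as (m & hm & h1); [lra |].
  destruct (hm (e / 2)) as (w & hw & h2); [lra |]; exists w; split; [exact hw |].
  pose proof (norm_sub_trans (L w) m y); lra.
- destruct (sa_graph (x -v m) vzero) as [hd e0].
  { intros w hw; rewrite rip_zero_r, rip_sym; apply ho; intros e he'.
    exists w; split; [exact hw |].
    replace (L w -v L w) with (vzero : H) by vec; rewrite norm_zero_eq; exact he'. }
  assert (ex : x = m) by (apply vsub_0_eq, Lker; auto).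
  rewrite ex; apply hm, he.
Qed.

(** On the range, [(1 + t L)^-1 L y] is [(y - (1 + t L)^-1 y) / t]. *)
Lemma res_to_zero x eps : 0 < eps ->
  exists T, 0 < T /\ forall t, T < t -> vnorm (res t x) < eps.
Proof.
intros he; destruct (range_dense x (eps / 2)) as (y & hy & hyx); [lra |].
set (c := 2 * vnorm y + 1); assert (hc : 0 < c) by (unfold c; pose proof (norm_pos y); lra).
exists (2 * c / eps); split; [apply Rdiv_lt_0_compat; lra |]; intros t ht'.
assert (ht : 0 < t).
{ eapply Rlt_trans; [| exact ht']; apply Rdiv_lt_0_compat; lra. }
assert (h1 : t * vnorm (res t (L y)) <= 2 * vnorm y).
{ rewrite <- (Rabs_pos_eq t) at 1 by lra.
  rewrite <- norm_scal_eq, res_op by assumption.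
  eapply Rle_trans; [apply norm_sub_le |]; pose proof (res_norm t y ht); lra. }
assert (h2 : 2 * c < t * eps).
{ apply Rmult_lt_reg_r with (/ eps); [apply Rinv_0_lt_compat; lra |].
  replace (t * eps * / eps) with t by (field; lra); exact ht'. }
assert (h3 : vnorm (res t (L y)) < eps / 2).
{ apply Rmult_lt_reg_l with t; [exact ht |]; unfold c in h2; nra. }
assert (e : res t x = res t (L y) -v res t (L y -v x)).
{ rewrite res_sub by exact ht; vec. }
rewrite e; eapply Rle_lt_trans; [apply norm_sub_le |].
pose proof (res_norm t (L y -v x) ht); lra.
Qed.

End SelfAdjoint.

(** * Forms weighted by powers of [1 + a] *)

(** In the applications [a] is [(1 + t L)^-1], so its spectrum lies in [[0, 1]];
    the hypotheses express this without spectral theory. *)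
Section Weights.

Context {H : CHilbert} (a : H -> H).

(** [wgt k] is [(1 + a)^k]. *)
Fixpoint wgt (k : nat) (x : H) : H :=
  match k with
  | O => x
  | S k => wgt k x +v a (wgt k x)
  end.

Context (alin : rlinear a).
Context (asym : forall x y, rip (a x) y = rip x (a y)).
Context (apos : forall x, rip (a x) (a x) <= rip (a x) x).

Lemma a_add x y : a (x +v y) = a x +v a y.
Proof. apply alin. Qed.

Lemma a_scal r x : a (r *v x) = r *v a x.
Proof. apply alin. Qed.

Lemma a_sub x y : a (x -v y) = a x -v a y.
Proof. apply rlinear_sub, alin. Qed.

Lemma wgt_linear k : rlinear (wgt k).
Proof.
induction k as [| k [IH1 IH2]]; split; intros; simpl; auto.
- rewrite IH1, a_add; vec.
- rewrite IH2, a_scal; vec.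
Qed.

Lemma wgt_add k x y : wgt k (x +v y) = wgt k x +v wgt k y.
Proof. apply wgt_linear. Qed.

Lemma wgt_scal k r x : wgt k (r *v x) = r *v wgt k x.
Proof. apply wgt_linear. Qed.

Lemma wgt_sub k x y : wgt k (x -v y) = wgt k x -v wgt k y.
Proof. apply rlinear_sub, wgt_linear. Qed.

Lemma wgt_a k x : wgt k (a x) = a (wgt k x).
Proof. induction k as [| k IH]; simpl; [| rewrite IH, a_add]; reflexivity. Qed.

Lemma wgt_sym k x y : rip (wgt k x) y = rip x (wgt k y).
Proof.
revert x y; induction k as [| k IH]; intros x y; simpl; [reflexivity |].
rip_simpl; rewrite asym, !IH, wgt_a; reflexivity.
Qed.

Lemma wgt_S k x : wgt (S k) x = wgt k (x +v a x).
Proof. simpl; rewrite wgt_add, wgt_a; reflexivity. Qed.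

Lemma wgt_sq k K x : (forall x, K (x +v a x) = K x +v a (K x)) ->
  rip (wgt (S (S k)) (K x)) x = rip (wgt k (K (x +v a x))) (x +v a x).
Proof.
intros hK; rewrite hK, !wgt_S, rip_add_r, wgt_add, rip_add_l, wgt_a, asym.
reflexivity.
Qed.

(** Multiplying a symmetric form by [(1 + a)^2] amounts to a change of vector,
    which reduces positivity of the weighted form to the exponents 0 and 1. *)
Lemma wgt_pos K : (forall x, K (x +v a x) = K x +v a (K x)) ->
  (forall x, 0 <= rip (K x) x) -> (forall x, 0 <= rip (K x +v a (K x)) x) ->
  forall k x, 0 <= rip (wgt k (K x)) x.
Proof.
intros hK h0 h1.
enough (h : forall k, (forall x, 0 <= rip (wgt k (K x)) x) /\
  (forall x, 0 <= rip (wgt (S k) (K x)) x)) by (intros k x; apply h).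
induction k as [| k [IH1 IH2]]; split; auto.
intros x; rewrite wgt_sq by exact hK; apply IH1.
Qed.

Lemma a_pos x : 0 <= rip (a x) x.
Proof. pose proof (apos x); pose proof (rip_pos (a x)); lra. Qed.

Lemma a_norm x : rip (a x) (a x) <= rip x x.
Proof.
pose proof (apos x) as h; pose proof (rip_pos (x -v a x)) as h'.
rip_simpl_in h'; rewrite (rip_sym x (a x)) in h'; lra.
Qed.

Lemma a_le x : rip (a x) x <= rip x x.
Proof.
pose proof (apos x) as h; pose proof (rip_pos (x -v a x)) as h'.
rip_simpl_in h'; rewrite (rip_sym x (a x)) in h'; lra.
Qed.

Lemma wgt_pos_a k x : 0 <= rip (wgt k (a x)) x.
Proof.
apply wgt_pos with (K := a); intros.
- apply a_add.
- apply a_pos.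
- rip_simpl; rewrite (asym (a x0)); pose proof (a_pos x0); pose proof (rip_pos (a x0)); lra.
Qed.

Lemma wgt_pos_e k x : 0 <= rip (wgt k (x -v a x)) x.
Proof.
apply wgt_pos with (K := fun x => x -v a x); intros.
- rewrite !a_add, a_sub; vec.
- rip_simpl; pose proof (a_le x0); lra.
- rewrite a_sub; rip_simpl; rewrite (asym (a x0) x0); pose proof (a_norm x0); lra.
Qed.

Lemma wgt_pos_ae k x : 0 <= rip (wgt k (a (x -v a x))) x.
Proof.
apply wgt_pos with (K := fun x => a (x -v a x)); intros.
- rewrite <- a_add; f_equal; rewrite !a_add, a_sub; vec.
- rewrite a_sub; rip_simpl; rewrite (asym (a x0) x0); pose proof (apos x0); lra.
- rewrite !a_sub; rip_simpl.
  rewrite (asym (a (a x0)) x0), (asym (a x0) x0).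
  pose proof (apos x0); pose proof (a_le (a x0)); lra.
Qed.

Lemma wgt_ge k x : rip x x <= rip (wgt k x) x.
Proof.
induction k as [| k IH]; [simpl; lra |].
simpl; rip_simpl; rewrite <- wgt_a; pose proof (wgt_pos_a k x); lra.
Qed.

Lemma wgt_norm k x : vnorm (wgt k x) <= 2 ^ k * vnorm x.
Proof.
induction k as [| k IH]; simpl; [lra |].
assert (h : vnorm (a (wgt k x)) <= vnorm (wgt k x)).
{ apply norm_le_of_sq; [apply norm_pos |]; rewrite <- rip_norm; apply a_norm. }
pose proof (norm_add_le (wgt k x) (a (wgt k x))); lra.
Qed.

Lemma wgt_ae_comm k x y :
  rip (wgt k (a (x -v a x))) y = rip (wgt k (a (y -v a y))) x.
Proof.
rewrite wgt_sym, asym, rip_sub_l, asym, wgt_a, wgt_sub, wgt_a, a_sub.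
rewrite rip_sub_l, (rip_sym (a _) x), (rip_sym (a (a _)) x); reflexivity.
Qed.

Lemma wgt_CS k x y :
  Rabs (2 * rip (wgt k (a (x -v a x))) y)
  <= rip (wgt k (a (x -v a x))) x + rip (wgt k (a (y -v a y))) y.
Proof.
pose proof (wgt_pos_ae k (x +v y)) as h1; pose proof (wgt_pos_ae k (x -v y)) as h2.
pose proof (wgt_ae_comm k x y) as h.
replace ((x +v y) -v a (x +v y)) with ((x -v a x) +v (y -v a y)) in h1
  by (rewrite a_add; vec).
replace ((x -v y) -v a (x -v y)) with ((x -v a x) -v (y -v a y)) in h2
  by (rewrite a_sub; vec).
rewrite a_add, wgt_add, rip_add_l, !rip_add_r in h1.
rewrite a_sub, wgt_sub, rip_sub_l, !rip_sub_r in h2.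
apply Rabs_le; lra.
Qed.

End Weights.

(** * The Lyapunov functional *)

(** With [s = t L] and [a = (1 + s)^-1], the functional combines the energy
    [|p|^2 + |y|^2], the virial term [2 beta (1 - a) <r, p>], which cancels the
    growth of the energy at high frequencies, and [a^2 |r - p|^2], which controls
    [r] at low frequencies; [(1 - a) r] is written [a y]. The weight [(1 + a)^k]
    decreases along the flow like [t d/dt log (1 + a)^k = - k a (1 - a) / (1 + a)],
    which is of the size of the remaining errors in both regimes. *)
Definition lyap {H : CHilbert} (a : H -> H) (k : nat) (beta : R) (p y r : H) : R :=
  rip (wgt a k p) p + rip (wgt a k y) y + 2 * beta * rip (wgt a k (a y)) p
  + rip (wgt a k (a (r -v p))) (a (r -v p)).

(** [t d/dt] of [<(1 + a)^(j + 1) x, x'>] when [x] and [x'] have the logarithmic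
    derivatives [dx] and [dx']; it uses [t d/dt a = - a (1 - a)]. *)
Definition form_der {H : CHilbert} (a : H -> H) (j : nat) (x dx x' dx' : H) : R :=
  rip (wgt a (S j) dx -v INR (S j) *v wgt a j (a (x -v a x))) x'
  + rip (wgt a (S j) x) dx'.

(** The resulting [t d/dt] of [lyap a (S j)]. *)
Definition lyap_der {H : CHilbert} (a : H -> H) (j : nat) (beta dbeta : R)
    (p y r dp dy dr : H) : R :=
  let d := r -v p in
  let dq := a (dr -v dp) -v a (d -v a d) in
  form_der a j p dp p dp + form_der a j y dy y dy
  + (2 * dbeta * rip (wgt a (S j) (a y)) p
     + 2 * beta * form_der a j (a y) (a dy -v a (y -v a y)) p dp)
  + form_der a j (a d) dq (a d) dq.

(** Here [z] stands for [t L y] and [s] for [t L p]. Since [a] inverts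
    [1 + t L], the relations [y = t L r], [z = t L y] and [s = t L p] are used in
    the bounded form [a y = (1 - a) r] and so on. *)
Section Lyapunov.

Context {H : CHilbert} (a : H -> H).
Context (alin : rlinear a).
Context (asym : forall x y, rip (a x) y = rip x (a y)).
Context (apos : forall x, rip (a x) (a x) <= rip (a x) x).
Context (j : nat) (p y r z s : H).
Context (hy : a y = r -v a r).
Context (hz : a z = y -v a y).
Context (hs : a s = p -v a p).
Context (hzs : rip (wgt a (S j) y) s = rip (wgt a (S j) p) z).

Let w x x' := rip (wgt a j x) x'.

Lemma w_sym x x' : w x x' = w x' x.
Proof. unfold w; rewrite wgt_sym by assumption; apply rip_sym. Qed.
Lemma w_a x x' : w x (a x') = w (a x) x'.
Proof. unfold w; rewrite <- asym, wgt_a by assumption; reflexivity. Qed.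
Lemma w_add_l x x' x'' : w (x +v x') x'' = w x x'' + w x' x''.
Proof. unfold w; rewrite wgt_add by assumption; apply rip_add_l. Qed.
Lemma w_sub_l x x' x'' : w (x -v x') x'' = w x x'' - w x' x''.
Proof. unfold w; rewrite wgt_sub by assumption; apply rip_sub_l. Qed.
Lemma w_scal_l c x x'' : w (c *v x) x'' = c * w x x''.
Proof. unfold w; rewrite wgt_scal by assumption; apply rip_scal_l. Qed.
Lemma w_add_r x x' x'' : w x'' (x +v x') = w x'' x + w x'' x'.
Proof. apply rip_add_r. Qed.
Lemma w_sub_r x x' x'' : w x'' (x -v x') = w x'' x - w x'' x'.
Proof. apply rip_sub_r. Qed.
Lemma w_scal_r c x x'' : w x'' (c *v x) = c * w x'' x.
Proof. apply rip_scal_r. Qed.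
Lemma w_S x x' : rip (wgt a (S j) x) x' = w x x' + w (a x) x'.
Proof.
unfold w; rewrite wgt_S, wgt_add, rip_add_l by assumption; reflexivity.
Qed.
Lemma form_der_w x dx x' dx' :
  form_der a j x dx x' dx' = w dx x' + w (a dx) x' - INR (S j) * w (a (x -v a x)) x'
    + w x dx' + w (a x) dx'.
Proof.
unfold form_der; rewrite rip_sub_l, rip_scal_l, !w_S; fold (w (a (x -v a x)) x'); ring.
Qed.

Lemma w_ay x : w (a x) y = w x r - w (a x) r.
Proof. rewrite <- w_a, hy, w_sub_r, w_a; ring. Qed.
Lemma w_az x : w (a x) z = w x y - w x r + w (a x) r.
Proof. rewrite <- w_a, hz, hy, !w_sub_r, w_a; ring. Qed.
Lemma w_as x : w (a x) s = w x p - w (a x) p.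
Proof. rewrite <- w_a, hs, w_sub_r, w_a; ring. Qed.

(** Normal form of the moments [<(1 + a)^j a^i x, x'>]: all powers of [a] are
    moved to the left argument, and the relations above remove [a y], [a z]
    and [a s]. *)
Ltac w_expand :=
  repeat (rewrite ?(a_sub a alin), ?(a_add a alin), ?(a_scal a alin), ?hy, ?hz, ?hs,
    ?w_add_l, ?w_sub_l, ?w_scal_l, ?w_add_r, ?w_sub_r, ?w_scal_r, ?w_a,
    ?w_ay, ?w_az, ?w_as, ?(w_sym y p), ?(w_sym y r), ?(w_sym z p),
    ?(w_sym z r), ?(w_sym z y), ?(w_sym s p), ?(w_sym s r), ?(w_sym s y),
    ?(w_sym r p), ?(w_sym (a r) p), ?(w_sym (a (a r)) p), ?(w_sym (a (a (a r))) p),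
    ?(w_sym (a (a (a (a r)))) p), ?(w_sym (a (a (a (a (a r))))) p)).

Ltac w_expand_a :=
  repeat (rewrite ?(a_sub a alin), ?(a_add a alin), ?(a_scal a alin),
    ?w_add_l, ?w_sub_l, ?w_scal_l, ?w_add_r, ?w_sub_r, ?w_scal_r, ?w_a).

Context (beta B C : R).
Context (hbeta : 0 <= beta <= 1 / 2).
Context (hB : Rabs B <= C).
Context (hk : 64 + 32 * C <= INR (S j)).

Let e x := x -v a x.
Let m x x' := rip (wgt a (S j) x) x'.
Let dp := (- beta) *v p -v z.
Let dy := beta *v y +v s.
Let dr := p -v (1 - beta) *v r.
Let d := r -v p.
Let q := a d.

(** The vectors [z] and [s], which are not bounded by the functional, cancel. So
    does the high frequency part of the growth [2 beta (|y|^2 - |p|^2)] of the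
    energy, against the virial term. *)
Lemma lyap_der_eq : lyap_der a j beta (beta + B) p y r dp dy dr =
  - INR (S j) * (w (a (e p)) p + w (a (e y)) y + 2 * beta * w (a (e (a y))) p
                 + w (a (e q)) q)
  - 2 * beta * m (a p) p + 2 * beta * m (a y) y + 2 * B * m (a y) p
  + 2 * beta * m (a (e r)) p - 2 * m (e q) q - 2 * (1 - beta) * m q q
  + 4 * beta * m q (a p) + 2 * m (a (e d)) y.
Proof.
unfold lyap_der, m, q, d, e, dp, dy, dr; cbv zeta.
rewrite !form_der_w, !w_S; rewrite !w_S in hzs.
assert (h1 := w_a y z). rewrite hz in h1.
assert (h2 := w_a y s). rewrite hs in h2.
revert h1 h2; revert hzs; generalize (INR (S j)); intros K.
w_expand.
intros hzs' h1 h2.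
assert (e1 : w r z = w y y) by lra.
assert (e2 : w r s = w p y) by lra.
assert (e3 : w y s = w p z) by lra.
rewrite e1, e2, e3; ring.
Qed.

(** Every term without a sign carries the factor [a (1 - a)], and so does the
    derivative of the weight, with the large factor [- INR (S j)]. *)
Lemma lyap_der_le : lyap_der a j beta (beta + B) p y r dp dy dr <= 0.
Proof.
rewrite lyap_der_eq.
assert (mw : forall x x', m x x' = w x x' + w (a x) x') by (intros; apply w_S).
assert (N0 : forall x, 0 <= w (a (e x)) x) by (intros; apply wgt_pos_ae; assumption).
assert (M0 : forall x, 0 <= m (a (e x)) x) by (intros; apply wgt_pos_ae; assumption).
assert (E0 : forall x, 0 <= m (e x) x) by (intros; apply wgt_pos_e; assumption).
assert (I0 : forall x, 0 <= m x x).
{ intros x; eapply Rle_trans; [apply (rip_pos x) | apply wgt_ge; assumption]. }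
assert (wCS : forall x x', - (w (a (e x)) x + w (a (e x')) x') <= 2 * w (a (e x)) x'
  <= w (a (e x)) x + w (a (e x')) x').
{ intros x x'; apply Rabs_le_between, (wgt_CS a alin asym apos j). }
assert (mCS : forall x x', - (m (a (e x)) x + m (a (e x')) x') <= 2 * m (a (e x)) x'
  <= m (a (e x)) x + m (a (e x')) x').
{ intros x x'; apply Rabs_le_between, (wgt_CS a alin asym apos (S j)). }
(* [1 + a] lies between 1 and 2, and [a] between 0 and 1 *)
assert (NM : forall x, m (a (e x)) x <= 2 * w (a (e x)) x).
{ intros x; pose proof (wgt_pos_a a alin asym apos j (e x)) as h.
  change (0 <= w (a (e x)) (e x)) in h; rewrite mw.
  unfold e in h at 2; rewrite w_sub_r, w_a in h; lra. }
assert (Na : forall x, w (a (e (a x))) (a x) <= w (a (e x)) x).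
{ intros x; pose proof (wgt_pos_a a alin asym apos (S j) (e x)) as h2.
  change (0 <= m (a (e x)) (e x)) in h2.
  rewrite mw in h2; revert h2; unfold e; w_expand_a; intros; lra. }
assert (Nr : w (a (e r)) r <= 3 * (w (a (e q)) q + w (a (e p)) p + w (a (e y)) y)).
{ assert (er : r = q +v (a p +v a y)).
  { unfold q, d; rewrite (a_sub a alin), hy; vec. }
  assert (eadd : forall u v, a (e (u +v v)) = a (e u) +v a (e v)).
  { intros; unfold e; rewrite <- a_add by assumption; f_equal.
    rewrite a_add by assumption; vec. }
  rewrite er, !eadd, !w_add_l, !w_add_r.
  pose proof (wCS q (a p)); pose proof (wCS q (a y)); pose proof (wCS (a p) (a y)).
  pose proof (wCS (a p) q); pose proof (wCS (a y) q); pose proof (wCS (a y) (a p)).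
  pose proof (Na p); pose proof (Na y); lra. }
assert (ay : forall x, m (a y) x = m (a (e r)) x + m (a (e y)) x).
{ intros x; unfold m; rewrite <- rip_add_l, <- (wgt_add a alin).
  unfold e; f_equal; f_equal.
  rewrite !(a_sub a alin), hy, !(a_sub a alin); vec. }
(* completing the square needs [beta <= 1 / 2] *)
assert (low : - 2 * beta * m (a p) p - 2 * (1 - beta) * m q q
  + 4 * beta * m q (a p) <= 0).
{ pose proof (I0 (a p -v q)) as h1; pose proof (I0 q) as h2.
  pose proof (M0 p) as h3.
  assert (h4 : m (a (e p)) p = m (a p) p - m (a p) (a p)).
  { rewrite !mw; unfold e; w_expand_a; ring. }
  assert (h5 : m (a p -v q) (a p -v q) = m (a p) (a p) - 2 * m q (a p) + m q q).
  { rewrite !mw; rewrite ?(a_sub a alin), ?w_sub_l, ?w_sub_r, (w_sym (a p) q),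
      (w_sym (a (a p)) q), ?w_a; ring. }
  nra. }
assert (ed : m (a (e d)) y = m (a (e r)) y - m (a (e p)) y).
{ unfold m; rewrite <- rip_sub_l, <- (wgt_sub a alin); f_equal; f_equal.
  rewrite <- (a_sub a alin); f_equal; unfold e, d; rewrite (a_sub a alin); vec. }
assert (hB' : - C <= B <= C) by (apply Rabs_le_between, hB).
rewrite ed, !ay.
pose proof (E0 q).
pose proof (mCS r y); pose proof (mCS r p); pose proof (mCS y p); pose proof (mCS p y).
pose proof (wCS (a y) p); pose proof (Na y).
pose proof (NM p); pose proof (NM y); pose proof (NM r).
pose proof (N0 p); pose proof (N0 y); pose proof (N0 q); pose proof (N0 r).
pose proof (M0 p); pose proof (M0 y); pose proof (M0 r).
set (wp := w (a (e p)) p) in *; set (wy := w (a (e y)) y) in *.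
set (wq := w (a (e q)) q) in *; set (wr := w (a (e r)) r) in *.
set (mp := m (a (e p)) p) in *; set (my := m (a (e y)) y) in *.
set (mr := m (a (e r)) r) in *.
set (way := w (a (e (a y))) (a y)) in *; set (X := w (a (e (a y))) p) in *.
set (r_y := m (a (e r)) y) in *; set (r_p := m (a (e r)) p) in *.
set (y_p := m (a (e y)) p) in *; set (p_y := m (a (e p)) y) in *.
set (K := INR (S j)) in *.
assert (K0 : 0 <= K) by apply pos_INR.
assert (C0 : 0 <= C) by lra.
set (S := wp + wy + wq).
assert (main : (wp + wy) / 2 + wq <= wp + wy + 2 * beta * X + wq) by nra.
(* the errors are at most [(4 + 2 C) (mp + my + mr)], hence at most
   [(32 + 16 C) S], and the gain is [K S / 2] *)
assert (main' : K * (S / 2) <= K * (wp + wy + 2 * beta * X + wq))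
  by (apply Rmult_le_compat_l; unfold S; lra).
assert (tot : mp + my + mr <= 8 * S) by (unfold S; lra).
assert (g1 : 2 * beta * r_y <= mr + my) by nra.
assert (g2 : 2 * beta * r_p <= mr + mp) by nra.
assert (g3 : 2 * B * r_p <= C * (mr + mp)) by nra.
assert (g4 : 2 * B * y_p <= C * (my + mp)) by nra.
assert (g5 : 2 * beta * my <= my) by nra.
assert (S0 : 0 <= S) by (unfold S; lra).
assert (hKS : (64 + 32 * C) * (S / 2) <= K * (S / 2))
  by (apply Rmult_le_compat_r; lra).
assert (g6 : C * (mp + my + mr) <= C * (8 * S)) by (apply Rmult_le_compat_l; lra).
assert (g7 : 0 <= C * mr) by (apply Rmult_le_pos; lra).
assert (g8 : 0 <= C * my) by (apply Rmult_le_pos; lra).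
nra.
Qed.

End Lyapunov.

(** * Derivatives of vector-valued functions *)

Definition vder {H : CHilbert} (f : R -> H) (t : R) (d : H) : Prop :=
  forall eps, 0 < eps -> exists delta, 0 < delta /\
    forall h, Rabs h < delta -> vnorm (f (t + h) -v f t -v h *v d) <= eps * Rabs h.

Definition vcont {H : CHilbert} (f : R -> H) (t : R) : Prop :=
  forall eps, 0 < eps -> exists delta, 0 < delta /\
    forall h, Rabs h < delta -> vnorm (f (t + h) -v f t) < eps.

Lemma is_derive_eps (g : R -> R) (t l : R) :
  is_derive g t l <->
  forall eps, 0 < eps -> exists delta, 0 < delta /\
    forall h, Rabs h < delta -> Rabs (g (t + h) - g t - h * l) <= eps * Rabs h.
Proof.
rewrite is_derive_Reals; split.
- intros hd eps heps; destruct (hd eps heps) as [delta hdelta].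
  exists delta; split; [apply cond_pos |]; intros h hh.
  destruct (Req_dec h 0) as [-> | hne].
  { rewrite Rplus_0_r; replace (g t - g t - 0 * l) with 0 by ring; rewrite Rabs_R0; lra. }
  specialize (hdelta h hne hh).
  replace (g (t + h) - g t - h * l) with (((g (t + h) - g t) / h - l) * h)
    by (field; exact hne).
  rewrite Rabs_mult; apply Rmult_le_compat_r; [apply Rabs_pos | lra].
- intros hd eps heps; destruct (hd (eps / 2)) as (delta & hdelta & hb); [lra |].
  exists (mkposreal delta hdelta); intros h hne hh; specialize (hb h hh).
  assert (hp : 0 < Rabs h) by (apply Rabs_pos_lt, hne).
  replace ((g (t + h) - g t) / h - l) with ((g (t + h) - g t - h * l) / h)
    by (field; exact hne).
  unfold Rdiv; rewrite Rabs_mult, Rabs_inv.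
  apply Rmult_lt_reg_r with (Rabs h); [exact hp |].
  rewrite Rmult_assoc, Rinv_l by lra; nra.
Qed.

Lemma vder_eq {H : CHilbert} (f : R -> H) t d d' : d = d' -> vder f t d -> vder f t d'.
Proof. intros ->; auto. Qed.

Lemma vder_cont {H : CHilbert} (f : R -> H) t d : vder f t d -> vcont f t.
Proof.
intros hf eps heps; destruct (hf 1) as (delta & hdelta & hb); [lra |].
pose proof (norm_pos d).
assert (hq : 0 < eps / (2 + vnorm d)) by (apply Rdiv_lt_0_compat; lra).
exists (Rmin delta (eps / (2 + vnorm d))); split; [apply Rmin_pos; assumption |].
intros h hh; specialize (hb h (Rlt_le_trans _ _ _ hh (Rmin_l _ _))).
assert (hh' := Rlt_le_trans _ _ _ hh (Rmin_r _ _)).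
replace (f (t + h) -v f t) with ((f (t + h) -v f t -v h *v d) +v h *v d) by vec.
pose proof (norm_add_le (f (t + h) -v f t -v h *v d) (h *v d)) as hn.
rewrite norm_scal_eq in hn.
assert (eps = eps / (2 + vnorm d) * (2 + vnorm d)) by (field; lra).
pose proof (Rabs_pos h); nra.
Qed.

Lemma vder_ext_loc {H : CHilbert} (f g : R -> H) t d r : 0 < r ->
  (forall s, Rabs (s - t) < r -> f s = g s) -> vder f t d -> vder g t d.
Proof.
intros hr he hf eps heps; destruct (hf eps heps) as (delta & hdelta & hb).
exists (Rmin delta r); split; [apply Rmin_pos; assumption |]; intros h hh.
rewrite <- !he.
- apply hb, (Rlt_le_trans _ _ _ hh), Rmin_l.
- replace (t - t) with 0 by ring; rewrite Rabs_R0; exact hr.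
- replace (t + h - t) with h by ring; apply (Rlt_le_trans _ _ _ hh), Rmin_r.
Qed.

Lemma vder_const {H : CHilbert} (x : H) t : vder (fun _ => x) t vzero.
Proof.
intros eps heps; exists 1; split; [lra |]; intros h _.
replace (x -v x -v h *v vzero) with (vzero : H) by vec; rewrite norm_zero_eq.
pose proof (Rabs_pos h); nra.
Qed.

Lemma vder_add {H : CHilbert} (f g : R -> H) t d d' : vder f t d -> vder g t d' ->
  vder (fun s => f s +v g s) t (d +v d').
Proof.
intros hf hg eps heps.
destruct (hf (eps / 2)) as (d1 & hd1 & h1); [lra |].
destruct (hg (eps / 2)) as (d2 & hd2 & h2); [lra |].
exists (Rmin d1 d2); split; [apply Rmin_pos; assumption |]; intros h hh.
specialize (h1 h (Rlt_le_trans _ _ _ hh (Rmin_l _ _))).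
specialize (h2 h (Rlt_le_trans _ _ _ hh (Rmin_r _ _))).
replace (f (t + h) +v g (t + h) -v (f t +v g t) -v h *v (d +v d'))
  with ((f (t + h) -v f t -v h *v d) +v (g (t + h) -v g t -v h *v d')) by vec.
eapply Rle_trans; [apply norm_add_le | lra].
Qed.

(** The product rule for a locally bounded family of linear maps applied to a
    function. It only asks the family to be differentiable at the vector
    [f t], which is what unbounded generators allow. *)
Lemma vder_family {H G : CHilbert} (K : R -> H -> G) (f : R -> H) t d (D : G) M r :
  0 < r -> (forall s, Rabs (s - t) < r -> rlinear (K s) /\ bounded_by M (K s)) ->
  vder f t d -> vder (fun s => K s (f t)) t D -> vcont (fun s => K s d) t ->
  vder (fun s => K s (f s)) t (D +v K t d).
Proof.
intros hr hK hf hD hc eps heps.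
assert (hM : 0 < Rabs M + 1) by (pose proof (Rabs_pos M); lra).
destruct (hf (eps / (3 * (Rabs M + 1)))) as (d1 & hd1 & h1);
  [apply Rdiv_lt_0_compat; lra |].
destruct (hD (eps / 3)) as (d2 & hd2 & h2); [lra |].
destruct (hc (eps / 3)) as (d3 & hd3 & h3); [lra |].
exists (Rmin (Rmin d1 d2) (Rmin d3 r)); split; [repeat apply Rmin_pos; assumption |].
intros h hh.
pose proof (Rmin_l (Rmin d1 d2) (Rmin d3 r)); pose proof (Rmin_r (Rmin d1 d2) (Rmin d3 r)).
pose proof (Rmin_l d1 d2); pose proof (Rmin_r d1 d2).
pose proof (Rmin_l d3 r); pose proof (Rmin_r d3 r).
specialize (h1 h); specialize (h2 h); specialize (h3 h).
destruct (hK (t + h)) as [[hadd hscal] hb].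
{ replace (t + h - t) with h by ring; lra. }
set (x := f (t + h) -v f t -v h *v d) in *.
assert (e : f (t + h) = f t +v h *v d +v x) by (unfold x; vec).
replace (K (t + h) (f (t + h)) -v K t (f t) -v h *v (D +v K t d))
  with (K (t + h) x +v (K (t + h) (f t) -v K t (f t) -v h *v D)
        +v h *v (K (t + h) d -v K t d)) by (rewrite e, !hadd, hscal; vec).
pose proof (norm_add_le (K (t + h) x +v (K (t + h) (f t) -v K t (f t) -v h *v D))
  (h *v (K (t + h) d -v K t d))) as n1.
pose proof (norm_add_le (K (t + h) x) (K (t + h) (f t) -v K t (f t) -v h *v D)) as n2.
rewrite norm_scal_eq in n1.
pose proof (hb x) as hbx; pose proof (Rle_abs M); pose proof (norm_pos x).
assert (n3 : (Rabs M + 1) * vnorm x <= eps / 3 * Rabs h).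
{ replace (eps / 3 * Rabs h)
    with ((Rabs M + 1) * (eps / (3 * (Rabs M + 1)) * Rabs h)) by (field; lra).
  apply Rmult_le_compat_l; [lra | apply h1; lra]. }
assert (n4 : Rabs h * vnorm (K (t + h) d -v K t d) <= Rabs h * (eps / 3)).
{ apply Rmult_le_compat_l; [apply Rabs_pos | left; apply h3; lra]. }
specialize (h2 ltac:(lra)); nra.
Qed.

Lemma vcont_const {H : CHilbert} (x : H) t : vcont (fun _ => x) t.
Proof. eapply vder_cont, vder_const. Qed.

Lemma vder_linear {H G : CHilbert} (K : H -> G) M (f : R -> H) t d :
  rlinear K -> bounded_by M K -> vder f t d -> vder (fun s => K (f s)) t (K d).
Proof.
intros hK hM hf.
apply (vder_eq (fun s => K (f s)) t (vzero +v K d)); [vec |].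
apply (vder_family (fun _ => K) f t d vzero M 1).
- lra.
- auto.
- exact hf.
- apply vder_const.
- apply vcont_const.
Qed.

Lemma vder_scal {H : CHilbert} (g : R -> R) (f : R -> H) t l d : is_derive g t l -> vder f t d ->
  vder (fun s => g s *v f s) t (l *v f t +v g t *v d).
Proof.
intros hg hf.
assert (hx : forall x : H, vder (fun s => g s *v x) t (l *v x)).
{ intros x eps heps; pose proof (norm_pos x).
  destruct (proj1 (is_derive_eps g t l) hg (eps / (vnorm x + 1)))
    as (delta & hdelta & hb); [apply Rdiv_lt_0_compat; lra |].
  exists delta; split; [exact hdelta |]; intros h hh; specialize (hb h hh).
  replace (g (t + h) *v x -v g t *v x -v h *v (l *v x))
    with ((g (t + h) - g t - h * l) *v x) by vec.
  rewrite norm_scal_eq.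
  assert (e : eps = eps / (vnorm x + 1) * (vnorm x + 1)) by (field; lra).
  pose proof (Rabs_pos h); set (q := eps / (vnorm x + 1)) in *.
  apply Rle_trans with (q * Rabs h * vnorm x); [apply Rmult_le_compat_r; lra |].
  assert (0 < q) by (unfold q; apply Rdiv_lt_0_compat; lra).
  rewrite e; assert (0 <= q * Rabs h) by nra; nra. }
assert (hc := proj1 (is_derive_eps g t l) hg 1 ltac:(lra)).
destruct hc as (delta & hdelta & hb).
apply (vder_family (fun s x => g s *v x) f t d (l *v f t)
  (Rabs (g t) + 1 + Rabs l) (Rmin delta 1)).
- apply Rmin_pos; lra.
- intros s hs; split; [split; intros; vec |].
  intros x; rewrite norm_scal_eq; apply Rmult_le_compat_r; [apply norm_pos |].
  specialize (hb (s - t) (Rlt_le_trans _ _ _ hs (Rmin_l _ _))).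
  assert (hs' := Rlt_le_trans _ _ _ hs (Rmin_r _ _)).
  replace (t + (s - t)) with s in hb by ring.
  pose proof (Rabs_triang (g s - g t - (s - t) * l) (g t + (s - t) * l)) as h1.
  pose proof (Rabs_triang (g t) ((s - t) * l)) as h2.
  rewrite Rabs_mult in h2; pose proof (Rabs_pos l); pose proof (Rabs_pos (s - t)).
  replace (g s - g t - (s - t) * l + (g t + (s - t) * l)) with (g s) in h1 by ring; nra.
- exact hf.
- apply hx.
- eapply vder_cont, hx.
Qed.

Lemma vder_sub {H : CHilbert} (f g : R -> H) t d d' : vder f t d -> vder g t d' ->
  vder (fun s => f s -v g s) t (d -v d').
Proof.
intros hf hg.
assert (hg' : vder (fun s => (-1) *v g s) t ((-1) *v d')).
{ apply (vder_linear (fun x => (-1) *v x) 1); [split; intros; vec | | exact hg].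
  intros x; rewrite norm_scal_eq, Rabs_left1 by lra; lra. }
apply vder_eq with (d +v (-1) *v d'); [vec |].
apply vder_ext_loc with (fun s => f s +v (-1) *v g s) 1; [lra | intros; vec |].
apply vder_add; assumption.
Qed.

Lemma vder_rip {H : CHilbert} (f g : R -> H) t d d' : vder f t d -> vder g t d' ->
  is_derive (fun s => rip (f s) (g s)) t (rip d (g t) + rip (f t) d').
Proof.
intros hf hg; apply is_derive_eps; intros eps heps.
set (M := vnorm (f t) + vnorm (g t) + vnorm d + vnorm d' + 2).
pose proof (norm_pos (f t)); pose proof (norm_pos (g t)).
pose proof (norm_pos d); pose proof (norm_pos d').
assert (hM : 0 < M) by (unfold M; lra).
set (q := eps / (3 * M)).
assert (hq : 0 < q) by (unfold q; apply Rdiv_lt_0_compat; lra).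
assert (eq : eps = 3 * M * q) by (unfold q; field; lra).
destruct (hf q hq) as (d1 & hd1 & h1); destruct (hg q hq) as (d2 & hd2 & h2).
destruct (vder_cont g t d' hg (Rmin 1 q)) as (d3 & hd3 & h3); [apply Rmin_pos; lra |].
exists (Rmin d1 (Rmin d2 d3)); split; [repeat apply Rmin_pos; assumption |]; intros h hh.
pose proof (Rmin_l d1 (Rmin d2 d3)); pose proof (Rmin_r d1 (Rmin d2 d3)).
pose proof (Rmin_l d2 d3); pose proof (Rmin_r d2 d3).
specialize (h1 h ltac:(lra)); specialize (h2 h ltac:(lra)); specialize (h3 h ltac:(lra)).
pose proof (Rmin_l 1 q); pose proof (Rmin_r 1 q).
set (x := f (t + h) -v f t -v h *v d) in *; set (y := g (t + h) -v g t -v h *v d') in *.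
set (z := g (t + h) -v g t) in *.
replace (rip (f (t + h)) (g (t + h)) - rip (f t) (g t) - h * (rip d (g t) + rip (f t) d'))
  with (rip x (g t +v z) + (rip (f t) y + h * rip d z)).
2: { unfold x, y, z; rip_simpl; ring. }
pose proof (Rabs_triang (rip x (g t +v z)) (rip (f t) y + h * rip d z)) as t1.
pose proof (Rabs_triang (rip (f t) y) (h * rip d z)) as t2; rewrite Rabs_mult in t2.
pose proof (rip_CS_abs x (g t +v z)) as c1; pose proof (rip_CS_abs (f t) y) as c2.
pose proof (rip_CS_abs d z) as c3; pose proof (norm_add_le (g t) z) as c4.
pose proof (Rabs_pos h); pose proof (norm_pos x); pose proof (norm_pos y).
pose proof (norm_pos z).
assert (b1 : vnorm x * vnorm (g t +v z) <= q * Rabs h * M).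
{ apply Rmult_le_compat; [lra | apply norm_pos | lra | unfold M; lra]. }
assert (b2 : vnorm (f t) * vnorm y <= M * (q * Rabs h)).
{ apply Rmult_le_compat; [lra | lra | unfold M; lra | lra]. }
assert (b3 : vnorm d * vnorm z <= M * q).
{ apply Rmult_le_compat; [lra | lra | unfold M; lra | lra]. }
assert (b4 : Rabs h * Rabs (rip d z) <= Rabs h * (M * q)).
{ apply Rmult_le_compat_l; lra. }
rewrite eq; lra.
Qed.

Lemma incr_of_derive (phi dphi : R -> R) s t : s <= t ->
  (forall x, s <= x <= t -> is_derive phi x (dphi x)) ->
  (forall x, s <= x <= t -> 0 <= dphi x) -> phi s <= phi t.
Proof.
intros hst hd hp.
destruct (MVT_gen phi s t dphi) as (c & hc & e);
  rewrite ?Rmin_left, ?Rmax_right in * by exact hst.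
- intros x hx; apply hd; lra.
- intros x hx; apply continuity_pt_filterlim.
  apply (ex_derive_continuous (K := R_AbsRing) (V := R_NormedModule)).
  exists (dphi x); apply hd, hx.
- pose proof (hp c hc); nra.
Qed.

(** The mean value inequality, tested against the increment itself. *)
Lemma vder_mean {H : CHilbert} (f d : R -> H) (phi dphi : R -> R) s t : s <= t ->
  (forall x, s <= x <= t -> vder f x (d x)) ->
  (forall x, s <= x <= t -> is_derive phi x (dphi x)) ->
  (forall x, s <= x <= t -> vnorm (d x) <= dphi x) ->
  vnorm (f t -v f s) <= phi t - phi s.
Proof.
intros hst hf hphi hd; set (v := f t -v f s).
assert (h : vnorm v * phi s - rip (f s) v <= vnorm v * phi t - rip (f t) v).
{ apply (incr_of_derive (fun x => vnorm v * phi x - rip (f x) v)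
    (fun x => vnorm v * dphi x - rip (d x) v)); [exact hst | |].
  - intros x hx.
    assert (h1 := vder_rip f (fun _ => v) x (d x) vzero (hf x hx) (vder_const v x)).
    rewrite rip_zero_r, Rplus_0_r in h1.
    apply (is_derive_minus (fun x => vnorm v * phi x) (fun x => rip (f x) v));
      [| exact h1].
    apply (is_derive_scal phi x (vnorm v)), hphi, hx.
  - intros x hx; pose proof (hd x hx); pose proof (rip_CS (d x) v).
    pose proof (norm_pos v); nra. }
assert (e : rip v v = rip (f t) v - rip (f s) v) by (unfold v at 1; rip_simpl; ring).
rewrite rip_norm in e.
destruct (Req_dec (vnorm v) 0) as [e0 | hne].
- assert (phi s <= phi t).
  { apply incr_of_derive with dphi; [exact hst | exact hphi |]; intros x hx.
    pose proof (hd x hx); pose proof (norm_pos (d x)); lra. }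
  lra.
- pose proof (norm_pos v); apply Rmult_le_reg_l with (vnorm v); [lra | nra].
Qed.

Lemma vder_zero_const {H : CHilbert} (f : R -> H) s t : (forall x, vder f x vzero) -> f s = f t.
Proof.
intros hf.
assert (h : forall s t, s <= t -> f t = f s).
{ intros a b hab; apply vsub_0_eq, norm_0_eq, Rle_antisym; [| apply norm_pos].
  pose proof (vder_mean f (fun _ => vzero) (fun _ => 0) (fun _ => 0) a b hab) as h.
  rewrite Rminus_diag in h; apply h; intros; auto.
  - apply (is_derive_const (K := R_AbsRing) (V := R_NormedModule)).
  - rewrite norm_zero_eq; lra. }
destruct (Rle_or_lt s t); [symmetry; apply h; assumption | apply h; lra].
Qed.

(** The scalar mean value theorem, with the remainder itself as test vector,
    bounds the remainder by the oscillation of [d]. *)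
Lemma vder_of_weak {H : CHilbert} (f d : R -> H) t r : 0 < r ->
  (forall z s, Rabs (s - t) < r -> is_derive (fun s => rip (f s) z) s (rip (d s) z)) ->
  vcont d t -> vder f t (d t).
Proof.
intros hr hw hc eps heps; destruct (hc eps heps) as (delta & hdelta & hb).
exists (Rmin delta r); split; [apply Rmin_pos; assumption |]; intros h hh.
pose proof (Rmin_l delta r); pose proof (Rmin_r delta r).
set (v := f (t + h) -v f t -v h *v d t).
destruct (MVT_gen (fun s => rip (f s) v - s * rip (d t) v) t (t + h)
  (fun s => rip (d s) v - rip (d t) v)) as (c & hcc & e).
- intros x hx; apply (is_derive_minus (fun s => rip (f s) v) (fun s => s * rip (d t) v)).
  + apply hw; unfold Rabs in *; revert hx; unfold Rmin, Rmax.
    destruct (Rle_dec t (t + h)); destruct (Rcase_abs h); destruct (Rcase_abs (x - t)); lra.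
  + auto_derive; [exact I | ring].
- intros x hx; apply continuity_pt_filterlim.
  apply (ex_derive_continuous (K := R_AbsRing) (V := R_NormedModule)
    (fun s => rip (f s) v - s * rip (d t) v)).
  exists (rip (d x) v - rip (d t) v).
  apply (is_derive_minus (fun s => rip (f s) v) (fun s => s * rip (d t) v)).
  + apply hw; unfold Rabs in *; revert hx; unfold Rmin, Rmax.
    destruct (Rle_dec t (t + h)); destruct (Rcase_abs h); destruct (Rcase_abs (x - t)); lra.
  + auto_derive; [exact I | ring].
- assert (ev : rip v v = (rip (d c) v - rip (d t) v) * h).
  { transitivity (rip (f (t + h)) v - rip (f t) v - h * rip (d t) v);
      [unfold v at 1; rip_simpl; ring |]; lra. }
  assert (hdc : vnorm (d c -v d t) < eps).
  { replace c with (t + (c - t)) by ring; apply hb.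
    unfold Rabs in *; revert hcc; unfold Rmin, Rmax.
    destruct (Rle_dec t (t + h)); destruct (Rcase_abs h); destruct (Rcase_abs (c - t)); lra. }
  rewrite <- rip_sub_l in ev.
  pose proof (rip_CS_abs (d c -v d t) v) as hcs.
  assert (hv : vnorm v ^ 2 <= eps * Rabs h * vnorm v).
  { rewrite <- rip_norm, ev; eapply Rle_trans; [apply Rle_abs |]; rewrite Rabs_mult.
    pose proof (Rabs_pos h); pose proof (norm_pos v).
    assert (vnorm (d c -v d t) * vnorm v <= eps * vnorm v)
      by (apply Rmult_le_compat_r; lra); nra. }
  pose proof (norm_pos v); pose proof (Rabs_pos h).
  destruct (Req_dec (vnorm v) 0) as [e0 | hne]; [rewrite e0; nra |].
  apply Rmult_le_reg_l with (vnorm v); [lra | nra].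
Qed.

(** * Unitary groups and their generators *)

Section Group.

Context {H : CHilbert} (B : operator H) (T : R -> H -> H).
Context (Tgroup : unitary_group T).
Context (Tgen : generates B T).

Lemma T_linear t : rlinear (T t).
Proof. destruct (proj1 Tgroup t) as (h1 & h2 & _); split; intros; [apply h1 | apply h2]. Qed.

Lemma T_scal t r x : T t (r *v x) = r *v T t x.
Proof. apply T_linear. Qed.

Lemma T_sub t x y : T t (x -v y) = T t x -v T t y.
Proof. apply rlinear_sub, T_linear. Qed.

Lemma T_rip t x y : rip (T t x) (T t y) = rip x y.
Proof. destruct (proj1 Tgroup t) as (_ & _ & h & _); unfold rip; rewrite h; reflexivity. Qed.

Lemma T_norm t x : vnorm (T t x) = vnorm x.
Proof.
apply Rsqr_inj; try apply norm_pos.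
pose proof (T_rip t x x) as h; rewrite !rip_norm in h; unfold Rsqr; lra.
Qed.

Lemma T_0 x : T 0 x = x.
Proof. apply Tgroup. Qed.

Lemma T_plus s t x : T (s + t) x = T s (T t x).
Proof. apply Tgroup. Qed.

Lemma T_inv t x : T (- t) (T t x) = x.
Proof. rewrite <- T_plus, Rplus_opp_l; apply T_0. Qed.

Lemma T_inv' t x : T t (T (- t) x) = x.
Proof. rewrite <- T_plus, Rplus_opp_r; apply T_0. Qed.

Lemma gen_vder x y : in_graph B x y <-> vder (fun s => T s x) 0 y.
Proof.
rewrite (Tgen x y).
rewrite (filterlim_vnorm (F := locally' 0) (fun h : R => (/ h) *v (T h x -v x)) y); split.
- intros hl eps heps; destruct (hl eps heps) as [delta hd].
  exists delta; split; [apply cond_pos |]; intros h hh; simpl.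
  rewrite Rplus_0_l, T_0.
  destruct (Req_dec h 0) as [-> | hne].
  { rewrite T_0; replace (x -v x -v 0 *v y) with (vzero : H) by vec.
    rewrite norm_zero_eq, Rabs_R0; lra. }
  assert (hb : ball 0 delta h).
  { change (Rabs (h - 0) < delta); rewrite Rminus_0_r; exact hh. }
  specialize (hd h hb hne); simpl in hd.
  replace (T h x -v x -v h *v y) with (h *v ((/ h) *v (T h x -v x) -v y))
    by (vec; field; exact hne).
  rewrite norm_scal_eq; pose proof (Rabs_pos h); nra.
- intros hv eps heps; destruct (hv (eps / 2)) as (delta & hdelta & hd); [lra |].
  exists (mkposreal delta hdelta); intros h hb hne.
  change (Rabs (h - 0) < delta) in hb; rewrite Rminus_0_r in hb.
  specialize (hd h hb); simpl in hd; rewrite Rplus_0_l, T_0 in hd.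
  replace ((/ h) *v (T h x -v x) -v y) with ((/ h) *v (T h x -v x -v h *v y))
    by (vec; field; exact hne).
  rewrite norm_scal_eq, Rabs_inv; pose proof (Rabs_pos_lt h hne) as hp.
  apply Rmult_lt_reg_l with (Rabs h); [exact hp |].
  rewrite <- Rmult_assoc, Rinv_r by lra; nra.
Qed.

Lemma T_graph t x : dom B x -> in_graph B (T t x) (T t (B x)).
Proof.
intros hx; apply gen_vder.
assert (h := proj1 (gen_vder x (B x)) (conj hx eq_refl)).
apply vder_ext_loc with (fun s => T t (T s x)) 1; [lra | |].
- intros s _; rewrite <- !T_plus, Rplus_comm; reflexivity.
- apply (vder_linear (T t) 1); [apply T_linear | | exact h].
  intros y; rewrite T_norm; lra.
Qed.

Lemma T_dom t x : dom B x -> dom B (T t x).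
Proof. intros hx; apply T_graph, hx. Qed.

Lemma op_T t x : dom B x -> B (T t x) = T t (B x).
Proof. intros hx; symmetry; apply T_graph, hx. Qed.

Lemma T_vder c t x : dom B x -> vder (fun s => T (c * s) x) t (c *v T (c * t) (B x)).
Proof.
intros hx eps heps.
destruct (proj1 (gen_vder x (B x)) (conj hx eq_refl) (eps / (Rabs c + 1)))
  as (delta & hdelta & hd).
{ pose proof (Rabs_pos c); apply Rdiv_lt_0_compat; lra. }
pose proof (Rabs_pos c).
exists (delta / (Rabs c + 1)); split; [apply Rdiv_lt_0_compat; lra |]; intros h hh.
assert (hch : Rabs (c * h) < delta).
{ rewrite Rabs_mult; replace delta with ((Rabs c + 1) * (delta / (Rabs c + 1)))
    by (field; lra); pose proof (Rabs_pos h); nra. }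
specialize (hd _ hch); rewrite Rplus_0_l, T_0 in hd.
replace (T (c * (t + h)) x -v T (c * t) x -v h *v (c *v T (c * t) (B x)))
  with (T (c * t) (T (c * h) x -v x -v (c * h) *v B x)).
2: { rewrite !T_sub, T_scal, <- T_plus, <- Rmult_plus_distr_l; vec. }
rewrite T_norm; eapply Rle_trans; [exact hd |].
rewrite Rabs_mult.
replace (eps * Rabs h) with (eps / (Rabs c + 1) * ((Rabs c + 1) * Rabs h)) by (field; lra).
apply Rmult_le_compat_l; [left; apply Rdiv_lt_0_compat; lra |].
pose proof (Rabs_pos h); nra.
Qed.

Lemma T_vcont c t x : vcont (fun s => T (c * s) x) t.
Proof.
intros eps heps.
destruct (proj2 (proj2 (proj2 Tgroup)) x (c * t) (fun y => vnorm (y -v T (c * t) x) < eps))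
  as [delta hd].
{ pose proof (proj1 (filterlim_vnorm (F := locally (T (c * t) x)) (fun y : H => y) _)
    (filterlim_id _ _) eps heps) as h; exact h. }
pose proof (Rabs_pos c).
exists (delta / (Rabs c + 1)); split; [apply Rdiv_lt_0_compat; [apply cond_pos | lra] |].
intros h hh; apply hd.
change (Rabs (c * (t + h) - c * t) < delta).
replace (c * (t + h) - c * t) with (c * h) by ring.
rewrite Rabs_mult; replace (pos delta) with ((Rabs c + 1) * (delta / (Rabs c + 1)))
    by (field; lra); pose proof (Rabs_pos h); nra.
Qed.

(** The derivative of the group exists only at vectors of the domain, whereas
    the derivative [d] of [f] may be arbitrary. *)
Lemma T_product c (f : R -> H) t d : vder f t d -> dom B (f t) ->
  vder (fun s => T (c * s) (f s)) t (c *v T (c * t) (B (f t)) +v T (c * t) d).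
Proof.
intros hf hdom; apply (vder_family (fun s => T (c * s)) f t d _ 1 1).
- lra.
- intros s _; split; [apply T_linear |]; intros x; rewrite T_norm; lra.
- exact hf.
- apply T_vder, hdom.
- apply T_vcont.
Qed.

(** For [x] in the domain, [T (- sigma s) (K (T s x))] has derivative zero in
    [s]; the domain is dense. *)
Lemma intertwine (sigma M : R) (K : H -> H) : rlinear K -> bounded_by M K ->
  (forall x, dom B x -> dom B (K x) /\ K (B x) = sigma *v B (K x)) ->
  (forall x eps, 0 < eps -> exists y, dom B y /\ vnorm (y -v x) < eps) ->
  forall t x, K (T t x) = T (sigma * t) (K x).
Proof.
intros hK hM hB hdense t x.
assert (hdom : forall x, dom B x -> K (T t x) = T (sigma * t) (K x)).
{ clear x; intros x hx.
  set (f := fun s => T (- sigma * s) (K (T (1 * s) x))).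
  assert (hf : forall s, vder f s vzero).
  { intros s.
    assert (h1 := vder_linear K M (fun s => T (1 * s) x) s _ hK hM (T_vder 1 s x hx)).
    pose proof (T_dom (1 * s) x hx) as hd.
    eapply vder_eq; [| apply (T_product (- sigma) _ s _ h1); apply hB, hd].
    rewrite (proj2 hK), <- (op_T (1 * s) x hx), (proj2 (hB _ hd)), !T_scal; vec. }
  pose proof (vder_zero_const f 0 t hf) as e; unfold f in e.
  rewrite !Rmult_0_r, !T_0, Rmult_1_l in e.
  rewrite e, <- T_plus; replace (sigma * t + - sigma * t) with 0 by ring.
  symmetry; apply T_0. }
apply vsub_0_eq, norm_le_eps; intros eps heps.
assert (hM' : 0 < Rabs M + 1) by (pose proof (Rabs_pos M); lra).
destruct (hdense x (eps / (2 * (Rabs M + 1)))) as (y & hy & hyx);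
  [apply Rdiv_lt_0_compat; lra |].
replace (K (T t x) -v T (sigma * t) (K x))
  with (T (sigma * t) (K (y -v x)) -v K (T t (y -v x))).
2: { rewrite (T_sub t), !(rlinear_sub K) by exact hK; rewrite T_sub, hdom by exact hy; vec. }
eapply Rle_trans; [apply norm_sub_le |]; rewrite T_norm.
pose proof (hM (y -v x)) as h1; pose proof (hM (T t (y -v x))) as h2.
rewrite T_norm in h2; pose proof (norm_pos (y -v x)); pose proof (Rle_abs M).
assert (e : eps = 2 * ((Rabs M + 1) * (eps / (2 * (Rabs M + 1))))) by (field; lra).
assert ((Rabs M + 1) * vnorm (y -v x) <= (Rabs M + 1) * (eps / (2 * (Rabs M + 1))))
  by (apply Rmult_le_compat_l; lra).
nra.
Qed.

End Group.

(** * Integration of vector-valued functions *)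

Definition rcont (f : R -> R) (t : R) : Prop :=
  forall eps, 0 < eps -> exists delta, 0 < delta /\
    forall h, Rabs h < delta -> Rabs (f (t + h) - f t) < eps.

Lemma rcont_continuous (f : R -> R) t : rcont f t -> continuous f t.
Proof.
intros hf; apply continuity_pt_filterlim; intros eps heps.
destruct (hf eps heps) as (delta & hdelta & hd); exists delta; split; [exact hdelta |].
intros x [_ hx]; simpl; unfold Rdist in *.
replace x with (t + (x - t)) by ring; apply hd, hx.
Qed.

Lemma vcont_rip {H : CHilbert} (f : R -> H) (z : H) t :
  vcont f t -> rcont (fun s => rip (f s) z) t.
Proof.
intros hf eps heps; pose proof (norm_pos z).
destruct (hf (eps / (vnorm z + 1))) as (delta & hdelta & hd);
  [apply Rdiv_lt_0_compat; lra |].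
exists delta; split; [exact hdelta |]; intros h hh; specialize (hd h hh).
rewrite <- rip_sub_l; pose proof (rip_CS_abs (f (t + h) -v f t) z).
assert (e : eps = eps / (vnorm z + 1) * (vnorm z + 1)) by (field; lra).
assert (0 < eps / (vnorm z + 1)) by (apply Rdiv_lt_0_compat; lra).
nra.
Qed.

Lemma vcont_scal {H : CHilbert} (g : R -> R) (f : R -> H) t :
  rcont g t -> vcont f t -> vcont (fun s => g s *v f s) t.
Proof.
intros hg hf eps heps; pose proof (norm_pos (f t)); pose proof (Rabs_pos (g t)).
set (M := vnorm (f t) + Rabs (g t) + 2).
set (q := Rmin 1 (eps / (2 * M))).
assert (hM : 0 < M) by (unfold M; lra).
assert (hq : 0 < q) by (apply Rmin_pos; [lra | apply Rdiv_lt_0_compat; lra]).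
assert (hq1 : q <= 1) by apply Rmin_l.
assert (hqe : q * (2 * M) <= eps) by (apply Rle_div_r; [lra | apply Rmin_r]).
destruct (hg q hq) as (d1 & hd1 & h1); destruct (hf q hq) as (d2 & hd2 & h2).
exists (Rmin d1 d2); split; [apply Rmin_pos; assumption |]; intros h hh.
specialize (h1 h (Rlt_le_trans _ _ _ hh (Rmin_l _ _))).
specialize (h2 h (Rlt_le_trans _ _ _ hh (Rmin_r _ _))).
set (x := f (t + h) -v f t) in *; set (e := g (t + h) - g t) in *.
replace (g (t + h) *v f (t + h) -v g t *v f t)
  with ((g t + e) *v x +v e *v f t) by (unfold x, e; vec).
eapply Rle_lt_trans; [apply norm_add_le |]; rewrite !norm_scal_eq.
pose proof (Rabs_triang (g t) e); pose proof (norm_pos x); pose proof (Rabs_pos e).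
unfold M in hqe; nra.
Qed.

Lemma vcont_linear {H G : CHilbert} (K : H -> G) M (f : R -> H) t :
  rlinear K -> bounded_by M K -> vcont f t -> vcont (fun s => K (f s)) t.
Proof.
intros hK hM hf eps heps; pose proof (Rabs_pos M).
destruct (hf (eps / (Rabs M + 1))) as (delta & hdelta & hd);
  [apply Rdiv_lt_0_compat; lra |].
exists delta; split; [exact hdelta |]; intros h hh; specialize (hd h hh).
rewrite <- rlinear_sub by exact hK; eapply Rle_lt_trans; [apply hM |].
assert (e : eps = eps / (Rabs M + 1) * (Rabs M + 1)) by (field; lra).
assert (0 < eps / (Rabs M + 1)) by (apply Rdiv_lt_0_compat; lra).
pose proof (Rle_abs M); pose proof (norm_pos (f (t + h) -v f t)); nra.
Qed.

Section RInt.

Context {H : CHilbert}.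

(** Riemann integrals of continuous functions exist in complete real normed
    modules. *)
Definition restrict_complete : CompleteNormedModule R_AbsRing :=
  CompleteNormedModule.Pack R_AbsRing H
    (CompleteNormedModule.Class R_AbsRing H
       (NormedModule.class R_AbsRing (restrict_R H))
       (CompleteSpace.Mixin _ (@lim H) (@complete_cauchy H) (@close_lim H)))
    H.

Lemma riemann_sum_rip (f : R -> H) (z : H) ptd :
  rip (Riemann_sum (V := restrict_R H) f ptd) z = Riemann_sum (fun s => rip (f s) z) ptd.
Proof.
induction ptd using SF_cons_ind; simpl.
- apply rip_zero_l.
- rewrite !Riemann_sum_cons.
  change (rip ((SF_h ptd - fst h) *v f (snd h) +v Riemann_sum (V := restrict_R H) f ptd) z
    = (SF_h ptd - fst h) * rip (f (snd h)) z + Riemann_sum (fun s => rip (f s) z) ptd).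
  rewrite <- IHptd; rip_simpl; ring.
Qed.

(** Integrals of vector-valued functions are only used through their real inner
    products with fixed vectors. *)
Lemma is_RInt_rip (f : R -> H) (z Y : H) a b :
  is_RInt (V := restrict_R H) f a b Y -> is_RInt (fun s => rip (f s) z) a b (rip Y z).
Proof.
unfold is_RInt; intros hf.
apply (filterlim_ext (fun ptd =>
  rip (@scal _ (restrict_R H) (sign (b - a)) (Riemann_sum (V := restrict_R H) f ptd)) z)).
{ intros ptd; rewrite <- riemann_sum_rip; apply rip_scal_l. }
assert (PF : Filter (Riemann_fine a b)) by apply Riemann_fine_filter.
pose proof (proj1 (filterlim_vnorm (F := Riemann_fine a b) (H := H) _ Y) hf) as hf'.
apply filterlim_locally; intros eps; pose proof (norm_pos z).
assert (hq : 0 < eps / (vnorm z + 1))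
  by (apply Rdiv_lt_0_compat; [apply cond_pos | lra]).
specialize (hf' _ hq); revert hf'; apply filter_imp; intros ptd hp.
match goal with |- ball _ _ (rip ?w z) => set (x := w) in * end.
change (Rabs (rip x z - rip Y z) < eps); rewrite <- rip_sub_l.
pose proof (rip_CS_abs (x -v Y) z).
assert (e : pos eps = eps / (vnorm z + 1) * (vnorm z + 1)) by (field; lra).
change (vnorm (x -v Y) < eps / (vnorm z + 1)) in hp; nra.
Qed.

Lemma ex_primitive (f : R -> H) (x : H) : (forall t, vcont f t) ->
  exists F : R -> H, F 0 = x /\ forall t, vder F t (f t).
Proof.
intros hf.
assert (hI : forall t, exists Y, is_RInt (V := restrict_complete) f 0 t Y).
{ intros t; apply (ex_RInt_continuous (V := restrict_complete)); intros s _.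
  apply (proj2 (filterlim_vnorm (F := locally s) (H := H) f (f s))); intros eps heps.
  destruct (hf s eps heps) as (delta & hdelta & hd); exists (mkposreal delta hdelta).
  intros s' hs'; replace s' with (s + (s' - s)) by ring; apply hd, hs'. }
set (F := fun t => x +v (RInt (V := restrict_complete) f 0 t : H)).
assert (hF : forall t, is_RInt (V := restrict_complete) f 0 t (RInt (V := restrict_complete) f 0 t)).
{ intros t; apply (RInt_correct (V := restrict_complete)), hI. }
exists F; split.
- unfold F; rewrite (RInt_point (V := restrict_complete)).
  change (x +v vzero = x); vec.
- intros t; apply vder_of_weak with 1; [lra | | apply hf].
  intros z s _.
  apply (is_derive_ext (fun s => rip x z + rip (RInt (V := restrict_complete) f 0 s : H) z)).
  { intros s'; unfold F; rewrite rip_add_l; reflexivity. }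
  rewrite <- (Rplus_0_l (rip (f s) z)).
  apply (is_derive_plus (V := R_NormedModule)
    (fun _ => rip x z) (fun s => rip (RInt (V := restrict_complete) f 0 s : H) z)).
  { apply (is_derive_const (K := R_AbsRing) (V := R_NormedModule)). }
  apply (is_derive_RInt (V := R_NormedModule) (fun s => rip (f s) z) _ 0).
  + apply filter_forall; intros s'; apply is_RInt_rip, (hF s').
  + apply rcont_continuous, vcont_rip, hf.
Qed.

End RInt.

(** * Damped waves *)

Definition hcont {H : CHilbert} (f : R -> H) : Prop :=
  forall t, 0 <= t -> forall eps, 0 < eps -> exists delta, 0 < delta /\
    forall s, 0 <= s -> Rabs (s - t) < delta -> vnorm (f s -v f t) < eps.

Definition hrcont (b : R -> R) : Prop :=
  forall t, 0 <= t -> forall eps, 0 < eps -> exists delta, 0 < delta /\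
    forall s, 0 <= s -> Rabs (s - t) < delta -> Rabs (b s - b t) < eps.

Lemma Rmax0_lip t h : Rabs (Rmax 0 (t + h) - Rmax 0 t) <= Rabs h.
Proof.
unfold Rmax, Rabs; destruct (Rle_dec 0 (t + h)), (Rle_dec 0 t);
  destruct (Rcase_abs h); destruct (Rcase_abs _); lra.
Qed.

Lemma hcont_extend {H : CHilbert} (f : R -> H) t :
  hcont f -> vcont (fun s => f (Rmax 0 s)) t.
Proof.
intros hf eps heps; destruct (hf (Rmax 0 t) (Rmax_l _ _) eps heps) as (delta & hd & h).
exists delta; split; [exact hd |]; intros s hs; apply h; [apply Rmax_l |].
eapply Rle_lt_trans; [apply Rmax0_lip | exact hs].
Qed.

Lemma hrcont_extend (b : R -> R) t : hrcont b -> rcont (fun s => b (Rmax 0 s)) t.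
Proof.
intros hf eps heps; destruct (hf (Rmax 0 t) (Rmax_l _ _) eps heps) as (delta & hd & h).
exists delta; split; [exact hd |]; intros s hs; apply h; [apply Rmax_l |].
eapply Rle_lt_trans; [apply Rmax0_lip | exact hs].
Qed.

Lemma hcont_vcont {H : CHilbert} (f : R -> H) t : hcont f -> 0 < t -> vcont f t.
Proof.
intros hf ht eps heps; destruct (hf t (Rlt_le _ _ ht) eps heps) as (delta & hd & h).
exists (Rmin delta t); split; [apply Rmin_pos; assumption |]; intros s hs.
assert (h1 := Rlt_le_trans _ _ _ hs (Rmin_l _ _)).
assert (h2 := Rlt_le_trans _ _ _ hs (Rmin_r _ _)); apply Rabs_lt_between in h2.
apply h; [lra | replace (t + s - t) with s by ring; exact h1].
Qed.

Lemma hrcont_rcont (b : R -> R) t : hrcont b -> 0 < t -> rcont b t.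
Proof.
intros hf ht eps heps; destruct (hf t (Rlt_le _ _ ht) eps heps) as (delta & hd & h).
exists (Rmin delta t); split; [apply Rmin_pos; assumption |]; intros s hs.
assert (h1 := Rlt_le_trans _ _ _ hs (Rmin_l _ _)).
assert (h2 := Rlt_le_trans _ _ _ hs (Rmin_r _ _)); apply Rabs_lt_between in h2.
apply h; [lra | replace (t + s - t) with s by ring; exact h1].
Qed.

Lemma hcont_linear {H G : CHilbert} (K : H -> G) M (f : R -> H) :
  rlinear K -> bounded_by M K -> hcont f -> hcont (fun s => K (f s)).
Proof.
intros hK hM hf t ht eps heps; pose proof (Rabs_pos M).
destruct (hf t ht (eps / (Rabs M + 1))) as (delta & hdelta & hd);
  [apply Rdiv_lt_0_compat; lra |].
exists delta; split; [exact hdelta |]; intros s hs hst; specialize (hd s hs hst).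
rewrite <- rlinear_sub by exact hK; eapply Rle_lt_trans; [apply hM |].
assert (e : eps = eps / (Rabs M + 1) * (Rabs M + 1)) by (field; lra).
assert (0 < eps / (Rabs M + 1)) by (apply Rdiv_lt_0_compat; lra).
pose proof (Rle_abs M); pose proof (norm_pos (f s -v f t)); nra.
Qed.

Lemma hcont_sub {H : CHilbert} (f g : R -> H) :
  hcont f -> hcont g -> hcont (fun s => f s -v g s).
Proof.
intros hf hg t ht eps heps.
destruct (hf t ht (eps / 2)) as (d1 & hd1 & h1); [lra |].
destruct (hg t ht (eps / 2)) as (d2 & hd2 & h2); [lra |].
exists (Rmin d1 d2); split; [apply Rmin_pos; assumption |]; intros s hs hst.
specialize (h1 s hs (Rlt_le_trans _ _ _ hst (Rmin_l _ _))).
specialize (h2 s hs (Rlt_le_trans _ _ _ hst (Rmin_r _ _))).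
replace (f s -v g s -v (f t -v g t)) with ((f s -v f t) -v (g s -v g t)) by vec.
eapply Rle_lt_trans; [apply norm_sub_le | lra].
Qed.

(** Derivatives are available on the open half line only; continuity carries
    constancy to its end point. *)
Lemma const_from_zero {H : CHilbert} (f : R -> H) :
  hcont f -> (forall t, 0 < t -> vder f t vzero) -> forall t, 0 <= t -> f t = f 0.
Proof.
intros hc hd t ht; destruct (Req_dec t 0) as [-> | hne]; [reflexivity |].
apply vsub_0_eq, norm_le_eps; intros eps heps.
destruct (hc 0 (Rle_refl 0) eps heps) as (delta & hdelta & h).
set (s := Rmin t (delta / 2)).
assert (hs : 0 < s) by (apply Rmin_pos; lra).
assert (hst : s <= t) by apply Rmin_l.
assert (hsd : s <= delta / 2) by apply Rmin_r.
assert (e : f t = f s).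
{ apply vsub_0_eq, norm_0_eq, Rle_antisym; [| apply norm_pos].
  replace 0 with (0 - 0) by ring.
  apply (vder_mean f (fun _ => vzero) (fun _ => 0) (fun _ => 0)); auto.
  - intros x hx; apply hd; lra.
  - intros; apply (is_derive_const (K := R_AbsRing) (V := R_NormedModule)).
  - intros; rewrite norm_zero_eq; lra. }
rewrite e; left; apply h; [lra |]; rewrite Rminus_0_r, Rabs_pos_eq; lra.
Qed.

(** ** Componentwise operators on the phase space *)

Section Phase.

Context {H : CHilbert}.
Notation HH := (prod_CHilbert H H).

Lemma pair_eq (U V : HH) : fst U = fst V -> snd U = snd V -> U = V.
Proof. destruct U, V; simpl; intros -> ->; reflexivity. Qed.

(** The generator is [rot] followed by [L] in both components, and the
    reflection [flip], which is [1 - 2 damp], anticommutes with it. *)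
Definition damp (U : HH) : HH := (vzero, snd U).
Definition flip (U : HH) : HH := (fst U, vopp (snd U)).
Definition rot (U : HH) : HH := (snd U, vopp (fst U)).

Definition diag (K : H -> H) (U : HH) : HH := (K (fst U), K (snd U)).

Lemma fst_linear : rlinear (fst : HH -> H).
Proof. split; reflexivity. Qed.

Lemma snd_linear : rlinear (snd : HH -> H).
Proof. split; reflexivity. Qed.

Lemma fst_bounded : bounded_by 1 (fst : HH -> H).
Proof. intros x; rewrite Rmult_1_l; apply norm_fst_le. Qed.

Lemma snd_bounded : bounded_by 1 (snd : HH -> H).
Proof. intros x; rewrite Rmult_1_l; apply norm_snd_le. Qed.

Lemma damp_linear : rlinear damp.
Proof.
split; intros; apply pair_eq; try reflexivity.
- change (vzero = (vzero : H) +v vzero); vec.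
- change (vzero = r *v (vzero : H)); vec.
Qed.

Lemma flip_linear : rlinear flip.
Proof.
split; intros; apply pair_eq; try reflexivity.
- change (vopp ((snd x : H) +v snd y) = vopp (snd x : H) +v vopp (snd y : H)); vec.
- change (vopp (r *v (snd x : H)) = r *v vopp (snd x : H)); vec.
Qed.

Lemma rot_linear : rlinear rot.
Proof.
split; intros; apply pair_eq; try reflexivity.
- change (vopp ((fst x : H) +v fst y) = vopp (fst x : H) +v vopp (fst y : H)); vec.
- change (vopp (r *v (fst x : H)) = r *v vopp (fst x : H)); vec.
Qed.

Lemma diag_linear K : rlinear K -> rlinear (diag K).
Proof.
intros [h1 h2]; split; intros; apply pair_eq; [apply h1 | apply h1 | apply h2 | apply h2].
Qed.

Lemma norm_of_sq_le {G G' : CHilbert} (x : G) (y : G') (M : R) :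
  0 <= M -> rip x x <= M ^ 2 * rip y y -> vnorm x <= M * vnorm y.
Proof.
intros hM h; pose proof (norm_pos y); apply norm_le_of_sq; [apply Rmult_le_pos; lra |].
rewrite (rip_norm y) in h; nra.
Qed.

Lemma damp_bounded : bounded_by 1 damp.
Proof.
intros x; apply norm_of_sq_le; [lra |]; rewrite !prod_rip; simpl.
rewrite rip_zero_l; pose proof (rip_pos (fst x : H)); lra.
Qed.

Lemma flip_norm x : vnorm (flip x) = vnorm x.
Proof.
apply Rsqr_inj; try apply norm_pos; unfold Rsqr.
pose proof (rip_norm x) as h1; pose proof (rip_norm (flip x)) as h2.
rewrite prod_rip in h1, h2; simpl in h2; rewrite rip_opp_l, rip_opp_r in h2.
simpl in h1; lra.
Qed.

Lemma flip_bounded : bounded_by 1 flip.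
Proof. intros x; rewrite flip_norm; lra. Qed.

Lemma rot_bounded : bounded_by 1 rot.
Proof.
intros x; apply norm_of_sq_le; [lra |]; rewrite !prod_rip; simpl.
rewrite rip_opp_l, rip_opp_r; lra.
Qed.

Lemma diag_bounded K M : 0 <= M -> bounded_by M K -> bounded_by M (diag K).
Proof.
intros hM hK x; apply norm_of_sq_le; [exact hM |]; rewrite !prod_rip; simpl.
rewrite !rip_norm; pose proof (hK (fst x)); pose proof (hK (snd x)).
pose proof (norm_pos (K (fst x))); pose proof (norm_pos (K (snd x))).
assert (vnorm (K (fst x)) ^ 2 <= (M * vnorm (fst x : H)) ^ 2) by (apply pow_incr; lra).
assert (vnorm (K (snd x)) ^ 2 <= (M * vnorm (snd x : H)) ^ 2) by (apply pow_incr; lra).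
simpl in *; lra.
Qed.

Lemma diag_damp K U : rlinear K -> diag K (damp U) = damp (diag K U).
Proof.
intros hK; apply pair_eq; [| reflexivity]; simpl.
rewrite <- (vscal_0 vzero), (proj2 hK), !vscal_0; reflexivity.
Qed.

Lemma flip_damp U : U -v 2 *v damp U = flip U.
Proof.
apply pair_eq.
- change ((fst U : H) -v 2 *v vzero = fst U); vec.
- change ((snd U : H) -v 2 *v snd U = vopp (snd U)); vec.
Qed.

End Phase.

Section Wave.

Context {H : CHilbert} (L : operator H).
Context (Lsa : self_adjoint L).
Context (Lpos : nonneg_operator L).
Notation HH := (prod_CHilbert H H).
Context (T : R -> HH -> HH).
Context (Tgroup : unitary_group T).
Context (Tgen : generates (wave_operator L) T).

Let B := wave_operator L.

Lemma wave_dense (U : HH) eps : 0 < eps -> exists V, dom B V /\ vnorm (V -v U) < eps.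
Proof.
intros heps.
destruct (sa_dense L Lsa (fst U) (eps / 2)) as (y1 & hy1 & h1); [lra |].
destruct (sa_dense L Lsa (snd U) (eps / 2)) as (y2 & hy2 & h2); [lra |].
set (Y := (y1, y2) : HH); exists Y; split; [split; assumption |].
pose proof (prod_norm_sq (H1 := H) (H2 := H) (Y -v U)) as h.
change (vnorm (Y -v U) ^ 2
  = vnorm (y1 -v fst U) ^ 2 + vnorm (y2 -v snd U) ^ 2) in h.
pose proof (norm_pos (y1 -v fst U)); pose proof (norm_pos (y2 -v snd U)).
pose proof (norm_pos (Y -v U)).
apply Rsqr_incrst_0; [unfold Rsqr; nra | assumption | lra].
Qed.

(** Reversing the velocity anticommutes with the generator. *)
Lemma flip_T t U : flip (T t U) = T (- t) (flip U).
Proof.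
replace (- t) with (-1 * t) by ring.
apply (intertwine B T Tgroup Tgen (-1) 1 flip flip_linear flip_bounded);
  [| exact wave_dense].
intros V [hV1 hV2]; split.
- split; [exact hV1 |]; simpl; rewrite <- vscal_m1; apply dom_vscal, hV2.
- apply pair_eq; simpl.
  + change (L (snd V) = (-1) *v L (vopp (snd V))).
    rewrite <- vscal_m1, op_vscal by exact hV2; vec.
  + change (vopp (vopp (L (fst V))) = (-1) *v vopp (L (fst V))); vec.
Qed.

Lemma res_T e t U : 0 < e -> diag (res L e) (T t U) = T t (diag (res L e) U).
Proof.
intros he; rewrite <- (Rmult_1_l t) at 2.
apply (intertwine B T Tgroup Tgen 1 1 (diag (res L e))).
- apply diag_linear, res_linear; assumption.
- apply diag_bounded; [lra |]; intros x; rewrite Rmult_1_l.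
  apply res_norm; assumption.
- intros V [hV1 hV2]; split; [split; apply res_dom; assumption |].
  apply pair_eq; simpl.
  + change (res L e (L (snd V)) = 1 *v L (res L e (snd V))).
    rewrite res_comm_op by assumption; vec.
  + change (res L e (vopp (L (fst V))) = 1 *v vopp (L (res L e (fst V)))).
    rewrite <- res_comm_op by assumption; rewrite <- vscal_m1.
    rewrite (proj2 (res_linear L Lsa Lpos e he)); vec.
- exact wave_dense.
Qed.

Lemma res_diag_linear e : 0 < e -> rlinear (diag (res L e)).
Proof. intros he; apply diag_linear, res_linear; assumption. Qed.

Lemma res_diag_bounded e : 0 < e -> bounded_by 1 (diag (res L e)).
Proof.
intros he; apply diag_bounded; [lra |]; intros x; rewrite Rmult_1_l.
apply res_norm; assumption.
Qed.

Lemma res_diag_dom e U : 0 < e -> dom B (diag (res L e) U).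
Proof. intros he; split; apply res_dom; assumption. Qed.

(** In the frame moving with the free group the mild equation becomes an
    ordinary differential equation with bounded coefficients. *)
Definition damped (b : R -> R) (U : R -> HH) : Prop :=
  hcont U /\ forall t, 0 < t ->
    vder (fun s => T (- s) (U s)) t ((- 2 * b t) *v T (- t) (damp (U t))).

Lemma T_vcont_comp (f : R -> HH) t : vcont f t -> vcont (fun s => T (- s) (f s)) t.
Proof.
intros hf eps heps.
destruct (hf (eps / 2)) as (d1 & hd1 & h1); [lra |].
destruct (T_vcont T Tgroup (-1) t (f t) (eps / 2)) as (d2 & hd2 & h2); [lra |].
exists (Rmin d1 d2); split; [apply Rmin_pos; assumption |]; intros h hh.
specialize (h1 h (Rlt_le_trans _ _ _ hh (Rmin_l _ _))).
specialize (h2 h (Rlt_le_trans _ _ _ hh (Rmin_r _ _))).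
replace (T (- (t + h)) (f (t + h)) -v T (- t) (f t))
  with (T (- (t + h)) (f (t + h) -v f t) +v (T (-1 * (t + h)) (f t) -v T (-1 * t) (f t))).
2: { rewrite (T_sub T Tgroup).
  replace (-1 * (t + h)) with (- (t + h)) by ring; replace (-1 * t) with (- t) by ring; vec. }
eapply Rle_lt_trans; [apply norm_add_le |]; rewrite (T_norm T Tgroup); lra.
Qed.

(** Paired with a fixed vector, the mild equation exhibits [T (- s) (U s)] as a
    scalar integral of a continuous function; the weak derivative is then a
    strong one. *)
Lemma mild_damped (b : R -> R) (U0 : HH) (U : R -> HH) : hrcont b -> mild_solution T b U0 U ->
  damped b U /\ U 0 = U0.
Proof.
intros hb (hc & h0 & hmild); split; [| exact h0].
assert (hU : hcont U).
{ intros t ht eps heps.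
  pose proof (proj1 (filterlim_vnorm (H := HH) (F := within (Rle 0) (locally t)) U (U t))
    (hc t ht) eps heps) as [delta hd].
  exists delta; split; [apply cond_pos |]; intros s hs hst; apply hd; assumption. }
split; [exact hU |]; intros t ht.
set (g := fun s => (2 * b s) *v T (- s) (damp (U s))).
assert (hg : forall s, T (- s) (((vzero : H), (2 * b s) *v (snd (U s) : H)) : HH) = g s).
{ intros s; unfold g; rewrite <- (T_scal T Tgroup); f_equal.
  apply pair_eq; [| reflexivity].
  change (vzero = (2 * b s) *v (vzero : H)); vec. }
assert (hI : forall z s, 0 <= s ->
  is_RInt (fun r => rip (g r) z) 0 s (rip U0 z - rip (T (- s) (U s)) z)).
{ intros z s hs; destruct (hmild s hs) as (Y & hY & hUs).
  apply (is_RInt_rip (H := HH) _ (T s z)) in hY.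
  replace (rip U0 z - rip (T (- s) (U s)) z) with (rip (Y : HH) (T s z)).
  - apply (is_RInt_ext (V := R_NormedModule)
      (fun r => rip (T (s - r) (((vzero : H), (2 * b r) *v (snd (U r) : H)) : HH)) (T s z)));
      [| exact hY].
    intros r _; rewrite <- hg; unfold Rminus.
    rewrite (T_plus T Tgroup); apply (T_rip T Tgroup).
  - change (U s = T s U0 -v (Y : HH)) in hUs.
    rewrite hUs, (T_sub T Tgroup), (T_inv T Tgroup), rip_sub_l.
    rewrite <- (T_rip T Tgroup s (T (- s) (Y : HH))), (T_inv' T Tgroup); ring. }
assert (hgc : forall s, 0 < s -> vcont g s).
{ intros s hs; apply vcont_scal.
  - intros eps heps; destruct (hrcont_rcont b s hb hs (eps / 2)) as (d & hd & h); [lra |].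
    exists d; split; [exact hd |]; intros r hr; specialize (h r hr).
    rewrite <- Rmult_minus_distr_l, Rabs_mult, Rabs_pos_eq; lra.
  - apply T_vcont_comp, (vcont_linear damp 1 U s damp_linear damp_bounded).
    apply hcont_vcont; assumption. }
apply vder_eq with ((-1) *v g t); [unfold g; vec |].
apply (vder_of_weak (fun s => T (- s) (U s)) (fun s => (-1) *v g s) t t ht).
- intros z s hs; apply Rabs_lt_between in hs.
  apply (is_derive_ext (V := R_NormedModule)
    (fun r => rip U0 z - (rip U0 z - rip (T (- r) (U r)) z))).
  { intros r; change (rip U0 z - (rip U0 z - rip (T (- r) (U r)) z) = rip (T (- r) (U r)) z); ring. }
  replace (rip ((-1) *v g s) z) with (0 - rip (g s) z) by (rip_simpl; ring).
  apply (is_derive_minus (V := R_NormedModule) (fun _ => rip U0 z)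
    (fun r => rip U0 z - rip (T (- r) (U r)) z)).
  { apply (is_derive_const (K := R_AbsRing) (V := R_NormedModule)). }
  apply (is_derive_RInt (V := R_NormedModule) (fun s => rip (g s) z) _ 0).
  + exists (mkposreal s ltac:(lra)); intros r hr; apply hI.
    change (Rabs (r - s) < s) in hr; apply Rabs_lt_between in hr; lra.
  + apply rcont_continuous, vcont_rip, hgc; lra.
- apply (vcont_linear (fun x : HH => (-1) *v x) 1);
    [split; intros; vec | | apply hgc, ht].
  intros x; rewrite norm_scal_eq, Rabs_left1 by lra; lra.
Qed.

Lemma damped_sub b U V : damped b U -> damped b V -> damped b (fun s => U s -v V s).
Proof.
intros [hU hU'] [hV hV']; split; [apply hcont_sub; assumption |]; intros t ht.
apply vder_eq with ((- 2 * b t) *v T (- t) (damp (U t))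
  -v (- 2 * b t) *v T (- t) (damp (V t))).
{ rewrite rlinear_sub by apply damp_linear; rewrite (T_sub T Tgroup); vec. }
apply vder_ext_loc with (fun s => T (- s) (U s) -v T (- s) (V s)) 1; [lra | |].
{ intros s _; rewrite (T_sub T Tgroup); reflexivity. }
apply vder_sub; auto.
Qed.

(** Functions of [L] commute with the group and with the damping. *)
Lemma damped_res b U e : 0 < e -> damped b U -> damped b (fun s => diag (res L e) (U s)).
Proof.
intros he [hU hU']; split.
{ apply (hcont_linear _ 1); auto using res_diag_linear, res_diag_bounded. }
intros t ht.
apply vder_ext_loc with (fun s => diag (res L e) (T (- s) (U s))) 1; [lra | |].
{ intros s _; apply res_T, he. }
apply vder_eq with (diag (res L e) ((- 2 * b t) *v T (- t) (damp (U t)))).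
{ rewrite (proj2 (res_diag_linear e he)), res_T, diag_damp by
    (exact he || apply res_linear; assumption); reflexivity. }
apply (vder_linear _ 1); auto using res_diag_linear, res_diag_bounded.
Qed.

(** The derivative of the energy is [- 4 b |u'|^2]. *)
Lemma damped_decreasing b U s t : (forall t, 0 <= t -> 0 <= b t) -> damped b U ->
  0 <= s <= t -> vnorm (U t) <= vnorm (U s).
Proof.
intros hb [hU hU'] [hs hst].
assert (pos : forall s t, 0 < s -> s <= t -> vnorm (U t) <= vnorm (U s)).
{ clear s t hs hst; intros s t hs hst.
  apply Rsqr_incr_0_var; [| apply norm_pos].
  enough (- rip (U s) (U s) <= - rip (U t) (U t))
    by (rewrite !rip_norm in *; unfold Rsqr; lra).
  rewrite <- (T_rip T Tgroup (- s)), <- (T_rip T Tgroup (- t) (U t)).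
  apply (incr_of_derive (fun r => - rip (T (- r) (U r)) (T (- r) (U r)))
    (fun r => 4 * b r * rip (snd (U r) : H) (snd (U r)))); [exact hst | |].
  - intros r hr; assert (hr' : 0 < r) by lra.
    pose proof (vder_rip _ _ r _ _ (hU' r hr') (hU' r hr')) as h.
    replace (4 * b r * rip (snd (U r) : H) (snd (U r)))
      with (- (rip ((- 2 * b r) *v T (- r) (damp (U r))) (T (- r) (U r))
        + rip (T (- r) (U r)) ((- 2 * b r) *v T (- r) (damp (U r))))).
    + apply (is_derive_opp (V := R_NormedModule)
        (fun r => rip (T (- r) (U r)) (T (- r) (U r)))), h.
    + rip_simpl; rewrite !(T_rip T Tgroup), !prod_rip; simpl.
      rewrite rip_zero_l, rip_zero_r; ring.
  - intros r hr; pose proof (hb r ltac:(lra)); pose proof (rip_pos (snd (U r) : H)); nra. }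
apply le_epsilon; intros eps heps.
destruct (Req_dec s t) as [-> | hne]; [lra |].
destruct (hU s hs eps heps) as (delta & hdelta & h).
set (r := Rmin t (s + delta / 2)).
assert (hr : s < r) by (apply Rmin_glb_lt; lra).
assert (hrt : r <= t) by apply Rmin_l.
assert (hrd : r <= s + delta / 2) by apply Rmin_r.
pose proof (pos r t ltac:(lra) hrt).
assert (vnorm (U r -v U s) < eps) by (apply h; [lra | rewrite Rabs_pos_eq; lra]).
pose proof (norm_add_le (U r -v U s) (U s)) as h'.
replace (U r -v U s +v U s) with (U r) in h' by vec; lra.
Qed.

Lemma damped_unique b U V : (forall t, 0 <= t -> 0 <= b t) -> damped b U -> damped b V ->
  U 0 = V 0 -> forall t, 0 <= t -> U t = V t.
Proof.
intros hb hU hV e t ht; apply vsub_0_eq, norm_0_eq, Rle_antisym; [| apply norm_pos].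
pose proof (damped_decreasing b _ 0 t hb (damped_sub b U V hU hV) ltac:(lra)) as h.
simpl in h; rewrite e in h; replace (V 0 -v V 0) with (vzero : HH) in h by vec.
rewrite norm_zero_eq in h; exact h.
Qed.

(** Resolvents map into the domain of the generator, so that regularised mild
    solutions solve the first order system in the strong sense. *)
Lemma damped_res_vder b U e t : 0 < e -> 0 < t -> damped b U ->
  vder (fun s => res L e (fst (U s))) t (L (res L e (snd (U t)))) /\
  vder (fun s => res L e (snd (U s))) t
    ((-1) *v L (res L e (fst (U t))) -v (2 * b t) *v res L e (snd (U t))).
Proof.
intros he ht hU; destruct (damped_res b U e he hU) as [_ hV].
set (V := fun s => diag (res L e) (U s)) in *.
assert (hd : vder V t (B (V t) -v (2 * b t) *v damp (V t))).
{ apply vder_ext_loc with (fun s => T (1 * s) (T (- s) (V s))) 1; [lra | |].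
  { intros s _; rewrite Rmult_1_l; apply (T_inv' T Tgroup). }
  assert (hdom : dom B (T (- t) (V t))).
  { apply (T_dom B T Tgroup Tgen); apply res_diag_dom, he. }
  eapply vder_eq; [| apply (T_product B T Tgroup Tgen 1 _ t _ (hV t ht) hdom)].
  rewrite (op_T B T Tgroup Tgen) by (apply res_diag_dom, he).
  rewrite (T_scal T Tgroup), Rmult_1_l, !(T_inv' T Tgroup); unfold V; vec. }
split.
- apply (vder_linear (fst : HH -> H) 1 V t _ fst_linear fst_bounded) in hd.
  revert hd; apply vder_eq.
  change (L (res L e (snd (U t))) -v (2 * b t) *v (vzero : H) = L (res L e (snd (U t)))); vec.
- apply (vder_linear (snd : HH -> H) 1 V t _ snd_linear snd_bounded) in hd.
  revert hd; apply vder_eq.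
  change (vopp (L (res L e (fst (U t)))) -v (2 * b t) *v (res L e (snd (U t)) : H)
    = (-1) *v L (res L e (fst (U t))) -v (2 * b t) *v res L e (snd (U t))); vec.
Qed.

End Wave.

(** ** Size and evolution of the functional *)

Section LyapBounds.

Context {H : CHilbert} (a : H -> H).
Context (alin : rlinear a).
Context (asym : forall x y, rip (a x) y = rip x (a y)).
Context (apos : forall x, rip (a x) (a x) <= rip (a x) x).
Context (k : nat) (beta : R) (p y r : H).
Context (hbeta : 0 <= beta <= 1 / 2).

(** The virial term is [2 beta <a y, p>], hence at most half of the energy. *)
Lemma lyap_lower : rip p p + rip y y <= 2 * lyap a k beta p y r.
Proof.
unfold lyap.
pose proof (wgt_ge a alin asym apos k (a (r -v p))) as h1.
pose proof (rip_pos (a (r -v p))) as h2.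
pose proof (wgt_ge a alin asym apos k p) as h3.
pose proof (wgt_ge a alin asym apos k y) as h4.
pose proof (wgt_pos_a a alin asym apos k (p +v y)) as h5.
pose proof (wgt_pos_e a alin asym apos k p) as h6.
pose proof (wgt_pos_e a alin asym apos k y) as h7.
assert (e : rip (wgt a k (a p)) y = rip (wgt a k (a y)) p).
{ rewrite wgt_sym, asym, wgt_a, rip_sym by assumption; reflexivity. }
rewrite (a_add a alin), (wgt_add a alin) in h5; rip_simpl_in h5; rewrite e in h5.
rewrite (wgt_sub a alin) in h6, h7; rip_simpl_in h6; rip_simpl_in h7.
set (X := rip (wgt a k (a y)) p) in *; set (Y := rip (wgt a k (a (r -v p))) (a (r -v p))) in *.
assert (- (rip (wgt a k p) p + rip (wgt a k y) y) <= 2 * X) by lra.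
pose proof (rip_pos p); pose proof (rip_pos y); nra.
Qed.

Lemma lyap_upper M : 0 <= M -> vnorm p <= M -> vnorm y <= M -> vnorm r <= M ->
  lyap a k beta p y r <= 2 ^ k * (7 * M ^ 2).
Proof.
intros hM hp hy hr; unfold lyap.
assert (ha : forall x, vnorm (a x) <= vnorm x).
{ intros x; apply norm_le_of_sq; [apply norm_pos |]; rewrite <- rip_norm.
  apply a_norm; assumption. }
assert (hw : forall x x' N N', vnorm x <= N -> vnorm x' <= N' ->
  rip (wgt a k x) x' <= 2 ^ k * (N * N')).
{ intros x x' N N' hx hx'; eapply Rle_trans; [apply rip_CS |].
  pose proof (wgt_norm a apos k x) as h.
  rewrite <- Rmult_assoc; apply Rmult_le_compat; try apply norm_pos; [| exact hx'].
  eapply Rle_trans; [exact h |]; apply Rmult_le_compat_l; [apply pow_le; lra | exact hx]. }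
assert (hd : vnorm (a (r -v p)) <= 2 * M).
{ eapply Rle_trans; [apply ha |]; pose proof (norm_sub_le r p); lra. }
pose proof (hw p p M M hp hp); pose proof (hw y y M M hy hy).
pose proof (hw (a y) p M M (Rle_trans _ _ _ (ha y) hy) hp).
pose proof (hw _ _ _ _ hd hd).
assert (0 <= 2 ^ k * (M * M)) by (apply Rmult_le_pos; [apply pow_le | nra]; lra).
nra.
Qed.

End LyapBounds.

Section ResolventFamily.

Context {H : CHilbert} (L : operator H).
Context (Lsa : self_adjoint L).
Context (Lpos : nonneg_operator L).

Lemma res_lin_pos t : 0 < t -> rlinear (res L t) /\
  (forall x y, rip (res L t x) y = rip x (res L t y)) /\
  (forall x, rip (res L t x) (res L t x) <= rip (res L t x) x).
Proof.
intros ht; split; [apply res_linear; assumption | split; intros].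
- apply res_symmetric; assumption.
- apply res_pos; assumption.
Qed.

(** The resolvent identity, applied twice. *)
Lemma res_id_vder t x : 0 < t ->
  vder (fun s => res L s x) t ((- / t) *v res L t (x -v res L t x)).
Proof.
intros ht eps heps; set (w := x -v res L t x).
assert (hw : vnorm (w -v res L t w) <= 2 * vnorm w).
{ pose proof (norm_sub_le w (res L t w)); pose proof (res_norm L Lsa Lpos t w ht); lra. }
pose proof (norm_pos w).
exists (Rmin (t / 2) (eps * t ^ 2 / (2 * vnorm w + 1))); split.
{ apply Rmin_pos; [lra |]; apply Rdiv_lt_0_compat; [| lra].
  apply Rmult_lt_0_compat; [lra | apply pow_lt, ht]. }
intros h hh.
assert (h1 := Rlt_le_trans _ _ _ hh (Rmin_l _ _)); apply Rabs_lt_between in h1.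
assert (h2 := Rlt_le_trans _ _ _ hh (Rmin_r _ _)).
assert (hth : 0 < t + h) by lra.
rewrite (res_diff L Lsa Lpos (t + h) t x) by assumption; fold w.
replace (((t - (t + h)) / t) *v res L (t + h) w -v h *v ((- / t) *v res L t w))
  with ((- (h / t)) *v (res L (t + h) w -v res L t w)) by (vec; field; lra).
rewrite (res_diff L Lsa Lpos (t + h) t w) by assumption.
rewrite !norm_scal_eq; replace (t - (t + h)) with (- h) by ring.
unfold Rdiv; rewrite Rabs_Ropp, !Rabs_mult, Rabs_Ropp, Rabs_inv, (Rabs_pos_eq t) by lra.
pose proof (res_norm L Lsa Lpos (t + h) (w -v res L t w) hth) as h3.
assert (h4 : Rabs h * (2 * vnorm w + 1) < eps * t ^ 2).
{ apply Rlt_div_r; [lra | exact h2]. }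
pose proof (Rabs_pos h).
assert (h5 : Rabs h * vnorm (res L (t + h) (w -v res L t w)) <= eps * t ^ 2) by nra.
set (n := vnorm (res L (t + h) (w -v res L t w))) in *.
replace (Rabs h * / t * (Rabs h * / t * n)) with (Rabs h * ((Rabs h * n) * / t ^ 2))
  by (field; lra).
rewrite (Rmult_comm eps); apply Rmult_le_compat_l; [assumption |].
apply Rle_div_l; [apply pow_lt, ht | exact h5].
Qed.

Lemma res_vder f df t : 0 < t -> vder f t ((/ t) *v df) ->
  vder (fun s => res L s (f s)) t
    ((/ t) *v (res L t df -v res L t (f t -v res L t (f t)))).
Proof.
intros ht hf; pose proof (res_linear L Lsa Lpos t ht) as hlin.
apply vder_eq with
  ((- / t) *v res L t (f t -v res L t (f t)) +v res L t ((/ t) *v df)).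
{ rewrite (proj2 hlin); vec. }
apply (vder_family (res L) f t ((/ t) *v df) _ 1 t ht).
- intros s hs; apply Rabs_lt_between in hs; assert (hs' : 0 < s) by lra.
  split; [apply res_linear; assumption |]; intros x; rewrite Rmult_1_l.
  apply res_norm; assumption.
- exact hf.
- apply res_id_vder, ht.
- eapply vder_cont, res_id_vder, ht.
Qed.

Lemma wgt_vder k f df t : 0 < t -> vder f t ((/ t) *v df) ->
  vder (fun s => wgt (res L s) k (f s)) t
    ((/ t) *v (wgt (res L t) k df
       -v INR k *v wgt (res L t) (pred k) (res L t (f t -v res L t (f t))))).
Proof.
intros ht hf; pose proof (res_linear L Lsa Lpos t ht) as hlin.
induction k as [| k IH].
{ simpl; revert hf; apply vder_eq; vec. }
eapply vder_eq; [| apply (vder_add _ _ t _ _ IH (res_vder _ _ t ht IH))].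
set (g := res L t (f t -v res L t (f t))).
rewrite <- (wgt_a _ hlin), <- (wgt_sub _ hlin), <- (wgt_a _ hlin); fold g.
rewrite S_INR; simpl pred.
destruct k as [| k].
- simpl; rewrite (rlinear_sub _ _ _ hlin), (proj2 hlin); vec.
- simpl pred; rewrite (rlinear_sub _ _ _ hlin), (proj2 hlin).
  generalize (INR (S k)); intros c; simpl; vec.
Qed.

Lemma form_vder j f df g dg t : 0 < t -> vder f t ((/ t) *v df) -> vder g t ((/ t) *v dg) ->
  is_derive (fun s => rip (wgt (res L s) (S j) (f s)) (g s)) t
    (/ t * form_der (res L t) j (f t) df (g t) dg).
Proof.
intros ht hf hg.
pose proof (vder_rip _ _ t _ _ (wgt_vder (S j) f df t ht hf) hg) as h.
unfold form_der; simpl pred in h.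
replace (/ t * _) with
  (rip ((/ t) *v (wgt (res L t) (S j) df
     -v INR (S j) *v wgt (res L t) j (res L t (f t -v res L t (f t))))) (g t)
   + rip (wgt (res L t) (S j) (f t)) ((/ t) *v dg)); [exact h |].
rewrite rip_scal_l, rip_scal_r; ring.
Qed.

Lemma lyap_vder j (beta : R -> R) dbeta p y r dp dy dr t : 0 < t ->
  is_derive beta t (/ t * dbeta) ->
  vder p t ((/ t) *v dp) -> vder y t ((/ t) *v dy) -> vder r t ((/ t) *v dr) ->
  is_derive (fun s => lyap (res L s) (S j) (beta s) (p s) (y s) (r s)) t
    (/ t * lyap_der (res L t) j (beta t) dbeta (p t) (y t) (r t) dp dy dr).
Proof.
intros ht hb hp hy hr.
assert (hd : vder (fun s => r s -v p s) t ((/ t) *v (dr -v dp))).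
{ apply vder_eq with ((/ t) *v dr -v (/ t) *v dp); [vec | apply vder_sub; assumption]. }
pose proof (res_vder _ _ t ht hd) as hq.
pose proof (res_vder _ _ t ht hy) as hay.
pose proof (form_vder j _ _ _ _ t ht hp hp) as h1.
pose proof (form_vder j _ _ _ _ t ht hy hy) as h2.
pose proof (form_vder j _ _ _ _ t ht hay hp) as h3.
pose proof (form_vder j _ _ _ _ t ht hq hq) as h4.
unfold lyap, lyap_der; cbv zeta.
set (F1 := form_der _ _ _ dp _ _) in *; set (F2 := form_der _ _ _ dy _ _) in *.
set (F3 := form_der _ _ (res L t (y t)) _ _ _) in *.
set (F4 := form_der _ _ (res L t (r t -v p t)) _ _ _) in *.
set (X := fun s => rip (wgt (res L s) (S j) (res L s (y s))) (p s)) in *.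
replace (/ t * (F1 + F2 + (2 * dbeta * rip (wgt (res L t) (S j) (res L t (y t))) (p t)
  + 2 * beta t * F3) + F4))
  with (/ t * F1 + / t * F2 + (2 * (/ t * dbeta) * X t + 2 * beta t * (/ t * F3)) + / t * F4)
  by (unfold X; ring).
apply (is_derive_plus (V := R_NormedModule)
  (fun s => rip (wgt (res L s) (S j) (p s)) (p s) + rip (wgt (res L s) (S j) (y s)) (y s)
    + 2 * beta s * X s)
  (fun s => rip (wgt (res L s) (S j) (res L s (r s -v p s))) (res L s (r s -v p s))));
  [| exact h4].
apply (is_derive_plus (V := R_NormedModule)
  (fun s => rip (wgt (res L s) (S j) (p s)) (p s) + rip (wgt (res L s) (S j) (y s)) (y s))
  (fun s => 2 * beta s * X s)).
- apply (is_derive_plus (V := R_NormedModule)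
    (fun s => rip (wgt (res L s) (S j) (p s)) (p s))
    (fun s => rip (wgt (res L s) (S j) (y s)) (y s))); assumption.
- apply (is_derive_mult (fun s => 2 * beta s) X t (2 * (/ t * dbeta)) (/ t * F3));
    [| exact h3 | intros; apply Rmult_comm].
  apply (is_derive_scal beta t 2), hb.
Qed.

End ResolventFamily.

(** * The uniform bound *)

Section UniformBound.

Context {H : CHilbert} (L : operator H).
Context (Lsa : self_adjoint L).
Context (Lpos : nonneg_operator L).
Notation HH := (prod_CHilbert H H).
Context (T : R -> HH -> HH).
Context (Tgroup : unitary_group T).
Context (Tgen : generates (wave_operator L) T).

Lemma wgt_op k t x : 0 < t -> dom L x ->
  dom L (wgt (res L t) k x) /\ L (wgt (res L t) k x) = wgt (res L t) k (L x).
Proof.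
intros ht hx; induction k as [| k [IH1 IH2]]; simpl; [auto |].
split; [apply dom_add; [exact IH1 | apply res_dom; assumption] |].
rewrite op_add, <- res_comm_op, IH2 by (assumption || apply res_dom; assumption).
reflexivity.
Qed.

Lemma wgt_op_sym k t x y : 0 < t -> dom L x -> dom L y ->
  rip (wgt (res L t) k x) (t *v L y) = rip (wgt (res L t) k y) (t *v L x).
Proof.
intros ht hx hy; destruct (res_lin_pos L Lsa Lpos t ht) as (h1 & h2 & _).
rewrite !rip_scal_r; f_equal.
rewrite <- (sa_symmetric L Lsa) by (exact hy || apply wgt_op; assumption).
rewrite (proj2 (wgt_op k t x ht hx)), (wgt_sym _ h1 h2); apply rip_sym.
Qed.

Context (b db lam : R -> R) (Cb T0 : R).
Context (hbder : forall t, 0 < t -> is_derive b t (db t)).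
Context (hbpos : forall t, 0 <= t -> 0 <= b t).
Context (hlam : forall t, 0 < t -> is_derive lam t (b t * lam t)).
Context (hlampos : forall t, 0 < lam t).
Context (hCb : forall t, 0 < t -> Rabs (t ^ 2 * db t) <= Cb).
Context (hT0 : 1 <= T0).
Context (hsmall : forall t, T0 <= t -> t * b t <= 1 / 2).

(** The position [u] is the primitive of the velocity. That [L u] is the first
    component of [U] is proved after applying a resolvent, since only then both
    sides are differentiable. *)
Lemma position (U : R -> HH) u1 : damped T b U -> dom L u1 -> L u1 = fst (U 0) ->
  exists x : R -> H,
    (forall t, 0 < t -> vder x t (snd (U t))) /\
    (forall t, 0 <= t -> vnorm (x t) <= vnorm u1 + t * vnorm (U 0)) /\
    (forall e t, 0 < e -> 0 <= t -> L (res L e (x t)) = res L e (fst (U t))).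
Proof.
intros hU hu1 e1.
destruct (ex_primitive (fun s => snd (U (Rmax 0 s)) : H) u1) as (x & hx0 & hx).
{ intros t; apply (vcont_linear (snd : HH -> H) 1 (fun s => U (Rmax 0 s)));
    [apply snd_linear | apply snd_bounded | apply hcont_extend, hU]. }
assert (hxt : forall t, 0 < t -> vder x t (snd (U t))).
{ intros t ht; pose proof (hx t) as h; rewrite Rmax_right in h by lra; exact h. }
assert (hxc : hcont x).
{ intros t ht eps heps; destruct (vder_cont _ _ _ (hx t) eps heps) as (d & hd & h).
  exists d; split; [exact hd |]; intros s _ hs.
  replace s with (t + (s - t)) by ring; apply h, hs. }
exists x; split; [exact hxt | split].
- intros t ht.
  pose proof (vder_mean x (fun s => snd (U (Rmax 0 s))) (fun s => s * vnorm (U 0))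
    (fun _ => vnorm (U 0)) 0 t ht) as h.
  rewrite hx0, Rmult_0_l, Rminus_0_r in h.
  pose proof (norm_add_le (x t -v u1) u1) as h'.
  replace (x t -v u1 +v u1) with (x t) in h' by vec.
  enough (vnorm (x t -v u1) <= t * vnorm (U 0)) by lra.
  apply h; intros s hs; [apply hx | auto_derive; [exact I | ring] |].
  eapply Rle_trans; [apply (norm_snd_le (H1 := H) (H2 := H)) |].
  apply (damped_decreasing T Tgroup b); auto; split; [lra | apply Rmax_l].
- intros e t he ht.
  set (LR := fun v : H => (/ e) *v (v -v res L e v)).
  assert (hLR : forall v, L (res L e v) = LR v) by (intros; apply op_res'; assumption).
  pose proof (res_linear L Lsa Lpos e he) as hlin.
  assert (LRlin : rlinear LR).
  { split; intros; unfold LR; [rewrite (proj1 hlin) | rewrite (proj2 hlin)]; vec. }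
  assert (LRb : bounded_by (/ e * 2) LR).
  { intros v; unfold LR; rewrite norm_scal_eq, Rabs_pos_eq
      by (left; apply Rinv_0_lt_compat, he).
    rewrite Rmult_assoc; apply Rmult_le_compat_l; [left; apply Rinv_0_lt_compat, he |].
    pose proof (norm_sub_le v (res L e v)); pose proof (res_norm L Lsa Lpos e v he); lra. }
  rewrite hLR; symmetry; apply vsub_0_eq.
  rewrite (const_from_zero (fun s => res L e (fst (U s)) -v LR (x s))); [| | | exact ht].
  + rewrite hx0, <- e1, <- hLR, res_comm_op by assumption; vec.
  + apply hcont_sub.
    * apply (hcont_linear (fun V : HH => fst (diag (res L e) V)) 1 U); [| | apply hU].
      { split; intros; [apply (proj1 hlin) | apply (proj2 hlin)]. }
      { intros V; rewrite Rmult_1_l; eapply Rle_trans; [apply res_norm; assumption |].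
        apply (norm_fst_le (H1 := H) (H2 := H)). }
    * apply (hcont_linear LR _ x LRlin LRb hxc).
  + intros s hs.
    pose proof (proj1 (damped_res_vder L Lsa Lpos T Tgroup Tgen b U e s he hs hU)) as h1.
    pose proof (vder_linear LR _ x s _ LRlin LRb (hxt s hs)) as h2.
    rewrite hLR in h1; eapply vder_eq; [| apply (vder_sub _ _ _ _ _ h1 h2)]; vec.
Qed.

(** After regularisation, [p = lam u'], [y = lam L u] and [r = lam u / t] satisfy
    the system for which the functional decreases from [T0] on. Up to the time
    [T0] the decay of the energy and the linear growth of [u] are enough, which
    is where the norm of [u1] itself enters. *)
Lemma uniform_bound : exists K, 0 <= K /\
  forall (U : R -> HH) u1, damped T b U -> dom L u1 -> L u1 = fst (U 0) ->
  forall t, T0 <= t -> lam t * vnorm (U t) <= K * (vnorm u1 + vnorm (U 0)).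
Proof.
destruct (INR_unbounded (64 + 32 * Cb)) as [j hj].
(* twice the constant of [lyap_upper], because of [lyap_lower] *)
set (k := S j); set (K := 14 * 2 ^ k * lam T0).
assert (h2k : 1 <= 2 ^ k) by (apply pow_R1_Rle; lra).
assert (hlT : 0 < lam T0) by apply hlampos.
assert (hK : 0 <= K) by (unfold K; nra).
exists K; split; [exact hK |]; intros U u1 hU hu1 e1 t ht.
destruct (position U u1 hU hu1 e1) as (x & hx & hxn & hLx).
set (M := lam T0 * (vnorm u1 + vnorm (U 0))).
pose proof (norm_pos u1) as hn1; pose proof (norm_pos (U 0)) as hn0.
assert (hM : 0 <= M) by (unfold M; nra).
assert (hreg : forall e, 0 < e ->
  lam t * vnorm (diag (res L e) (diag (res L e) (U t))) <= 14 * 2 ^ k * M).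
{ intros e he.
  set (p := fun s => lam s *v res L e (res L e (snd (U s)))).
  set (y := fun s => lam s *v res L e (res L e (fst (U s)))).
  set (r := fun s => (lam s / s) *v res L e (res L e (x s))).
  pose proof (res_linear L Lsa Lpos e he) as hlin.
  assert (hrb : bounded_by 1 (res L e)).
  { intros v; rewrite Rmult_1_l; apply res_norm; assumption. }
  assert (hdp : forall s, 0 < s -> dom L (p s)).
  { intros; apply dom_vscal, res_dom; assumption. }
  assert (hdy : forall s, 0 < s -> dom L (y s)).
  { intros; apply dom_vscal, res_dom; assumption. }
  assert (hdr : forall s, 0 < s -> dom L (r s)).
  { intros; apply dom_vscal, res_dom; assumption. }
  assert (hLr : forall s, 0 < s -> s *v L (r s) = y s).
  { intros s hs; unfold r, y; rewrite op_vscal by (apply res_dom; assumption).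
    rewrite <- (res_comm_op L Lsa Lpos e (res L e (x s))) by auto using res_dom.
    rewrite hLx by lra; vec; field; lra. }
  set (dp := fun s => (- (s * b s)) *v p s -v s *v L (y s)).
  set (dy := fun s => (s * b s) *v y s +v s *v L (p s)).
  set (dr := fun s => p s -v (1 - s * b s) *v r s).
  assert (vp : forall s, 0 < s -> vder p s ((/ s) *v dp s)).
  { intros s hs.
    pose proof (proj2 (damped_res_vder L Lsa Lpos T Tgroup Tgen b U e s he hs hU)) as h.
    apply (vder_linear (res L e) 1 _ s _ hlin hrb) in h.
    eapply vder_eq; [| apply (vder_scal lam _ s _ _ (hlam s hs) h)].
    unfold dp, p, y; rewrite op_vscal by (apply res_dom; assumption).
    rewrite (rlinear_sub _ _ _ hlin), !(proj2 hlin), res_comm_op by auto using res_dom.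
    vec; field; lra. }
  assert (vy : forall s, 0 < s -> vder y s ((/ s) *v dy s)).
  { intros s hs.
    pose proof (proj1 (damped_res_vder L Lsa Lpos T Tgroup Tgen b U e s he hs hU)) as h.
    apply (vder_linear (res L e) 1 _ s _ hlin hrb) in h.
    eapply vder_eq; [| apply (vder_scal lam _ s _ _ (hlam s hs) h)].
    unfold dy, p, y; rewrite op_vscal by (apply res_dom; assumption).
    rewrite res_comm_op by auto using res_dom.
    vec; field; lra. }
  assert (vr : forall s, 0 < s -> vder r s ((/ s) *v dr s)).
  { intros s hs.
    pose proof (vder_linear (res L e) 1 _ s _ hlin hrb (hx s hs)) as h.
    apply (vder_linear (res L e) 1 _ s _ hlin hrb) in h.
    assert (hl : is_derive (fun s => lam s / s) s ((b s * lam s * s - lam s * 1) / s ^ 2)).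
    { apply is_derive_div; [apply hlam, hs | | lra].
      apply (is_derive_id (K := R_AbsRing)). }
    eapply vder_eq; [| apply (vder_scal _ _ s _ _ hl h)].
    unfold dr, p, r; vec; field; lra. }
  set (lyp := fun s => lyap (res L s) k (s * b s) (p s) (y s) (r s)).
  assert (hdec : lyp t <= lyp T0).
  { apply Ropp_le_cancel.
    apply (incr_of_derive (fun s => - lyp s) (fun s => - (/ s *
      lyap_der (res L s) j (s * b s) (s * b s + s ^ 2 * db s) (p s) (y s) (r s)
        (dp s) (dy s) (dr s)))); [exact ht | |].
    - intros s hs; assert (hs' : 0 < s) by lra.
      apply (is_derive_opp (V := R_NormedModule) lyp).
      apply (lyap_vder L Lsa Lpos j (fun s => s * b s)); auto.
      replace (/ s * (s * b s + s ^ 2 * db s)) with (1 * b s + s * db s)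
        by (field; lra).
      apply (is_derive_mult (fun s => s) b s 1 (db s));
        [apply (is_derive_id (K := R_AbsRing)) | apply hbder, hs' | intros; apply Rmult_comm].
    - intros s hs; assert (hs' : 0 < s) by lra.
      destruct (res_lin_pos L Lsa Lpos s hs') as (a1 & a2 & a3).
      enough (lyap_der (res L s) j (s * b s) (s * b s + s ^ 2 * db s) (p s) (y s) (r s)
        (dp s) (dy s) (dr s) <= 0).
      { pose proof (Rinv_0_lt_compat s hs'); nra. }
      (* the logarithmic derivative of [t b] is [t b + t^2 b'] *)
      apply (lyap_der_le (res L s) a1 a2 a3 j (p s) (y s) (r s) (s *v L (y s)) (s *v L (p s)))
        with (C := Cb).
      + rewrite <- hLr, (proj2 a1) by exact hs'; apply res_op; auto.
      + rewrite (proj2 a1); apply res_op; auto.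
      + rewrite (proj2 a1); apply res_op; auto.
      + apply wgt_op_sym; auto.
      + split; [| apply hsmall; lra].
        apply Rmult_le_pos; [lra | apply hbpos; lra].
      + apply hCb, hs'.
      + rewrite S_INR; lra. }
  assert (hT0' : 0 < T0) by lra.
  assert (hUT : vnorm (U T0) <= vnorm (U 0)).
  { apply (damped_decreasing T Tgroup b); auto; lra. }
  assert (hrr : forall v, vnorm (res L e (res L e v)) <= vnorm v).
  { intros v; eapply Rle_trans; apply res_norm; assumption. }
  assert (hup : lyp T0 <= 2 ^ k * (7 * M ^ 2)).
  { destruct (res_lin_pos L Lsa Lpos T0 hT0') as (a1 & a2 & a3).
    assert (hscal : forall v : H, vnorm v <= vnorm u1 + vnorm (U 0) -> vnorm (lam T0 *v v) <= M).
    { intros v hv; rewrite norm_scal_eq, Rabs_pos_eq by lra.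
      apply Rmult_le_compat_l; lra. }
    apply lyap_upper; auto.
    - split; [| apply hsmall; lra]; apply Rmult_le_pos; [lra | apply hbpos; lra].
    - apply hscal; eapply Rle_trans; [apply hrr |].
      pose proof (norm_snd_le (H1 := H) (H2 := H) (U T0)); lra.
    - apply hscal; eapply Rle_trans; [apply hrr |].
      pose proof (norm_fst_le (H1 := H) (H2 := H) (U T0)); lra.
    - unfold r.
      replace ((lam T0 / T0) *v res L e (res L e (x T0)))
        with (lam T0 *v ((/ T0) *v res L e (res L e (x T0)))) by (vec; field; lra).
      apply hscal; rewrite norm_scal_eq, Rabs_pos_eq
        by (left; apply Rinv_0_lt_compat, hT0').
      apply Rmult_le_reg_l with T0; [exact hT0' |].
      rewrite <- Rmult_assoc, Rinv_r, Rmult_1_l by lra.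
      pose proof (hrr (x T0)); pose proof (hxn T0 ltac:(lra)); nra. }
  assert (hlow : rip (p t) (p t) + rip (y t) (y t) <= 2 * lyp t).
  { assert (ht' : 0 < t) by lra.
    destruct (res_lin_pos L Lsa Lpos t ht') as (a1 & a2 & a3).
    apply lyap_lower; auto; split; [| apply hsmall, ht].
    apply Rmult_le_pos; [lra | apply hbpos; lra]. }
  set (V := diag (res L e) (diag (res L e) (U t))).
  assert (eV : rip (lam t *v V) (lam t *v V) = rip (p t) (p t) + rip (y t) (y t)).
  { rewrite prod_rip; apply Rplus_comm. }
  rewrite <- (Rabs_pos_eq (lam t)) by (left; apply hlampos).
  rewrite <- norm_scal_eq; apply norm_le_of_sq; [nra |].
  rewrite eV; assert (0 <= M ^ 2) by apply pow2_ge_0.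
  apply Rle_trans with (14 * 2 ^ k * M ^ 2); [lra |].
  rewrite Rpow_mult_distr; apply Rmult_le_compat_r; nra. }
apply Rle_trans with (14 * 2 ^ k * M); [| unfold K, M; lra].
apply le_epsilon; intros eps heps.
assert (hlt : 0 < lam t) by apply hlampos.
set (q := eps / (4 * lam t)).
assert (hq : 0 < q) by (unfold q; apply Rdiv_lt_0_compat; lra).
destruct (res_to_id L Lsa Lpos (fst (U t)) q hq) as (d1 & hd1 & h1).
destruct (res_to_id L Lsa Lpos (snd (U t)) q hq) as (d2 & hd2 & h2).
set (e := Rmin d1 d2 / 2).
assert (he : 0 < e) by (apply Rdiv_lt_0_compat; [apply Rmin_pos; assumption | lra]).
pose proof (Rmin_l d1 d2); pose proof (Rmin_r d1 d2).
specialize (h1 e ltac:(unfold e in *; lra)); specialize (h2 e ltac:(unfold e in *; lra)).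
set (D := diag (res L e)) in *.
assert (hD : vnorm (D (U t) -v U t) <= 2 * q).
{ apply norm_le_of_sq; [lra |]; rewrite prod_rip.
  pose proof (norm_sq_le _ _ (Rlt_le _ _ h1)); pose proof (norm_sq_le _ _ (Rlt_le _ _ h2)).
  change (rip (res L e (fst (U t)) -v fst (U t)) (res L e (fst (U t)) -v fst (U t))
    + rip (res L e (snd (U t)) -v snd (U t)) (res L e (snd (U t)) -v snd (U t))
    <= (2 * q) ^ 2); nra. }
assert (hDD : vnorm (D (D (U t)) -v D (U t)) <= 2 * q).
{ rewrite <- rlinear_sub by (apply res_diag_linear; assumption).
  pose proof (res_diag_bounded L Lsa Lpos e he (D (U t) -v U t)); unfold D in *; lra. }
pose proof (hreg e he) as h.
pose proof (norm_sub_trans (U t) (D (U t)) (D (D (U t)))) as n1.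
pose proof (norm_add_le (D (D (U t))) (U t -v D (D (U t)))) as n2.
replace (D (D (U t)) +v (U t -v D (D (U t)))) with (U t) in n2 by vec.
rewrite (norm_sub_sym (U t) (D (U t))), (norm_sub_sym (D (U t)) (D (D (U t)))) in n1.
assert (hN : vnorm (U t) <= vnorm (D (D (U t))) + 4 * q) by lra.
assert (eq : lam t * (4 * q) = eps) by (unfold q; field; lra).
assert (lam t * vnorm (U t) <= lam t * (vnorm (D (D (U t))) + 4 * q))
  by (apply Rmult_le_compat_l; lra).
unfold D in *; lra.
Qed.

End UniformBound.

(** * Convergence in the frame of the free group *)

Section Scattering.

Context {H : CHilbert} (L : operator H).
Context (Lsa : self_adjoint L).
Context (Lpos : nonneg_operator L).
Context (Lker : forall x, dom L x -> L x = vzero -> x = vzero).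
Notation HH := (prod_CHilbert H H).
Context (T : R -> HH -> HH).
Context (Tgroup : unitary_group T).
Context (Tgen : generates (wave_operator L) T).
Context (b db lam : R -> R) (Cb T0 : R).
Context (hbder : forall t, 0 < t -> is_derive b t (db t)).
Context (hbpos : forall t, 0 <= t -> 0 <= b t).
Context (hlam : forall t, 0 < t -> is_derive lam t (b t * lam t)).
Context (hlampos : forall t, 0 < lam t).
Context (hCb : forall t, 0 < t -> Rabs (t ^ 2 * db t) <= Cb).
Context (hT0 : 1 <= T0).
Context (hsmall : forall t, T0 <= t -> t * b t <= 1 / 2).

Let B := wave_operator L.

Section Trajectory.

Context (U : R -> HH) (Kw : R).
Context (hU : damped T b U).

Let W (t : R) : HH := lam t *v T (- t) (U t).
Context (hW : forall t, T0 <= t -> vnorm (W t) <= Kw).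

(** The factor [lam] turns [- 2 b damp] into [b (1 - 2 damp)], a reflection. As
    it anticommutes with the generator, conjugating it by the group leaves an
    oscillating factor. *)
Lemma W_vder t : 0 < t -> vder W t (b t *v flip (T (2 * t) (W t))).
Proof.
intros ht; eapply vder_eq; [| apply (vder_scal lam _ t _ _ (hlam t ht) (proj2 hU t ht))].
unfold W; rewrite (T_scal T Tgroup), <- (T_plus T Tgroup).
replace (2 * t + - t) with t by ring.
rewrite (proj2 flip_linear), (flip_T L Lsa T Tgroup Tgen), <- flip_damp.
rewrite (T_sub T Tgroup), (T_scal T Tgroup); vec.
Qed.

Lemma diag_flip K (V : HH) : rlinear K -> diag K (flip V) = flip (diag K V).
Proof.
intros hK; apply pair_eq; [reflexivity |]; simpl.
rewrite <- !vscal_m1; apply hK.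
Qed.

(** The part [(1 - (1 + tau L)^-1) W] lies in the range of
    the generator, so the oscillating integrand is an exact derivative up to
    terms of order [t^-2]. *)
Lemma high_cauchy tau : 0 < tau ->
  exists A, 0 <= A /\ forall s t, T0 <= s -> s <= t ->
    vnorm ((W t -v diag (res L tau) (W t)) -v (W s -v diag (res L tau) (W s))) <= A / s.
Proof.
intros htau; set (D := diag (res L tau)).
pose proof (res_diag_linear L Lsa Lpos tau htau) as hDlin; fold D in hDlin.
pose proof (res_diag_bounded L Lsa Lpos tau htau) as hDb; fold D in hDb.
assert (hKw : 0 <= Kw) by (eapply Rle_trans; [apply (norm_pos (W T0)) | apply hW; lra]).
set (X := fun t => W t -v D (W t)).
(* [B (Q V)] is the high frequency part [V - D V] *)
set (Q := fun V : HH => (- tau) *v rot (D V)).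
assert (Qlin : rlinear Q).
{ split; intros; unfold Q.
  - rewrite (proj1 hDlin), (proj1 rot_linear); vec.
  - rewrite (proj2 hDlin), (proj2 rot_linear); vec. }
assert (Qb : bounded_by tau Q).
{ intros V; unfold Q; rewrite norm_scal_eq, Rabs_Ropp, Rabs_pos_eq by lra.
  apply Rmult_le_compat_l; [lra |].
  pose proof (rot_bounded (D V)); pose proof (hDb V); lra. }
assert (Qdom : forall V, dom B (Q V)).
{ intros V; split; unfold Q, D.
  - change (dom L ((- tau) *v res L tau (snd V))); apply dom_vscal, res_dom; assumption.
  - change (dom L ((- tau) *v vopp (res L tau (fst V)))).
    rewrite <- vscal_m1; do 2 apply dom_vscal; apply res_dom; assumption. }
assert (BQ : forall V, B (Q V) = V -v D V).
{ intros V; apply pair_eq; unfold Q, D.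
  - change (L ((- tau) *v vopp (res L tau (fst V))) = fst V -v res L tau (fst V)).
    rewrite <- vscal_m1, <- op_res by assumption.
    rewrite !op_vscal by (try apply dom_vscal; apply res_dom; assumption); vec.
  - change (vopp (L ((- tau) *v res L tau (snd V))) = snd V -v res L tau (snd V)).
    rewrite <- op_res by assumption; rewrite <- vscal_m1.
    rewrite !op_vscal by (apply res_dom; assumption); vec. }
set (dW := fun t => b t *v flip (T (2 * t) (W t))).
set (N := fun t => T (2 * t) (Q (W t))).
set (A0 := / 2 * (tau * Kw * (Cb + / 4))).
assert (hCb0 : 0 <= Cb).
{ eapply Rle_trans; [apply Rabs_pos | apply (hCb 1); lra]. }
assert (hA0 : 0 <= A0).
{ unfold A0; repeat apply Rmult_le_pos; lra. }
assert (hb : forall t, T0 <= t -> 0 <= b t <= / (2 * t)).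
{ intros t ht; split; [apply hbpos; lra |].
  apply Rmult_le_reg_l with (2 * t); [lra |].
  rewrite Rinv_r by lra; pose proof (hsmall t ht); lra. }
assert (hNn : forall t, T0 <= t -> vnorm (N t) <= tau * Kw).
{ intros t ht; unfold N; rewrite (T_norm T Tgroup).
  eapply Rle_trans; [apply Qb |]; apply Rmult_le_compat_l; [lra | apply hW, ht]. }
(* integration by parts: [G] differs from [X] by a term of order [1 / t] *)
set (G := fun t => X t -v (/ 2 * b t) *v flip (N t)).
set (dG := fun t => (- / 2 * db t) *v flip (N t)
  -v (/ 2 * b t) *v flip (T (2 * t) (Q (dW t)))).
assert (hG : forall t, 0 < t -> vder G t (dG t)).
{ intros t ht; pose proof (W_vder t ht) as h1; fold (dW t) in h1.
  pose proof (vder_sub _ _ _ _ _ h1 (vder_linear D 1 _ t _ hDlin hDb h1)) as h2.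
  pose proof (vder_linear Q tau _ t _ Qlin Qb h1) as h3.
  pose proof (T_product B T Tgroup Tgen 2 _ t _ h3 (Qdom _)) as h4.
  pose proof (vder_linear flip 1 _ t _ flip_linear flip_bounded h4) as h5.
  assert (hb2 : is_derive (fun s => / 2 * b s) t (/ 2 * db t)).
  { apply (is_derive_scal b t (/ 2)), hbder, ht. }
  pose proof (vder_sub _ _ _ _ _ h2 (vder_scal _ _ _ _ _ hb2 h5)) as h6.
  eapply vder_eq; [| exact h6].
  unfold dG, N; rewrite BQ.
  assert (e : dW t -v D (dW t) = b t *v flip (T (2 * t) (W t -v D (W t)))).
  { unfold dW; rewrite (proj2 hDlin); unfold D.
    rewrite diag_flip by (apply res_linear; assumption).
    rewrite (res_T L Lsa Lpos T Tgroup Tgen) by exact htau.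
    rewrite (T_sub T Tgroup), (rlinear_sub _ _ _ flip_linear); vec. }
  rewrite e, (proj1 flip_linear), (proj2 flip_linear); vec; field. }
assert (hdG : forall t, T0 <= t -> vnorm (dG t) <= A0 / t ^ 2).
{ intros t ht; assert (ht' : 0 < t) by lra; unfold dG.
  eapply Rle_trans; [apply norm_sub_le |].
  rewrite !norm_scal_eq, !flip_norm, (T_norm T Tgroup), !Rabs_mult, Rabs_Ropp.
  rewrite (Rabs_pos_eq (/ 2)) by lra; rewrite (Rabs_pos_eq (b t)) by (apply hb, ht).
  assert (h1 : vnorm (Q (dW t)) <= tau * (b t * Kw)).
  { eapply Rle_trans; [apply Qb |]; apply Rmult_le_compat_l; [lra |].
    unfold dW; rewrite norm_scal_eq, flip_norm, (T_norm T Tgroup).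
    rewrite Rabs_pos_eq by (apply hb, ht).
    apply Rmult_le_compat_l; [apply hb, ht | apply hW, ht]. }
  pose proof (hNn t ht) as h2; pose proof (hCb t ht') as h3.
  rewrite Rabs_mult, Rabs_pos_eq in h3 by apply pow2_ge_0.
  pose proof (hb t ht) as [h4 h5]; pose proof (Rabs_pos (db t)).
  assert (ht2 : 0 < t ^ 2) by (apply pow_lt; lra).
  assert (h6 : t * b t <= / 2) by (pose proof (hsmall t ht); lra).
  assert (h7 : t ^ 2 * (b t * b t) <= / 4).
  { assert (0 <= t * b t) by (apply Rmult_le_pos; lra).
    replace (t ^ 2 * (b t * b t)) with ((t * b t) * (t * b t)) by ring.
    replace (/ 4) with (/ 2 * / 2) by field; apply Rmult_le_compat; lra. }
  apply Rle_div_r; [exact ht2 |].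
  assert (0 <= tau * Kw) by (apply Rmult_le_pos; lra).
  apply Rle_trans with
    (/ 2 * Rabs (db t) * (tau * Kw) * t ^ 2 + / 2 * b t * (tau * (b t * Kw)) * t ^ 2).
  - rewrite <- Rmult_plus_distr_r; apply Rmult_le_compat_r; [lra |].
    apply Rplus_le_compat; apply Rmult_le_compat_l; try assumption;
      apply Rmult_le_pos; lra.
  - replace (/ 2 * Rabs (db t) * (tau * Kw) * t ^ 2 + / 2 * b t * (tau * (b t * Kw)) * t ^ 2)
      with (/ 2 * (tau * Kw * (t ^ 2 * Rabs (db t) + t ^ 2 * (b t * b t)))) by ring.
    unfold A0; apply Rmult_le_compat_l; [lra |]; apply Rmult_le_compat_l; lra. }
exists (A0 + tau * Kw); split; [assert (0 <= tau * Kw) by (apply Rmult_le_pos; lra); lra |].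
intros s t hs hst.
assert (hGst : vnorm (G t -v G s) <= A0 / s).
{ assert (h : vnorm (G t -v G s) <= - A0 / t - - A0 / s).
  { apply (vder_mean G dG (fun x => - A0 / x) (fun x => A0 / x ^ 2) s t hst).
    - intros x hx; apply hG; lra.
    - intros x hx; auto_derive; [lra | field; lra].
    - intros x hx; apply hdG; lra. }
  assert (0 <= A0 / t) by (apply Rdiv_le_0_compat; lra).
  unfold Rdiv in *; lra. }
assert (hbN : forall r, s <= r -> vnorm ((/ 2 * b r) *v flip (N r)) <= tau * Kw / s * / 2).
{ intros r hr; assert (hr' : T0 <= r) by lra; pose proof (hb r hr') as [h1 h2].
  rewrite norm_scal_eq, flip_norm, Rabs_pos_eq by (apply Rmult_le_pos; lra).
  pose proof (hNn r hr') as h3; pose proof (norm_pos (N r)).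
  assert (h4 : b r <= / s).
  { eapply Rle_trans; [exact h2 |]; apply Rinv_le_contravar; lra. }
  replace (tau * Kw / s * / 2) with (/ 2 * / s * (tau * Kw)) by (field; lra).
  apply Rmult_le_compat; try lra; apply Rmult_le_pos; lra. }
change (vnorm (X t -v X s) <= (A0 + tau * Kw) / s).
replace (X t -v X s) with
  ((G t -v G s) +v ((/ 2 * b t) *v flip (N t) -v (/ 2 * b s) *v flip (N s)))
  by (unfold G; vec).
eapply Rle_trans; [apply norm_add_le |].
pose proof (norm_sub_le ((/ 2 * b t) *v flip (N t)) ((/ 2 * b s) *v flip (N s))).
pose proof (hbN t hst); pose proof (hbN s (Rle_refl s)).
unfold Rdiv in *; lra.
Qed.

End Trajectory.

(** The uniform bound, applied to the solution with data [(1 + tau L)^-1] times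
    the given ones, makes the low frequency part small uniformly in time, because
    these data tend to zero; the high frequency part converges for each [tau]. *)
Lemma scattering (U : R -> HH) u1 : damped T b U -> dom L u1 -> L u1 = fst (U 0) ->
  exists V : HH, forall eps, 0 < eps -> exists S, forall t, S < t ->
    vnorm (lam t *v T (- t) (U t) -v V) < eps.
Proof.
intros hU hu1 e1.
destruct (uniform_bound L Lsa Lpos T Tgroup Tgen b db lam Cb T0
  hbder hbpos hlam hlampos hCb hT0 hsmall) as (K & hK & hbound).
set (W := fun t => lam t *v T (- t) (U t)).
assert (hnorm : forall t (V : HH), vnorm (lam t *v T (- t) V) = lam t * vnorm V).
{ intros t V; rewrite norm_scal_eq, (T_norm T Tgroup), Rabs_pos_eq by (left; apply hlampos).
  reflexivity. }
destruct (norm_cauchy_cv (F := Rbar_locally p_infty) W) as [V hV].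
2: { exists V; intros eps heps; destruct (hV eps heps) as [S hS]; exists S; exact hS. }
intros eps heps.
set (q := eps / (8 * (K + 1))).
assert (hq : 0 < q) by (unfold q; apply Rdiv_lt_0_compat; lra).
destruct (res_to_zero L Lsa Lpos Lker u1 q hq) as (t1 & ht1 & h1).
destruct (res_to_zero L Lsa Lpos Lker (fst (U 0)) (q / 2)) as (t2 & ht2 & h2); [lra |].
destruct (res_to_zero L Lsa Lpos Lker (snd (U 0)) (q / 2)) as (t3 & ht3 & h3); [lra |].
set (tau := t1 + t2 + t3).
assert (htau : 0 < tau) by (unfold tau; lra).
specialize (h1 tau ltac:(unfold tau; lra)); specialize (h2 tau ltac:(unfold tau; lra)).
specialize (h3 tau ltac:(unfold tau; lra)).
set (D := diag (res L tau)).
(* the resolvent of the solution solves the equation for the resolvents of the data *)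
assert (hlow : forall t, T0 <= t -> vnorm (D (W t)) <= eps / 4).
{ intros t ht; unfold W, D.
  rewrite (proj2 (res_diag_linear L Lsa Lpos tau htau)).
  rewrite (res_T L Lsa Lpos T Tgroup Tgen), hnorm by exact htau.
  pose proof (hbound _ (res L tau u1) (damped_res L Lsa Lpos T Tgroup Tgen b U tau htau hU)
    (res_dom L Lsa Lpos tau u1 htau)) as h.
  simpl in h; rewrite <- res_comm_op, e1 in h by assumption.
  specialize (h eq_refl t ht).
  assert (hD0 : vnorm (diag (res L tau) (U 0)) <= q).
  { apply norm_le_of_sq; [lra |]; rewrite prod_rip.
    pose proof (norm_sq_le _ _ (Rlt_le _ _ h2)); pose proof (norm_sq_le _ _ (Rlt_le _ _ h3)).
    simpl in *; nra. }
  assert (e : eps / 4 = 2 * q * (K + 1)) by (unfold q; field; lra).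
  pose proof (norm_pos (res L tau u1)); pose proof (norm_pos (diag (res L tau) (U 0))).
  nra. }
set (Kw := K * (vnorm u1 + vnorm (U 0))).
destruct (high_cauchy U Kw hU) with (tau := tau) as (A & hA & hX).
{ intros t ht; rewrite hnorm; apply (hbound U u1); assumption. }
{ exact htau. }
set (S := T0 + 4 * A / eps).
assert (hAe : 0 <= 4 * A / eps) by (apply Rdiv_le_0_compat; lra).
assert (key : forall s t, S < s -> s <= t -> vnorm (W t -v W s) < eps).
{ intros s t hs hst; assert (hs0 : T0 <= s) by (unfold S in hs; lra).
  pose proof (hX s t hs0 hst) as h.
  change (vnorm ((W t -v D (W t)) -v (W s -v D (W s))) <= A / s) in h.
  assert (hAs : A / s < eps / 4 + eps / 8).
  { apply Rlt_div_l; [lra |].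
    assert (4 * A / eps * eps = 4 * A) by (field; lra).
    unfold S in hs; nra. }
  replace (W t -v W s)
    with (((W t -v D (W t)) -v (W s -v D (W s))) +v (D (W t) -v D (W s))) by vec.
  pose proof (norm_add_le ((W t -v D (W t)) -v (W s -v D (W s))) (D (W t) -v D (W s))).
  pose proof (norm_sub_le (D (W t)) (D (W s))).
  pose proof (hlow t ltac:(lra)); pose proof (hlow s hs0); lra. }
exists (fun t => S < t); split; [exists S; auto |]; intros s t hs ht.
destruct (Rle_or_lt s t); [rewrite norm_sub_sym |]; apply key; lra.
Qed.

End Scattering.

(** * The energy space *)

Section Energy.

Context {H : CHilbert} (L : operator H).
Context (Lsa : self_adjoint L).
Context (Lker : forall x, dom L x -> L x = vzero -> x = vzero).
Notation HH := (prod_CHilbert H H).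
Context (E : energy_space L).

Let JE (e : E) : HH := J E e.

(** The orthogonality condition is void when the kernel is trivial. *)
Lemma predomain_iff (U : HH) : energy_predomain L U <-> dom L (fst U).
Proof.
split; [intros [h _]; exact h | intros h; split; [exact h |]].
intros k [hk e]; rewrite (Lker k hk e).
apply injective_projections.
- apply (rip_zero_r (fst U)).
- pose proof (@inner_scal H (RtoC 0) (vzero : H) (fst U)) as h0.
  change (@scal C_AbsRing H (RtoC 0) vzero) with (0 *v (vzero : H)) in h0.
  rewrite vscal_0 in h0; rewrite (inner_conj H), h0; simpl; ring.
Qed.

Lemma JE_embed (U : HH) : dom L (fst U) -> JE (embed E U) = (L (fst U), snd U).
Proof. intros h; apply J_embed, predomain_iff, h. Qed.

Lemma energy_approx (e : E) eps : 0 < eps -> exists U : HH, dom L (fst U) /\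
  norm (minus (embed E U) e) < eps /\ vnorm (JE (embed E U) -v JE e) < eps.
Proof.
intros heps.
pose proof (proj1 (filterlim_vnorm (H := HH) (F := locally e) JE (JE e))
  (J_continuous L E e) eps heps) as hc.
pose proof (locally_norm_le_locally (V := E) e _ hc) as hc'; destruct hc' as [delta hd].
assert (hm : 0 < Rmin delta eps) by (apply Rmin_pos; [apply cond_pos | exact heps]).
destruct (embed_dense L E e (mkposreal _ hm)) as (y & (U & hU & ->) & hy); simpl in hy.
exists U; split; [apply predomain_iff, hU |].
split; [exact (Rlt_le_trans _ _ _ hy (Rmin_r _ _)) |].
apply hd; exact (Rlt_le_trans _ _ _ hy (Rmin_l _ _)).
Qed.

Lemma JE_near (e : E) eps : 0 < eps -> exists delta, 0 < delta /\
  forall e' : E, norm (minus e' e) < delta -> vnorm (JE e' -v JE e) < eps.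
Proof.
intros heps.
pose proof (proj1 (filterlim_vnorm (H := HH) (F := locally e) JE (JE e))
  (J_continuous L E e) eps heps) as hc.
pose proof (locally_norm_le_locally (V := E) e _ hc) as hc'; destruct hc' as [delta hd].
exists delta; split; [apply cond_pos | exact hd].
Qed.

Definition ecomb (r : R) (e e' : E) : E := minus (rscal r e) e'.

Lemma ecomb_norm r (e e' f f' : E) :
  norm (minus (ecomb r f f') (ecomb r e e'))
  <= Rabs r * norm (minus f e) + norm (minus f' e').
Proof.
replace (minus (ecomb r f f') (ecomb r e e'))
  with (minus (rscal r (minus f e)) (minus f' e')).
- unfold minus at 1; eapply Rle_trans; [apply (@norm_triangle C_AbsRing E) |].
  apply Rplus_le_compat; [apply (norm_rscal E) |].
  rewrite (@norm_opp C_AbsRing E); apply Rle_refl.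
- unfold ecomb, minus, rscal.
  rewrite (@scal_distr_l C_AbsRing E), (@scal_opp_r C_AbsRing E).
  rewrite !(@opp_plus E), !(@opp_opp E), <- !(@plus_assoc E); f_equal.
  rewrite !(@plus_assoc E); f_equal; apply (@plus_comm E).
Qed.

Lemma embed_comb r (U V : HH) : dom L (fst U) -> dom L (fst V) ->
  ecomb r (embed E U) (embed E V) = embed E (r *v U -v V).
Proof.
intros hU hV.
assert (hV' : energy_predomain L ((-1) *v V)) by (apply predomain_iff, dom_vscal, hV).
assert (hU' : energy_predomain L (r *v U)) by (apply predomain_iff, dom_vscal, hU).
replace (r *v U -v V) with (r *v U +v (-1) *v V) by vec.
etransitivity; [| symmetry; apply (embed_plus L E _ _ hU' hV')].
unfold ecomb, minus; f_equal.
- symmetry; apply (embed_scal L E (RtoC r)), predomain_iff, hU.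
- etransitivity; [| symmetry; apply (embed_scal L E (RtoC (-1))), predomain_iff, hV].
  rewrite <- (@scal_opp_one C_AbsRing E).
  apply (f_equal (fun c => @scal C_AbsRing E c (embed E V))).
  unfold RtoC, opp, one; simpl; unfold Copp, RtoC; simpl; f_equal; ring.
Qed.

(** [embed] and [J] are linear on a dense set, and [J] is continuous. *)
Lemma JE_comb r (e e' : E) : JE (ecomb r e e') = r *v JE e -v JE e'.
Proof.
apply vsub_0_eq, norm_le_eps; intros eps heps.
pose proof (Rabs_pos r).
destruct (JE_near (ecomb r e e') (eps / 2)) as (delta & hdelta & hd); [lra |].
set (q := Rmin delta (eps / 2) / (Rabs r + 2)).
assert (hm : 0 < Rmin delta (eps / 2)) by (apply Rmin_pos; lra).
assert (hq : 0 < q) by (unfold q; apply Rdiv_lt_0_compat; lra).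
assert (hqm : q * (Rabs r + 2) = Rmin delta (eps / 2)) by (unfold q; field; lra).
pose proof (Rmin_l delta (eps / 2)); pose proof (Rmin_r delta (eps / 2)).
destruct (energy_approx e q hq) as (U & hU & n1 & n2).
destruct (energy_approx e' q hq) as (V & hV & n3 & n4).
pose proof (ecomb_norm r e e' (embed E U) (embed E V)) as n5.
assert (n6 : vnorm (JE (ecomb r (embed E U) (embed E V)) -v JE (ecomb r e e')) < eps / 2).
{ apply hd; nra. }
rewrite embed_comb, JE_embed in n6
  by (assumption || (apply dom_sub; [apply dom_vscal |]; assumption)).
assert (ec : ((L (fst (r *v U -v V)), snd (r *v U -v V)) : HH)
  = r *v JE (embed E U) -v JE (embed E V)).
{ rewrite !JE_embed by assumption; apply pair_eq; [| reflexivity].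
  change (L (r *v (fst U : H) -v fst V) = r *v L (fst U) -v L (fst V)).
  rewrite op_sub, op_vscal by (try apply dom_vscal; assumption); reflexivity. }
rewrite ec in n6.
set (a := JE (embed E U)) in *; set (c := JE (embed E V)) in *.
replace (JE (ecomb r e e') -v (r *v JE e -v JE e'))
  with (((r *v (a -v JE e)) -v (c -v JE e')) -v ((r *v a -v c) -v JE (ecomb r e e'))) by vec.
pose proof (norm_sub_le ((r *v (a -v JE e)) -v (c -v JE e'))
  ((r *v a -v c) -v JE (ecomb r e e'))) as m1.
pose proof (norm_sub_le (r *v (a -v JE e)) (c -v JE e')) as m2.
rewrite norm_scal_eq in m2.
assert (Rabs r * vnorm (a -v JE e) <= Rabs r * q) by (apply Rmult_le_compat_l; lra).
nra.
Qed.

Lemma JE_norm (e : E) : vnorm (JE e) = norm e.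
Proof.
apply cond_eq; intros eps heps.
destruct (energy_approx e (eps / 2)) as (U & hU & n1 & n2); [lra |].
assert (eU : vnorm (JE (embed E U)) = norm (embed E U)).
{ rewrite JE_embed by exact hU.
  rewrite (embed_norm L E U) by (apply predomain_iff, hU); reflexivity. }
assert (h1 : Rabs (norm (embed E U) - norm e) <= norm (minus (embed E U) e))
  by exact (@norm_triangle_inv C_AbsRing E (embed E U) e).
pose proof (norm_add_le (JE (embed E U) -v JE e) (JE e)) as h2.
pose proof (norm_sub_le (JE (embed E U)) (JE (embed E U) -v JE e)) as h3.
replace (JE (embed E U) -v JE e +v JE e) with (JE (embed E U)) in h2 by vec.
replace (JE (embed E U) -v (JE (embed E U) -v JE e)) with (JE e) in h3 by vec.
apply Rabs_le_between in h1; apply Rabs_lt_between; split; lra.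
Qed.

Lemma JE_sub_norm (e e' : E) : norm (minus e e') = vnorm (JE e -v JE e').
Proof.
assert (h : ecomb 1 e e' = minus e e').
{ unfold ecomb; f_equal; apply (@scal_one C_AbsRing E). }
rewrite <- h, <- JE_norm, JE_comb; f_equal; vec.
Qed.

(** The range of [J] contains [Ran L x H], is dense because the kernel is
    trivial, and is closed because [J] is isometric and [E] complete. *)
Lemma JE_surjective (V : HH) : exists e : E, JE e = V.
Proof.
assert (hdense : forall eps, 0 < eps -> exists e : E, vnorm (JE e -v V) < eps).
{ intros eps heps; destruct (range_dense L Lsa Lker (fst V) eps heps) as (y & hy & h).
  exists (embed E ((y, snd V) : HH)); rewrite JE_embed by exact hy.
  eapply Rle_lt_trans; [| exact h].
  apply norm_le_of_sq; [apply norm_pos |]; rewrite <- rip_norm, prod_rip.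
  change (rip (L y -v fst V) (L y -v fst V)
    + rip ((snd V : H) -v snd V) ((snd V : H) -v snd V)
    <= rip (L y -v fst V) (L y -v fst V)).
  rip_simpl; lra. }
set (F := near_min (fun _ : E => True) (fun e => vnorm (JE e -v V))).
assert (PF : ProperFilter F).
{ apply near_min_proper; intros d hd; destruct (hdense d hd) as (e & he); exists e; auto. }
destruct (proj1 (filterlim_locally_cauchy (U := E) (F := F) (fun e => e))) as [e he].
{ intros eps; exists (fun e : E => vnorm (JE e -v V) < eps / 2).
  pose proof (cond_pos eps); split; [exists (eps / 2); split; [lra | auto] |].
  intros e e' h h'; apply (norm_compat1 (V := E)); rewrite JE_sub_norm.
  pose proof (norm_sub_trans (JE e') V (JE e)) as n; rewrite (norm_sub_sym V) in n; lra. }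
exists e; apply vsub_0_eq, norm_le_eps; intros eps heps.
pose proof (proj1 (filterlim_locally_ball_norm (U := E) (F := F) (fun e => e) e) he
  (mkposreal (eps / 2) ltac:(lra))) as (d & hd & h).
destruct (hdense (Rmin d (eps / 2))) as (e' & he'); [apply Rmin_pos; lra |].
pose proof (Rmin_l d (eps / 2)); pose proof (Rmin_r d (eps / 2)).
specialize (h e' I ltac:(lra)); unfold ball_norm in h; simpl in h.
rewrite JE_sub_norm in h.
pose proof (norm_sub_trans (JE e) (JE e') V) as n; rewrite (norm_sub_sym (JE e) (JE e')) in n; lra.
Qed.

End Energy.

(** * The dissipation coefficient *)

Lemma C1_half_line_der (b db : R -> R) t :
  C1_half_line b db -> 0 <= t -> forall eps, 0 < eps -> exists delta, 0 < delta /\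
    forall s, 0 <= s -> Rabs (s - t) < delta ->
      Rabs (b s - b t - (s - t) * db t) <= eps * Rabs (s - t).
Proof.
intros hC ht eps heps.
destruct (proj1 (filterlim_locally (F := within (Rle 0) (locally' t)) _ _)
  (proj1 (hC t ht)) (mkposreal eps heps)) as [delta hd].
exists delta; split; [apply cond_pos |]; intros s hs hst.
destruct (Req_dec s t) as [-> | hne].
{ replace (b t - b t - (t - t) * db t) with 0 by ring.
  rewrite Rabs_R0; apply Rmult_le_pos; [lra | apply Rabs_pos]. }
specialize (hd s hst hne hs).
change (Rabs ((b s - b t) / (s - t) - db t) < eps) in hd.
replace (b s - b t - (s - t) * db t) with (((b s - b t) / (s - t) - db t) * (s - t))
  by (field; lra).
rewrite Rabs_mult; apply Rmult_le_compat_r; [apply Rabs_pos | lra].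
Qed.

Lemma C1_half_line_hrcont b db : C1_half_line b db -> hrcont b.
Proof.
intros hC t ht eps heps.
destruct (C1_half_line_der b db t hC ht 1) as (delta & hdelta & hd); [lra |].
pose proof (Rabs_pos (db t)).
exists (Rmin delta (eps / (Rabs (db t) + 2))); split.
{ apply Rmin_pos; [lra | apply Rdiv_lt_0_compat; lra]. }
intros s hs hst; assert (h1 := Rlt_le_trans _ _ _ hst (Rmin_l _ _)).
assert (h2 := Rlt_le_trans _ _ _ hst (Rmin_r _ _)).
specialize (hd s hs h1).
pose proof (Rabs_triang (b s - b t - (s - t) * db t) ((s - t) * db t)) as h3.
replace (b s - b t - (s - t) * db t + (s - t) * db t) with (b s - b t) in h3 by ring.
rewrite Rabs_mult in h3.
apply Rlt_div_r in h2; [| lra]; pose proof (Rabs_pos (s - t)); nra.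
Qed.

Lemma C1_half_line_is_derive b db t : C1_half_line b db -> 0 < t -> is_derive b t (db t).
Proof.
intros hC ht; apply is_derive_eps; intros eps heps.
destruct (C1_half_line_der b db t hC (Rlt_le _ _ ht) eps heps) as (delta & hdelta & hd).
exists (Rmin delta t); split; [apply Rmin_pos; assumption |]; intros h hh.
assert (h1 := Rlt_le_trans _ _ _ hh (Rmin_l _ _)).
assert (h2 := Rlt_le_trans _ _ _ hh (Rmin_r _ _)); apply Rabs_lt_between in h2.
specialize (hd (t + h) ltac:(lra)).
replace (t + h - t) with h in hd by ring; apply hd, h1.
Qed.

Lemma limsup_lt (f : R -> R) (c : R) : Rbar_lt (limsup_infty f) (Finite c) ->
  exists T, 0 <= T /\ forall t, T <= t -> f t <= c.
Proof.
intros h; apply Classical_Prop.NNPP; intros hn.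
unfold limsup_infty, Rbar_glb in h; revert h.
destruct (Rbar_ex_glb _) as [g [hlb hglb]]; simpl; intros h.
apply (Rbar_lt_not_le _ _ h), hglb; intros M (T & hT & ->).
apply Rbar_not_lt_le; intros hlt; apply hn; exists T; split; [exact hT |].
intros t ht.
destruct (Lub_Rbar_correct (fun y => exists t, T <= t /\ y = f t)) as [hub _].
pose proof (hub (f t) (ex_intro _ t (conj ht eq_refl))) as h1.
pose proof (Rbar_le_lt_trans _ _ _ h1 hlt) as h2; simpl in h2; lra.
Qed.

Lemma decay_bound (d C t : R) : Rabs d <= C * / bracket t ^ 2 -> Rabs (t ^ 2 * d) <= C.
Proof.
unfold bracket; intros h.
rewrite pow2_sqrt in h by (pose proof (pow2_ge_0 t); lra).
pose proof (pow2_ge_0 t); pose proof (Rabs_pos d).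
apply Rle_div_r in h; [| lra].
rewrite Rabs_mult, (Rabs_pos_eq (t ^ 2)) by assumption; lra.
Qed.

Lemma free_damped {H : CHilbert} (T : R -> prod_CHilbert H H -> prod_CHilbert H H) V :
  unitary_group T -> damped T (fun _ => 0) (fun t => T t V).
Proof.
intros hT; split.
- intros t _ eps heps; destruct (T_vcont T hT 1 t V eps heps) as (d & hd & h).
  exists d; split; [exact hd |]; intros s _ hs; specialize (h (s - t) hs).
  rewrite !Rmult_1_l in h; replace (t + (s - t)) with s in h by ring; exact h.
- intros t ht; apply vder_ext_loc with (fun _ => V) 1; [lra | |].
  + intros s _; rewrite (T_inv T hT); reflexivity.
  + apply vder_eq with vzero; [vec | apply vder_const].
Qed.

(** * The wave operator *)

Theorem theorem1p2
  (H : CHilbert) (Hsep : separable H)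
  (A : operator H)
  (Aclosed : closed_operator A) (Asa : self_adjoint A) (Apos : nonneg_operator A)
  (L : operator H) (HL : is_sqrt_operator A L)
  (E : energy_space L)
  (E0 : R -> prod_CHilbert H H -> prod_CHilbert H H)
  (E0group : unitary_group E0) (E0gen : generates (wave_operator L) E0)
  (b db : R -> R) (bC1 : C1_half_line b db)
  (A1 : forall t, 0 <= t -> 0 <= b t)
  (C1 C2 : R)
  (A2 : forall t, 0 <= t ->
     Rabs (b t) <= C1 * / bracket t /\ Rabs (db t) <= C2 * / bracket t ^ 2)
  (blimsup : Rbar_lt (limsup_infty (fun t => t * b t)) (Finite (1 / 2)))
  (kerA : forall x, in_kernel A x -> x = zero) :
  forall u1 u2 : H, dom L u1 ->
  exists v0 : E,
  forall u v : R -> E,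
    energy_solution E E0 b (embed E (u1, u2)) u ->
    energy_solution E E0 (fun _ => 0) v0 v ->
    filterlim
      (fun t => norm (minus (rscal (exp (RInt b 0 t)) (u t)) (v t)))
      (Rbar_locally p_infty) (locally 0).
Proof.
intros u1 u2 hu1.
destruct HL as (Lsa & Lpos & Lsq).
assert (Lker : forall x, dom L x -> L x = vzero -> x = vzero).
{ intros x hx e; apply kerA.
  destruct (proj2 (Lsq x zero)) as [hA eA]; [| split; [exact hA | symmetry; exact eA]].
  exists vzero; split; [split; [exact hx | symmetry; exact e] |].
  split; [apply dom_zero | symmetry; apply op_zero]. }
(* The data [v0] are chosen before [u]; by uniqueness any solution determines
   them, and without a solution nothing is claimed. *)
destruct (Classical_Prop.classic
  (exists u, energy_solution E E0 b (embed E (u1, u2)) u)) as [[u0 hu0] | hno].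
2: { exists zero; intros u v hu _; exfalso; apply hno; exists u; exact hu. }
pose proof (C1_half_line_hrcont b db bC1) as hbc.
destruct (limsup_lt _ _ blimsup) as (T1 & _ & hT1).
(* [bb] extends [b] continuously to the whole line *)
set (bb := fun t => b (Rmax 0 t)).
set (lam := fun t => exp (RInt bb 0 t)).
assert (hbb : forall t, continuous bb t).
{ intros t; apply rcont_continuous, hrcont_extend, hbc. }
assert (hlam : forall t, 0 < t -> is_derive lam t (b t * lam t)).
{ intros t ht.
  assert (hI : is_derive (fun t => RInt bb 0 t) t (bb t)).
  { apply (is_derive_RInt (V := R_NormedModule) bb _ 0); [| apply hbb].
    apply filter_forall; intros s; apply (RInt_correct (V := R_CompleteNormedModule)).
    apply (ex_RInt_continuous (V := R_CompleteNormedModule)); intros; apply hbb. }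
  replace (b t) with (bb t) by (unfold bb; rewrite Rmax_right; lra).
  apply (is_derive_comp exp (fun t => RInt bb 0 t) t (lam t) (bb t));
    [apply is_derive_exp | exact hI]. }
assert (elam : forall t, 0 <= t -> exp (RInt b 0 t) = lam t).
{ intros t ht; unfold lam; f_equal; apply RInt_ext; intros s hs.
  rewrite Rmin_left in hs by exact ht; unfold bb; rewrite Rmax_right; lra. }
set (JU := fun (w : R -> E) t => J E (w t) : prod_CHilbert H H).
destruct (mild_damped E0 E0group b _ (JU u0) hbc hu0) as [hU0 eU0].
destruct (scattering L Lsa Lpos Lker E0 E0group E0gen b db lam C2 (Rmax 1 T1))
  with (U := JU u0) (u1 := u1) as (V & hV).
{ intros t ht; apply C1_half_line_is_derive; assumption. }
{ exact A1. }
{ exact hlam. }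
{ intros t; apply exp_pos. }
{ intros t ht; apply decay_bound, A2; lra. }
{ apply Rmax_l. }
{ intros t ht; apply hT1; eapply Rle_trans; [apply Rmax_r | exact ht]. }
{ exact hU0. }
{ exact hu1. }
{ rewrite eU0, (JE_embed L Lker E) by exact hu1; reflexivity. }
destruct (JE_surjective L Lsa Lker E V) as [v0 ev0].
exists v0; intros u v hu hv.
destruct (mild_damped E0 E0group b _ (JU u) hbc hu) as [hU eU].
assert (h0c : hrcont (fun _ => 0)).
{ intros t _ eps heps; exists 1; split; [lra |]; intros s _ _.
  rewrite Rminus_diag, Rabs_R0; exact heps. }
destruct (mild_damped E0 E0group (fun _ => 0) _ (JU v) h0c hv) as [hVd eV].
assert (eu : forall t, 0 <= t -> JU u t = JU u0 t).
{ apply (damped_unique E0 E0group b); auto; rewrite eU, eU0; reflexivity. }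
assert (evt : forall t, 0 <= t -> JU v t = E0 t V).
{ apply (damped_unique E0 E0group (fun _ => 0)).
  - intros; lra.
  - exact hVd.
  - apply free_damped, E0group.
  - rewrite eV, (T_0 E0 E0group); exact ev0. }
apply filterlim_locally; intros eps.
destruct (hV eps (cond_pos eps)) as [S hS].
exists (Rmax 0 S); intros t ht.
assert (ht0 : 0 <= t) by (pose proof (Rmax_l 0 S); lra).
assert (htS : S < t) by (pose proof (Rmax_r 0 S); lra).
change (Rabs (norm (minus (rscal (exp (RInt b 0 t)) (u t)) (v t)) - 0) < eps).
rewrite elam, Rminus_0_r, Rabs_pos_eq by (exact ht0 || apply (@norm_ge_0 C_AbsRing E)).
change (norm (ecomb L E (lam t) (u t) (v t)) < eps).
rewrite <- (JE_norm L Lker E), (JE_comb L Lker E).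
change (vnorm (lam t *v JU u t -v JU v t) < eps).
rewrite eu, evt by exact ht0.
rewrite <- (T_norm E0 E0group (- t)), (T_sub E0 E0group), (T_inv E0 E0group).
rewrite (T_scal E0 E0group); apply hS, htS.
Qed.
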